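(* Let $1<p<\infty$, $0<q<\infty$, let $a$ and $b$ be normal form parameters, and let $C>0$. (i) If $a(x)\le Cb(x)$ for all $x>0$, then $N_{p,q}(a)\le C^{1/p'}N_{p,q}(b)$. (ii) If $1<p\le q<\infty$ and $b$ is a normal form parameter, then $$\max\big(A_0,\;K_{p,q}A_0^{(0)},\;K_{p,q}A_0^{(\infty)}\big)\le N_{p,q}(b)\le K_{p,q}A_0.$$ (iii) If $1<p\le q<\infty$, $b$ is a normal form parameter, and $A_0=A_0^{(0)}$ or $A_0=A_0^{(\infty)}$, then $N_{p,q}(b)=K_{p,q}A_0$. Here, for $1<p\le q<\infty$, $c_0(x)=b(x)^{1/p'}x^{1/q}$ and $$A_0=\sup_{x>0}c_0(x),\quad A_0^{(0)}=\liminf_{x\to0^+}c_0(x),\quad A_0^{(\infty)}=\liminf_{x\to\infty}c_0(x).$$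
   Context: $L^+$ is the set of Lebesgue measurable functions $(0,\infty)\to[0,\infty]$ and $\|\cdot\|_p$ is the usual $L^p$ (quasi-)norm for Lebesgue measure on $(0,\infty)$; $p'$ denotes the conjugate exponent, $\frac1p+\frac1{p'}=1$. A normal form parameter is a non-increasing function $b:(0,\infty)\to[0,\infty]$. Put $H_bf(x)=\int_0^{b(x)}f(t)\,dt$ for $f\in L^+$, and let $N_{p,q}(b)\in[0,\infty]$ be the smallest $C$ such that $\|H_bf\|_q\le C\|f\|_p$ for all $f\in L^+$ with $\|f\|_p<\infty$. For $1<p\le q<\infty$ the constant $K_{p,q}$ is $$K_{p,q}=p^{1/p}(p')^{1/p'}\ \text{ if }p=q,\qquad K_{p,q}=\Big(\frac{\Gamma(s)}{\Gamma(s/p)\Gamma(s/q')}\Big)^{1/s}\ \text{ if }p<q,\ \text{ where }\tfrac1s=\tfrac1p-\tfrac1q.$$ (By classical results of Hardy ($p=q$) and Bliss ($p<q$), $N_{p,q}(x^{-p'/q})=K_{p,q}$.) *)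

(* Defs.v *)
From HB Require Import structures.
From mathcomp Require Import all_boot all_order all_algebra.
From mathcomp Require Import all_classical all_reals all_analysis.
From mathcomp Require Import measurable_realfun.

Set Implicit Arguments.
Unset Strict Implicit.
Unset Printing Implicit Defensive.

Import Order.TTheory GRing.Theory Num.Theory.
Import numFieldNormedType.Exports.

Local Open Scope classical_set_scope.
Local Open Scope ring_scope.
Local Open Scope ereal_scope.

(* The real line with the sigma-algebra of all Lebesgue measurable sets,
   whereas the canonical structure on [R] is the Borel sigma-algebra. *)
Definition lebesgueR (R : realType) : measurableType _ :=
  caratheodory_type (@wlength R idfun)^*%mu.

Section normal_form.
Context {R : realType}.
Implicit Types (p q s x t : R) (f b : R -> \bar R).

Local Notation mu :=
  (@completed_lebesgue_measure R : {measure set (lebesgueR R) -> \bar R}).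

(* Functions on (0, +oo) are represented by total functions whose values
   outside (0, +oo) are irrelevant. *)
Definition Lplus f :=
  measurable_fun (T := lebesgueR R) `]0%R, +oo[ f /\
  forall x, (0 < x)%R -> 0 <= f x.

Definition normL p f : \bar R := 'N[mu]_p%:E[f \_ `]0%R, +oo[].

Definition conj_exponent p : R := fine (hoelder_conjugate p%:E).

Definition normal_form_parameter b :=
  {in `]0%R, +oo[ &, nonincreasing_fun b} /\ forall x, (0 < x)%R -> 0 <= b x.

Definition hardy_op b f x : \bar R :=
  \int[mu]_(t in [set t : R | (0 < t)%R /\ t%:E < b x]) f t.

Definition bounding_constant p q b (C : \bar R) :=
  0 <= C /\
  forall f, Lplus f -> normL p f < +oo ->
    normL q (hardy_op b f) <= C * normL p f.

(* By [hardy_norm_bounding] below, this infimum is attained. *)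
Definition hardy_norm p q b : \bar R := ereal_inf (bounding_constant p q b).

Definition Gamma s : R :=
  (\int[@lebesgue_measure R]_(t in `]0, +oo[) (t `^ (s - 1) * expR (- t)))%R.

Definition K_ p q : R :=
  if p == q then (p `^ p^-1 * conj_exponent p `^ (conj_exponent p)^-1)%R
  else let s := ((p^-1 - q^-1)^-1)%R in
    ((Gamma s / (Gamma (s / p) * Gamma (s / conj_exponent q))) `^ s^-1)%R.

Definition c0 p q b x : \bar R :=
  b x `^ (conj_exponent p)^-1 * (x `^ q^-1)%:E.

Definition A0 p q b : \bar R := ereal_sup (c0 p q b @` `]0%R, +oo[).

Definition A0_zero p q b : \bar R := limf_einf (c0 p q b) (0%R : R)^'+.

Definition A0_infty p q b : \bar R := limf_einf (c0 p q b) (pinfty_nbhs R).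

Lemma conj_exponentE p : (1 < p)%R -> conj_exponent p = (p / (p - 1))%R.
Proof.
move=> p1; rewrite /conj_exponent /hoelder_conjugate /= eqe.
rewrite gt_eqF ?(lt_trans ltr01)// -EFinD inver gt_eqF ?subr_gt0//.
Qed.

Lemma hardy_norm_bounding p q b : (0 < p)%R -> (0 < q)%R ->
  bounding_constant p q b (hardy_norm p q b).
Proof.
move=> p0 q0.
have N0 : 0 <= hardy_norm p q b by apply: le_ereal_inf_tmp => C [].
have mpos : measurable (`]0%R, +oo[ : set (lebesgueR R)).
  apply: sub_caratheodory.
  exact: (@measurable_itv R).
split=> // f Lf nf.
have [n0|nN0] := eqVneq (normL p f) 0.
  rewrite n0 mule0.
  have [mf f0] := Lf.
  have f0ae : f \_ `]0%R, +oo[ = \0 %[ae mu].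
    apply: (@Lnorm_eq0_eq0 _ (lebesgueR R) _ mu _ p%:E) => //.
    exact/(measurable_restrictT _ mpos).
  have Hf0 x : hardy_op b f x = 0.
    rewrite /hardy_op.
    set D := [set t : R | _].
    have Dsub : D `<=` `]0%R, +oo[ by move=> t [t0 _]; rewrite /= in_itv /= t0.
    have mD : measurable (D : set (lebesgueR R)).
      apply: sub_caratheodory.
      case: (b x) @D {Dsub} => [r| |] D.
      - suff -> : D = `]0%R, r[%classic by exact: (@measurable_itv R).
        by apply/seteqP; split=> t; rewrite /D /= in_itv /= lte_fin => /andP.
      - suff -> : D = `]0%R, +oo[%classic by exact: (@measurable_itv R).
        apply/seteqP; split=> t; rewrite /D /= in_itv /= andbT; first by case.
        by rewrite ltry.
      - suff -> : D = set0 by exact: measurable0.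
        by apply/seteqP; split=> t // [].
    rewrite -(@integral0 _ (lebesgueR R) R mu D).
    apply: ae_eq_integral => //.
    - exact: measurable_funS mf.
    - apply: (@filterS _ _ (ae_filter_ringOfSetsType mu)) f0ae => t; rewrite /patch /= => + /= Dt.
      by rewrite mem_set; [apply|exact: Dsub].
  rewrite /normL (_ : hardy_op b f \_ _ = cst 0) ?Lnorm0 ?eqe ?gt_eqF//.
  by apply/funext => x; rewrite /patch Hf0 if_same.
have np0 : 0 < normL p f by rewrite lt0e nN0 Lnorm_ge0.
have /fineK nE : normL p f \is a fin_num by rewrite ge0_fin_numE// ltW.
rewrite -nE -lee_pdivrMr ?fine_gt0 ?np0//.
apply: le_ereal_inf_tmp => C [_ /(_ f Lf nf)].
by rewrite -{1}nE lee_pdivrMr// fine_gt0// np0.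
Qed.

End normal_form.

(* Main.v *)
(** By monotonicity and dilation everything reduces to the power forms
    [b x = c x ^ (- p' / q)], for which the upper bound is the inequality of Hardy
    and Bliss.  With [F] the primitive of [f] and [X = F ^ p y ^ (1 - p)], it is
    proved by a calibration: tangent inequalities (Young) give
    [f ^ p >= z X' + phi (z) X / y] for every slope [z] in [[0, 1]], where
    [phi z = (p - 1) (z - z ^ p')].  Choosing [z] with
    [phi z = lam X ^ ((q - p) / p)], on the decreasing branch of [phi] until [X]
    reaches its maximum and on the increasing branch afterwards, the Legendre
    transform [z X + S z] with [S' = - (phi / lam) ^ (p / (q - p))] makes
    [z X'] exact, so that the integral of [f ^ p] is at least [lam] times that
    of [F ^ q y ^ (- q / p' - 1)] plus [S 0]; optimizing over [lam] gives the
    sharp constant, [S 0] being a Beta integral.  For [p = q] the slope [z] is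
    constant.

    The lower bounds come from test functions: indicators for [A_0], and for the
    two lower limits the extremals of Bliss ([p < q]) or truncated powers
    ([p = q]), dilated towards [0] or infinity, where [b] dominates a power. *)

Require Import Defs.
From HB Require Import structures.
From mathcomp Require Import all_boot all_order all_algebra.
From mathcomp Require Import all_classical all_reals all_analysis.
From mathcomp Require Import measurable_realfun ring lra.

Import Order.TTheory GRing.Theory Num.Theory.
Import numFieldNormedType.Exports.

Local Open Scope classical_set_scope.
Local Open Scope ring_scope.
Local Open Scope ereal_scope.

Set Implicit Arguments.
Unset Strict Implicit.
Unset Printing Implicit Defensive.

(** * Power inequalities *)

Section real_powers.
Context {R : realType}.
Local Open Scope ring_scope.
Implicit Types (a b c e k p q x y z u v : R).

(** Everything is done on increments: Young's inequality is integrated over an interval with a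
    constant weight, the convex functions [x ^ p] and [y ^ (1 - p)] are replaced by their tangents,
    and increments whose errors are small relative to those of [F y + y] are added up by a supremum
    argument. The slope [z] is selected pointwise, without continuity; the inequalities for
    [z X + S z] rest on the convexity of [S] on one branch and its concavity on the other, which
    decides at which endpoint of an increment the slope is taken. The argument runs on [[a, b]] with
    [0 < a] and with the primitive started at [a]: then [F a = 0] while no negative power is
    singular, and monotone convergence removes the truncation. Since [f] is only Lebesgue
    measurable, dilating it needs the scaling of the completed measure, whereas the explicit
    integrals are Borel and come from Tonelli's theorem in place of nonlinear substitutions. *)

Lemma powR_tangent e x y : 1 < e -> 0 <= x -> 0 <= y ->
  y `^ e + e * y `^ (e - 1) * (x - y) <= x `^ e.
Proof.
move=> e1 x0 y0.
have e0 : 0 < e by lra.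
have ek : e^-1 + (e / (e - 1))^-1 = 1 by field; lra.
have := @conjugate_powR R x (y `^ (e - 1)) e (e / (e - 1)) x0 (powR_ge0 _ _) e0.
rewrite divr_gt0 ?subr_gt0// => /(_ isT ek).
rewrite -powRrM (_ : (e - 1) * (e / (e - 1)) = e); last by field; lra.
have yE : y `^ (e - 1) * y = y `^ e.
  by rewrite mulrC mulr_powRB1.
rewrite mulrBr -!mulrA yE => h.
have : e * (x * y `^ (e - 1)) <= e * (x `^ e / e + y `^ e / (e / (e - 1))).
  by rewrite ler_pM2l.
have -> : e * (x `^ e / e + y `^ e / (e / (e - 1))) = x `^ e + (e - 1) * y `^ e.
  by field; lra.
clear; rewrite (mulrC x); lra.
Qed.

(** With [t = x / y] the claim is [t ^ (- e) >= 1 - e (t - 1)], which is [expR u >= 1 + u] used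
    twice: for [u = - e ln t] and, in the form [ln t <= t - 1], for [u = t - 1], after [expR] has
    been applied. *)
Lemma powRN_tangent e x y : 0 < e -> 0 < x -> 0 < y ->
  y `^ (- e) - e * y `^ (- e - 1) * (x - y) <= x `^ (- e).
Proof.
move=> e0 x0 y0.
have -> : y `^ (- e - 1) = y `^ (- e) * y^-1.
  by rewrite powRD ?powR_inv1 ?(ltW y0)//; apply/implyP => _; rewrite gt_eqF.
have xE : x = (x / y) * y by field; rewrite gt_eqF.
have xy0 : 0 < x / y by rewrite divr_gt0.
have -> : y `^ (- e) - e * (y `^ (- e) / y) * (x - y) =
   (1 - e * (x / y - 1)) * y `^ (- e) by field; rewrite gt_eqF.
rewrite [in leRHS]xE powRM ?(ltW xy0) ?(ltW y0)//.
rewrite ler_pM2r ?powR_gt0// /powR gt_eqF//.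
apply: le_trans (expR_ge1Dx _).
have : ln (x / y) <= x / y - 1.
  by rewrite -ler_expR lnK ?posrE//; have := expR_ge1Dx (x / y - 1); lra.
by rewrite mulNr lerD2l lerN2 => h; rewrite ler_wpM2l// ltW.
Qed.

Lemma powR_near_gt0 e x : 0 < x -> forall eps, 0 < eps ->
  exists2 d, 0 < d & forall y, `|y - x| < d -> `|y `^ e - x `^ e| < eps.
Proof.
move=> x0 eps eps0.
have : derivable (fun y => y `^ e) x 1 by apply: derivable_powR; rewrite in_itv/= x0.
move=> /derivable1_diffP/differentiable_continuous /cvgrPdist_lt/(_ _ eps0).
move=> /nbhs_ballP[d /= d0 dP].
exists d => // y yx; rewrite distrC; apply: dP.
by rewrite /ball/= distrC.
Qed.

Lemma powR_near e x : 0 < e -> 0 <= x -> forall eps, 0 < eps ->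
  exists2 d, 0 < d & forall y, 0 <= y -> `|y - x| < d -> `|y `^ e - x `^ e| < eps.
Proof.
move=> e0; rewrite le_eqVlt => /predU1P[<-|x0] eps eps0.
  exists (eps `^ e^-1); first by rewrite powR_gt0.
  move=> y y0; rewrite !subr0 powR0 ?gt_eqF// subr0 !ger0_norm ?powR_ge0// => yd.
  have := gt0_ltr_powR e0 _ _ yd; rewrite !nnegrE powR_ge0 y0 -powRrM mulVf ?gt_eqF//.
  by rewrite powRr1 ?(ltW eps0)//; apply.
have [d d0 dP] := powR_near_gt0 e x0 eps0; exists d => // y _; exact: dP.
Qed.

Lemma mulr_near a b : forall eps, 0 < eps ->
  exists2 d, 0 < d & forall x y, `|x - a| < d -> `|y - b| < d ->
    `|x * y - a * b| < eps.
Proof.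
move=> eps eps0; pose M := `|a| + `|b| + 1.
have M0 : 0 < M by rewrite /M ltr_wpDl// addr_ge0.
exists (Num.min 1 (eps / M)); first by rewrite lt_min ltr01 divr_gt0.
move=> x y; rewrite !lt_min => /andP[x1 xe] /andP[y1 ye].
have -> : x * y - a * b = (x - a) * y + a * (y - b) by ring.
apply: le_lt_trans (ler_normD _ _) _; rewrite !normrM.
have yb : `|y| < 1 + `|b|.
  by rewrite -[y](subrK b); apply: le_lt_trans (ler_normD _ _) _; rewrite ltrD2r.
have : `|x - a| * `|y| <= (eps / M) * `|y| by rewrite ler_wpM2r// ltW.
have : `|a| * `|y - b| <= `|a| * (eps / M) by rewrite ler_wpM2l// ltW.
have : (eps / M) * `|y| < (eps / M) * (1 + `|b|) by rewrite ltr_pM2l// divr_gt0.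
have : (eps / M) * (1 + `|b|) + `|a| * (eps / M) = eps.
  by rewrite /M; field; rewrite -/M gt_eqF.
clear; lra.
Qed.

(* The supremum of the admissible right endpoints is [b], as in the proof of
   the mean value inequality. *)
Lemma straddle_le a b (D M : R -> R) : a <= b ->
  (forall eps, 0 < eps -> forall y, a <= y <= b -> exists2 d, 0 < d &
    forall u v, a <= u <= y -> y <= v <= b -> v - u < d ->
    - (eps * (M v - M u)) <= D v - D u) ->
  D a <= D b.
Proof.
move=> ab H.
have key eps : 0 < eps -> - (eps * (M b - M a)) <= D b - D a.
  move=> eps0.
  pose E := [set t | a <= t <= b /\ - (eps * (M t - M a)) <= D t - D a].
  have Ea : E a by split; rewrite ?lexx ?ab// !subrr mulr0 oppr0.
  have supE : has_sup E by split; [exists a|exists b => t [/andP[]]].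
  pose c := sup E.
  have ac : a <= c by apply: ub_le_sup => //; case: supE.
  have cb : c <= b by apply: ge_sup; [exists a|move=> t [/andP[]]].
  have [d d0 dP] := H _ eps0 c (introT andP (conj ac cb)).
  have [t Et ct] := sup_adherent d0 supE.
  have tc : t <= c by apply: ub_le_sup => //; case: supE.
  have step v : c <= v <= b -> v - t < d -> E v.
    move=> /andP[cv vb] vt; case: Et => /andP[at_ tb] Dt.
    split; first by rewrite (le_trans ac cv) vb.
    have := dP t v; rewrite at_ tc cv vb => /(_ isT isT vt).
    move: Dt; rewrite (_ : M v - M a = (M v - M t) + (M t - M a)); last by ring.
    rewrite mulrDr; clear; lra.
  have [bt|bt] := ltP (b - t) d.
    by have [] : E b by apply: step; rewrite ?cb ?lexx.
  (* Since [t + d] exceeds [c], this midpoint would be an element of [E] beyond its supremum. *)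
  have E2 : E ((c + (t + d)) / 2).
    by apply: step; rewrite -/c in ct *; move: ct bt tc; clear; lra.
  have : (c + (t + d)) / 2 <= c by apply: ub_le_sup => //; case: supE.
  by rewrite -/c in ct; move: ct; clear; lra.
rewrite leNgt; apply/negP => ba.
pose K := `|M b - M a| + 1.
have K0 : 0 < K by rewrite /K ltr_wpDl.
(* As [M b - M a] is at most [K], this value of [eps] costs at most half of the supposed deficit
   [D a - D b]. *)
have e0 : 0 < (D a - D b) / (2 * K) by rewrite divr_gt0 ?subr_gt0 ?mulr_gt0.
have := key _ e0.
have : (D a - D b) / (2 * K) * (M b - M a) <= (D a - D b) / (2 * K) * K.
  by rewrite ler_pM2l// /K; have := ler_norm (M b - M a); lra.
have -> : (D a - D b) / (2 * K) * K = (D a - D b) / 2 by field; rewrite gt_eqF.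
move: ba; clear; lra.
Qed.

End real_powers.

(** * The energy inequality *)

Section energy.
Context {R : realType}.
Local Open Scope ring_scope.
Implicit Types (a b p q u v w y eta lam : R) (F P Q G z : R -> R).

(* [F], [P] and [Q] abstract the primitives of [f], [f ^ p] and
   [kap * F ^ q * y ^ (- kap - 1)] with [kap = q (p - 1) / p]; only the two
   increment inequalities below are used about them. *)
Definition energy_data p q a b F P Q :=
  [/\ 0 < a, 0 <= F a,
    forall u v, a <= u -> u <= v -> v <= b -> F u <= F v,
    forall u v w, a <= u -> u <= v -> v <= b -> 0 <= w ->
      p * w * (F v - F u) - (p - 1) * w `^ (p / (p - 1)) * (v - u) <= P v - P u &
    forall u v, a <= u -> u <= v -> v <= b ->
      Q v - Q u <= F v `^ q * (u `^ (- (q * (p - 1) / p)) - v `^ (- (q * (p - 1) / p)))].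

Lemma energy_data_sub p q a b F P Q u v : energy_data p q a b F P Q ->
  a <= u -> u <= v -> v <= b -> energy_data p q u v F P Q.
Proof.
move=> [a0 Fa Fm Y Qb] au uv vb; split.
- exact: lt_le_trans au.
- by apply: le_trans Fa _; apply: Fm => //; exact: le_trans vb.
- by move=> s t us st tv; apply: Fm => //; [exact: le_trans us|exact: le_trans vb].
- by move=> s t w us st tv w0; apply: Y => //; [exact: le_trans us|exact: le_trans vb].
- by move=> s t us st tv; apply: Qb => //; [exact: le_trans us|exact: le_trans vb].
Qed.

Lemma energy_P_mono p q a b F P Q u v : 1 < p -> energy_data p q a b F P Q ->
  a <= u -> u <= v -> v <= b -> P u <= P v.
Proof.
move=> p1 [_ _ _ Y _] au uv vb; have := Y u v 0 au uv vb (lexx _).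
rewrite powR0 ?gt_eqF ?divr_gt0//; [lra|lra|lra].
Qed.

(* Young's inequality with a large weight [w] makes [F] continuous. *)
Lemma energy_F_near p q a b F P Q : 1 < p -> energy_data p q a b F P Q ->
  forall eps, 0 < eps -> exists2 d, 0 < d & forall u v, a <= u <= b -> a <= v <= b ->
    `|u - v| < d -> `|F u - F v| < eps.
Proof.
move=> p1 D eps eps0; have [a0 Fa Fm Y Qb] := D.
have [ab|ba] := leP a b; last first.
  by exists 1 => // u v /andP[au ub]; have := le_trans au ub; rewrite leNgt ba.
have PP := energy_P_mono p1 D.
have Pab : 0 <= P b - P a by rewrite subr_ge0 PP.
(* With this weight [p * w * eps] is the total increase of [P] plus 1, and [d] keeps the other term
   of Young's inequality below 1, so [F] cannot increase by [eps]. *)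
pose w := (P b - P a + 1) / (p * eps).
have w0 : 0 < w by rewrite divr_gt0 ?mulr_gt0//; lra.
pose d := ((p - 1) * w `^ (p / (p - 1)))^-1.
have d0 : 0 < d by rewrite invr_gt0 mulr_gt0 ?powR_gt0//; lra.
exists d => //.
have key u v : a <= u -> u <= v -> v <= b -> v - u < d -> F v - F u < eps.
  move=> au uv vb uvd.
  have := Y u v w au uv vb (ltW w0).
  have h1 : P v - P u <= P b - P a.
    have := PP a u; have := PP v b; rewrite !lexx au vb.
    rewrite (le_trans au uv) (le_trans uv vb) => /(_ isT isT isT) + /(_ isT isT isT).
    clear; lra.
  have h2 : (p - 1) * w `^ (p / (p - 1)) * (v - u) < 1.
    by rewrite -ltr_pdivlMl ?mulr1// -invr_gt0.
  have h3 : p * w * eps = P b - P a + 1.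
    by rewrite /w; field; rewrite !gt_eqF//; lra.
  move=> h; have : p * w * (F v - F u) < p * w * eps by rewrite h3; move: h h1 h2; clear; lra.
  by rewrite ltr_pM2l// mulr_gt0//; lra.
move=> u v /andP[au ub] /andP[av vb]; have [uv|vu] := leP u v.
  rewrite distrC (distrC (F u)) !ger0_norm ?subr_ge0//; last exact: Fm.
  exact: key.
rewrite !ger0_norm ?subr_ge0 ?(ltW vu)//; last exact: (Fm _ _ av (ltW vu) ub).
exact: key (ltW vu) _.
Qed.

(** [F] and the power of the variable are taken at different points [s] and [t], since the tangent
    inequalities mix the two endpoints of an increment. *)
Lemma energy_near p q a b F P Q e e' y : 1 < p -> energy_data p q a b F P Q ->
  0 < e -> a <= y <= b -> forall eps, 0 < eps -> exists2 d, 0 < d &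
  forall s t, a <= s <= b -> a <= t <= b -> `|s - y| < d -> `|t - y| < d ->
    `|F s `^ e * t `^ e' - F y `^ e * y `^ e'| < eps.
Proof.
move=> p1 D e0 yab eps eps0; have [a0 Fa Fm Y Qb] := D.
have F0 s : a <= s <= b -> 0 <= F s.
  by move=> /andP[as_ sb]; apply: le_trans Fa _; exact: Fm.
have y0 : 0 < y by case/andP: yab => ay _; exact: lt_le_trans ay.
have [d1 d10 H1] := mulr_near (F y `^ e) (y `^ e') eps0.
have [d2 d20 H2] := powR_near e0 (F0 _ yab) d10.
have [d3 d30 H3] := energy_F_near p1 D d20.
have [d4 d40 H4] := powR_near_gt0 e' y0 d10.
exists (Num.min d3 d4); first by rewrite lt_min d30.
move=> s t sab tab; rewrite !lt_min => /andP[sy3 _] /andP[_ ty4].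
apply: H1; last exact: H4.
by apply: H2; [exact: F0|exact: H3].
Qed.

(** For [eta = 0], Young's inequality and the bound on [dX] give
    [dP - z dX >= (p - 1) (z - zk) b dy], which is at least [lam g dy], hence at least [lam dQ].
    Index 1 marks values at the tag of the increment, index 2 the mixed values that the tangents
    produce, and [eta] bounds their difference. *)
Lemma energy_step p lam eta (z zk a1 a2 b1 b2 g1 g2 dF dy dP dQ dX dG : R) :
  1 < p -> 0 <= z <= 1 -> 0 <= lam -> 0 <= dF -> 0 <= dy ->
  `|a1 - a2| <= eta -> `|b1 - b2| <= eta -> `|g1 - g2| <= eta ->
  p * (z * a1) * dF - (p - 1) * (zk * b1) * dy <= dP ->
  dX <= p * a2 * dF - (p - 1) * b2 * dy ->
  dG <= z * dX -> dQ <= g2 * dy ->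
  lam * g1 <= (p - 1) * (z - zk) * b1 ->
  - ((2 * p + lam) * eta * (dF + dy)) <= dP - lam * dQ - dG.
Proof.
move=> p1 /andP[z0 z1] lam0 dF0 dy0 ha hb hg hP hX hG hQ hz.
have e0 : 0 <= eta by apply: le_trans ha.
have : z * dX <= z * (p * a2 * dF - (p - 1) * b2 * dy) by exact: ler_wpM2l.
have : lam * dQ <= lam * (g2 * dy) by exact: ler_wpM2l.
have : lam * g1 * dy <= (p - 1) * (z - zk) * b1 * dy by exact: ler_wpM2r.
have A : p * z * dF * (a2 - a1) <= p * z * dF * eta.
  rewrite ler_wpM2l// ?mulr_ge0//; first lra.
  by move: ha; rewrite ler_norml => /andP[+ _]; lra.
have B : (p - 1) * z * dy * (b1 - b2) <= (p - 1) * z * dy * eta.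
  rewrite ler_wpM2l// ?mulr_ge0//; first lra.
  by move: hb; rewrite ler_norml => /andP[_ +]; lra.
have G : lam * dy * (g2 - g1) <= lam * dy * eta.
  rewrite ler_wpM2l// ?mulr_ge0//.
  by move: hg; rewrite ler_norml => /andP[+ _]; lra.
have A' : p * z * dF * eta <= p * 1 * dF * eta.
  by rewrite ler_wpM2r// ler_wpM2r// ler_wpM2l//; lra.
have B' : (p - 1) * z * dy * eta <= (p - 1) * 1 * dy * eta.
  by rewrite ler_wpM2r// ler_wpM2r// ler_wpM2l//; lra.
have C : 0 <= p * dF * eta by rewrite !mulr_ge0//; lra.
have C' : 0 <= p * dy * eta by rewrite !mulr_ge0//; lra.
have C2 : 0 <= lam * dF * eta by rewrite !mulr_ge0//; lra.
have C3 : 0 <= dy * eta by rewrite !mulr_ge0//; lra.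
move: hP hG A B G A' B' C C' C2 C3; clear; lra.
Qed.

(* The Weierstrass field argument: [z y * (F y / y) ^ (p - 1)] is the slope of
   the field of extremals at [y] and [G] its eikonal.  The tag of an increment
   is its left endpoint when [left] holds and its right endpoint otherwise. *)
Lemma energy_half p q a b F P Q lam z G (left : bool) :
  let X y := F y `^ p * y `^ (- (p - 1)) in
  let tag u v := if left then u else v in
  1 < p -> 0 < q -> a <= b -> energy_data p q a b F P Q -> 0 <= lam ->
  (forall y, a <= y <= b -> 0 <= z y <= 1) ->
  (forall y, a <= y <= b ->
    lam * (F y `^ q * y `^ (- (q * (p - 1) / p) - 1)) <=
    (p - 1) * (z y - z y `^ (p / (p - 1))) * (F y `^ p * y `^ (- p))) ->
  (forall u v, a <= u -> u <= v -> v <= b ->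
    G v - G u <= z (tag u v) * (X v - X u)) ->
  G b - G a + lam / (q * (p - 1) / p) * (Q b - Q a) <= P b - P a.
Proof.
move=> X tag p1 q0 ab D lam0 z01 hz hG; have [a0 Fa Fm Y Qb] := D.
set kap := q * (p - 1) / p in Qb hz *.
have kap0 : 0 < kap by rewrite /kap divr_gt0 ?mulr_gt0//; lra.
have p10 : 0 < p - 1 by rewrite subr_gt0.
have p0 : 0 < p by exact: lt_trans p1.
have F0 s : a <= s <= b -> 0 <= F s.
  by move=> /andP[as_ sb]; apply: le_trans Fa _; exact: Fm.
suff : P a - lam / kap * Q a - G a <= P b - lam / kap * Q b - G b.
  by rewrite mulrBr; clear; lra.
(* The error of one increment is proportional to [dF + dy], hence the comparison function
   [F y + y]. *)
apply: (@straddle_le R a b (fun y => P y - lam / kap * Q y - G y) (fun y => F y + y)) => //.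
move=> eps eps0 y yab.
pose eta := eps / (2 * p + lam).
have L0 : 0 < 2 * p + lam by lra.
have eta0 : 0 < eta by rewrite divr_gt0.
have eta20 : 0 < eta / 2 by rewrite divr_gt0.
have [d1 d10 H1] := @energy_near p q a b F P Q (p - 1) (- (p - 1)) y p1 D p10 yab _ eta20.
have [d2 d20 H2] := @energy_near p q a b F P Q p (- p) y p1 D p0 yab _ eta20.
have [d3 d30 H3] := @energy_near p q a b F P Q q (- kap - 1) y p1 D q0 yab _ eta20.
exists (Num.min d1 (Num.min d2 d3)); first by rewrite !lt_min d10 d20.
move=> u v /andP[au uy] /andP[yv vb]; rewrite !lt_min => /and3P[uv1 uv2 uv3].
have uv : u <= v by exact: le_trans yv.
have uab : a <= u <= b by rewrite au (le_trans uv).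
have vab : a <= v <= b by rewrite vb (le_trans au).
have tab : a <= tag u v <= b by rewrite /tag; case: (left).
have u0 : 0 < u by exact: lt_le_trans au.
have v0 : 0 < v by exact: lt_le_trans uv.
have near (s d : R) : u <= s -> s <= v -> v - u < d -> `|s - y| < d.
  move=> us sv uvd.
  rewrite ltr_norml; apply/andP; move: us sv uy yv uvd; clear; split; lra.
have ut : u <= tag u v by rewrite /tag; case: (left).
have tv : tag u v <= v by rewrite /tag; case: (left).
have dist (d c x1 x2 : R) : `|x1 - c| < d / 2 -> `|x2 - c| < d / 2 -> `|x1 - x2| <= d.
  move=> h1 h2; rewrite -(subrKA c); apply: le_trans (ler_normD _ _) _.
  by rewrite (distrC c); move: h1 h2; clear; lra.
set t := tag u v.
have t0 : 0 < t by case/andP: tab => at_ _; exact: lt_le_trans at_.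
have Ft := F0 _ tab; have Fu := F0 _ uab; have Fv := F0 _ vab.
have hA := dist _ _ _ _ (H1 t t tab tab (near _ _ ut tv uv1) (near _ _ ut tv uv1))
  (H1 v v vab vab (near _ _ uv (lexx v) uv1) (near _ _ uv (lexx v) uv1)).
have hB := dist _ _ _ _ (H2 t t tab tab (near _ _ ut tv uv2) (near _ _ ut tv uv2))
  (H2 u v uab vab (near _ _ (lexx u) uv uv2) (near _ _ uv (lexx v) uv2)).
have hG' := dist _ _ _ _ (H3 t t tab tab (near _ _ ut tv uv3) (near _ _ ut tv uv3))
  (H3 v u vab uab (near _ _ uv (lexx v) uv3) (near _ _ (lexx u) uv uv3)).
(* Young's inequality is used with the slope of the field at the tag as its weight; the power
   [p / (p - 1)] of that weight is [z ^ p' (F t / t) ^ p]. *)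
have hP : p * (z t * (F t `^ (p - 1) * t `^ (- (p - 1)))) * (F v - F u)
    - (p - 1) * (z t `^ (p / (p - 1)) * (F t `^ p * t `^ (- p))) * (v - u) <= P v - P u.
  have zt0 : 0 <= z t by have /andP[] := z01 _ tab.
  have := Y u v (z t * (F t `^ (p - 1) * t `^ (- (p - 1)))) au uv vb.
  rewrite !mulr_ge0 ?powR_ge0// => /(_ isT).
  rewrite !powRM ?mulr_ge0 ?powR_ge0// -!powRrM.
  have -> : (p - 1) * (p / (p - 1)) = p by field; rewrite subr_eq0 gt_eqF.
  by have -> : - (p - 1) * (p / (p - 1)) = - p by field; rewrite subr_eq0 gt_eqF.
(* The increment is split as [(F v ^ p - F u ^ p) v ^ (1 - p) + F u ^ p (v ^ (1 - p) - u ^ (1 -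
   p))], and both tangents are taken at [v]. *)
have hX : X v - X u <= p * (F v `^ (p - 1) * v `^ (- (p - 1))) * (F v - F u)
    - (p - 1) * (F u `^ p * v `^ (- p)) * (v - u).
  have h1 := powR_tangent p1 Fu Fv.
  have h2 := @powRN_tangent R (p - 1) u v p10 u0 v0.
  have e1 : - (p - 1) - 1 = - p by ring.
  rewrite e1 in h2.
  have := ler_wpM2r (powR_ge0 v (- (p - 1))) h1.
  have := ler_wpM2l (powR_ge0 (F u) p) h2.
  rewrite /X; clear; lra.
have hQ : (Q v - Q u) / kap <= (F v `^ q * u `^ (- kap - 1)) * (v - u).
  rewrite ler_pdivrMr//; apply: le_trans (Qb u v au uv vb) _.
  have := powRN_tangent kap0 v0 u0.
  move=> h; have := ler_wpM2l (powR_ge0 (F v) q) h; clear; lra.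
have := @energy_step p lam eta (z t) (z t `^ (p / (p - 1))) _ _ _ _ _ _
  (F v - F u) (v - u) (P v - P u) ((Q v - Q u) / kap) (X v - X u) (G v - G u)
  p1 (z01 _ tab) lam0 _ _ hA hB hG' hP hX (hG u v au uv vb) hQ (hz _ tab).
rewrite !subr_ge0 Fm// uv => /(_ isT isT).
have -> : (2 * p + lam) * eta = eps by rewrite /eta; field; rewrite gt_eqF.
clear; rewrite !mulrBr; lra.
Qed.

End energy.

(** * The slope function of the field, its two branches and the case [p = q] *)

Section bliss_profile.
Context {R : realType}.
Local Open Scope ring_scope.
Implicit Types (a b p q r u v w x y z eta lam m c : R) (F P Q G S : R -> R).

(** This is [phi] of the overview. *)
Definition field_speed p z := (p - 1) * (z - z `^ (p / (p - 1))).

(** The zero of [1 - k z ^ (k - 1)] for [k = p / (p - 1)], because [k - 1 = 1 / (p - 1)]. *)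
Definition field_argmax p := (p / (p - 1)) `^ (- (p - 1)).

Section speed.
Context p (p1 : 1 < p).
Let k := p / (p - 1).
Let z0 := field_argmax p.

Let p10 : 0 < p - 1. Proof. by rewrite subr_gt0. Qed.
Let p0 : 0 < p. Proof. exact: lt_trans p1. Qed.
Let k0 : 0 < k. Proof. by rewrite divr_gt0. Qed.
Let k1 : 1 < k. Proof. by rewrite /k ltr_pdivlMr// mul1r; lra. Qed.

Lemma field_argmax_gt0 : 0 < field_argmax p.
Proof. by rewrite powR_gt0. Qed.

Lemma field_argmax_le1 : field_argmax p <= 1.
Proof.
rewrite /field_argmax -/k powRN invf_le1 ?powR_gt0//.
by rewrite -[leLHS](powRr0 k) ler_powR// ltW.
Qed.

Let kz0 : k * z0 `^ (k - 1) = 1.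
Proof.
rewrite /z0 /field_argmax -/k -powRrM.
have -> : - (p - 1) * (k - 1) = - 1.
  by rewrite /k; field; rewrite gt_eqF.
by rewrite powR_inv1 ?(ltW k0)// divff// gt_eqF.
Qed.

(** The maximum of [phi] is the reciprocal of [p' ^ p], the constant in Hardy's inequality for
    [F y / y]. *)
Lemma field_speed_argmax : field_speed p (field_argmax p) = k `^ (- p).
Proof.
rewrite /field_speed -/k /field_argmax -/k -powRrM.
have -> : - (p - 1) * k = - p by rewrite /k; field; rewrite gt_eqF.
have -> : - (p - 1) = - p + 1 by ring.
have -> : k `^ (- p + 1) = k `^ (- p) * k.
  by rewrite powRD ?powRr1 ?(ltW k0)//; apply/implyP => _; rewrite gt_eqF.
have -> : (p - 1) * (k `^ (- p) * k - k `^ (- p)) = (p - 1) * (k - 1) * k `^ (- p) by ring.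
have -> : (p - 1) * (k - 1) = 1 by rewrite /k; field; rewrite gt_eqF.
by rewrite mul1r.
Qed.

(** The tangent to [z ^ k] at [y] has slope at most [k z0 ^ (k - 1) = 1], so [z ^ k] grows no faster
    than [z] between [x] and [y]. On the other side of [z0] the tangent at the left endpoint has
    slope at least 1. *)
Lemma field_speed_incr x y : 0 <= x -> x <= y -> y <= z0 ->
  field_speed p x <= field_speed p y.
Proof.
move=> x0 xy yz; rewrite /field_speed ler_pM2l// -/k.
have y0 := le_trans x0 xy.
have h := powR_tangent k1 x0 y0.
have : y `^ (k - 1) <= z0 `^ (k - 1).
  by rewrite ge0_ler_powR ?nnegrE ?(ltW field_argmax_gt0) ?subr_ge0 ?(ltW k1).
move=> h1; have : k * y `^ (k - 1) * (y - x) <= k * z0 `^ (k - 1) * (y - x).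
  by rewrite ler_wpM2r ?subr_ge0// ler_pM2l.
rewrite kz0; move: h; lra.
Qed.

Lemma field_speed_decr x y : z0 <= x -> x <= y ->
  field_speed p y <= field_speed p x.
Proof.
move=> zx xy; rewrite /field_speed ler_pM2l// -/k.
have x0 : 0 <= x by apply: le_trans zx; exact/ltW/field_argmax_gt0.
have y0 := le_trans x0 xy.
have h := powR_tangent k1 y0 x0.
have : z0 `^ (k - 1) <= x `^ (k - 1).
  by rewrite ge0_ler_powR ?nnegrE ?(ltW field_argmax_gt0) ?subr_ge0 ?(ltW k1).
move=> h1; have : k * z0 `^ (k - 1) * (y - x) <= k * x `^ (k - 1) * (y - x).
  by rewrite ler_wpM2r ?subr_ge0// ler_pM2l.
rewrite kz0; move: h; lra.
Qed.

Lemma field_speed0 : field_speed p 0 = 0.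
Proof. by rewrite /field_speed powR0 ?gt_eqF// subrr mulr0. Qed.

Lemma field_speed1 : field_speed p 1 = 0.
Proof. by rewrite /field_speed powR1 subrr mulr0. Qed.

Lemma field_speed_ge0 z : 0 <= z <= 1 -> 0 <= field_speed p z.
Proof.
move=> /andP[z0' z1]; have [zz|zz] := leP z z0.
  by rewrite -field_speed0; exact: field_speed_incr.
by rewrite -field_speed1; apply: field_speed_decr => //; exact: ltW.
Qed.

Lemma field_speed_le z : 0 <= z <= 1 -> field_speed p z <= field_speed p z0.
Proof.
move=> /andP[z0' z1]; have [zz|zz] := leP z z0.
  exact: field_speed_incr.
by apply: field_speed_decr => //; exact: ltW.
Qed.

(** Powers of negative numbers are conventional values; the absolute value yields a function
    continuous on the whole line, to which the intermediate value theorem applies. *)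
Lemma continuous_field_speed_norm : continuous (fun z => field_speed p `|z|).
Proof.
move=> z; apply: cvgM; [exact: cvg_cst|apply: cvgB; first exact: norm_continuous].
apply/cvgrPdist_lt => eps eps0.
have [d d0 dP] := powR_near k0 (normr_ge0 z) eps0.
apply/nbhs_ballP; exists d => // y; rewrite /ball/= => zy.
rewrite distrC; apply: dP => //; apply: le_lt_trans (ler_dist_dist _ _) _.
by rewrite distrC.
Qed.

Lemma field_speed_ivt a b c : 0 <= a -> a <= b ->
  Num.min (field_speed p a) (field_speed p b) <= c ->
  c <= Num.max (field_speed p a) (field_speed p b) ->
  exists z, a <= z <= b /\ field_speed p z = c.
Proof.
move=> a0 ab c1 c2; have b0 := le_trans a0 ab.
have := @IVT R (fun z => field_speed p `|z|) a b c ab.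
rewrite !ger0_norm// c1 c2; case=> //.
  exact/continuous_subspaceT/continuous_field_speed_norm.
move=> z; rewrite in_itv/= => /andP[az zb] <-; exists z; rewrite az zb ger0_norm//.
exact: le_trans az.
Qed.

End speed.

(* [S z] stands for the integral of [field_speed p ^ (1 / r)] over [[z, 1]]. *)
Definition bliss_profile p r S Phi :=
  [/\ S 0 = Phi, S 1 = 0,
    forall x y m, 0 <= x -> x <= y -> y <= 1 ->
      (forall z, x <= z <= y -> m <= field_speed p z `^ r^-1) ->
      m * (y - x) <= S x - S y &
    forall x y m, 0 <= x -> x <= y -> y <= 1 ->
      (forall z, x <= z <= y -> field_speed p z `^ r^-1 <= m) ->
      S x - S y <= m * (y - x)].

(** On the decreasing branch [S' = - phi ^ (1 / r)] is nondecreasing, so [S] is convex and lies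
    above its tangent at [y], on either side of [y]. *)
Lemma bliss_profile_right p r S Phi x y : 1 < p -> 0 < r ->
  bliss_profile p r S Phi ->
  field_argmax p <= x <= 1 -> field_argmax p <= y <= 1 ->
  field_speed p y `^ r^-1 * (y - x) <= S x - S y.
Proof.
move=> p1 r0 [_ _ lo hi] /andP[x0 x1] /andP[y0 y1].
have a0 := ltW (field_argmax_gt0 p1).
have z01 z : field_argmax p <= z -> z <= 1 -> 0 <= field_speed p z.
  by move=> az z1; rewrite field_speed_ge0// z1 (le_trans a0 az).
have r'0 : 0 <= r^-1 by rewrite invr_ge0 ltW.
have [xy|yx] := leP x y.
  apply: (lo x y _ (le_trans a0 x0) xy y1).
  move=> z /andP[xz zy]; rewrite ge0_ler_powR ?nnegrE ?z01//.
  - exact: le_trans xz.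
  - exact: le_trans y1.
  - by rewrite field_speed_decr// (le_trans x0 xz).
have h : S y - S x <= field_speed p y `^ r^-1 * (x - y).
  apply: (hi y x _ (le_trans a0 y0) (ltW yx) x1).
  move=> z /andP[yz zx]; rewrite ge0_ler_powR ?nnegrE ?z01//.
  - exact: le_trans yz.
  - exact: le_trans x1.
  - by rewrite field_speed_decr.
move: h; clear; lra.
Qed.

(** On the increasing branch [S] is concave and lies below its tangent at [x]. The point of tangency
    has moved from [y] to [x], which is why the tags differ on the two branches. *)
Lemma bliss_profile_left p r S Phi x y : 1 < p -> 0 < r ->
  bliss_profile p r S Phi ->
  0 <= x <= field_argmax p -> 0 <= y <= field_argmax p ->
  field_speed p x `^ r^-1 * (y - x) <= S x - S y.
Proof.
move=> p1 r0 [_ _ lo hi] /andP[x0 xa] /andP[y0 ya].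
have a1 := field_argmax_le1 p1.
have z01 z : 0 <= z -> z <= field_argmax p -> 0 <= field_speed p z.
  by move=> z0 za; rewrite field_speed_ge0// z0 (le_trans za).
have r'0 : 0 <= r^-1 by rewrite invr_ge0 ltW.
have [xy|yx] := leP x y.
  apply: (lo x y _ x0 xy (le_trans ya a1)).
  move=> z /andP[xz zy]; rewrite ge0_ler_powR ?nnegrE ?z01//.
  - exact: le_trans xz.
  - exact: le_trans ya.
  - by rewrite field_speed_incr// (le_trans zy).
have h : S y - S x <= field_speed p x `^ r^-1 * (x - y).
  apply: (hi y x _ y0 (ltW yx) (le_trans xa a1)).
  move=> z /andP[yz zx]; rewrite ge0_ler_powR ?nnegrE ?z01//.
  - exact: le_trans yz.
  - exact: le_trans xa.
  - by rewrite field_speed_incr// (le_trans y0).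
move: h; clear; lra.
Qed.

(** The constant slope [field_argmax p] allows the largest [lam], the maximum of [phi]. The boundary
    term vanishes at [a], where [F a = 0], and is nonnegative at [b]. *)
Lemma energy_hardy p a b F P Q : 1 < p -> a <= b ->
  energy_data p p a b F P Q -> F a = 0 ->
  Q b - Q a <= (p - 1) * (p / (p - 1)) `^ p * (P b - P a).
Proof.
move=> p1 ab D Fa0; have [a0 Fa Fm Y Qb] := D.
have p10 : 0 < p - 1 by rewrite subr_gt0.
have p0 : 0 < p by exact: lt_trans p1.
pose z0 := field_argmax p.
have z00 : 0 <= z0 by exact/ltW/field_argmax_gt0.
have z01 : z0 <= 1 by exact: field_argmax_le1.
set k := p / (p - 1); have k0 : 0 < k by rewrite divr_gt0.
have b0 : 0 < b by exact: lt_le_trans ab.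
have kapE : p * (p - 1) / p = p - 1 by field; rewrite gt_eqF.
have := @energy_half R p p a b F P Q (k `^ (- p)) (fun=> z0)
  (fun y => z0 * (F y `^ p * y `^ (- (p - 1)))) true p1 p0 ab D (powR_ge0 _ _).
rewrite kapE z00 z01 => /(_ (fun _ _ => isT)).
have -> : - (p - 1) - 1 = - p by ring.
rewrite -/(field_speed p z0) field_speed_argmax// -/k.
move=> /(_ (fun _ _ => lexx _) (fun _ _ _ _ _ => ltac:(by rewrite mulrBr))).
rewrite Fa0 powR0 ?gt_eqF// mul0r mulr0 subr0.
set X := F b `^ p * _; have X0 : 0 <= X by rewrite mulr_ge0 ?powR_ge0.
have zX : 0 <= z0 * X by rewrite mulr_ge0.
rewrite powRN => h.
have : (k `^ p)^-1 / (p - 1) * (Q b - Q a) <= P b - P a by move: h zX; clear; lra.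
rewrite -invfM mulrC ler_pdivrMr ?mulr_gt0 ?powR_gt0//.
by rewrite (mulrC (k `^ p)) [leRHS]mulrC.
Qed.

Lemma energy_argmax p q a b F P Q : 1 < p -> a <= b ->
  energy_data p q a b F P Q -> exists2 y0, a <= y0 <= b &
  forall y, a <= y <= b ->
    F y `^ p * y `^ (- (p - 1)) <= F y0 `^ p * y0 `^ (- (p - 1)).
Proof.
(* The clamp [cl] onto [[a, b]] is 1-Lipschitz and extends the function continuously to the line, as
   [continuous_subspaceT] asks. *)
move=> p1 ab D; pose cl y := Num.max a (Num.min b y).
have p0 : 0 < p by exact: lt_trans p1.
have clab y : a <= cl y <= b by rewrite /cl le_max lexx/= ge_max ab/= ge_min lexx.
have clE y : a <= y <= b -> cl y = y.
  by move=> /andP[ay yb]; rewrite /cl (min_idPr yb) (max_idPr ay).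
have cl1 x y : `|cl x - cl y| <= `|x - y|.
  have key u v : u <= v -> `|cl u - cl v| <= v - u.
    move=> uv; have : cl u <= cl v.
      by rewrite /cl ge_max le_max lexx/= le_max le_min !ge_min lexx uv/= orbT orbT.
    rewrite distrC -subr_ge0 => /ger0_norm ->.
    rewrite /cl !maxEle !minEle; case: ifP; case: ifP; case: ifP; case: ifP; move: uv; lra.
  have [xy|/ltW yx] := leP x y.
    by rewrite (distrC x) [leRHS]ger0_norm ?subr_ge0// key.
  by rewrite [leRHS]ger0_norm ?subr_ge0// distrC key.
have := @EVT_max R (fun y => F (cl y) `^ p * (cl y) `^ (- (p - 1))) a b ab.
case.
  apply: continuous_subspaceT => x; apply/cvgrPdist_lt => eps eps0.
  have [d d0 dP] := @energy_near R p q a b F P Q p (- (p - 1)) (cl x) p1 D p0 (clab x) _ eps0.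
  apply/nbhs_ballP; exists d => // y; rewrite /ball/= => xy.
  have yx : `|cl y - cl x| < d by rewrite (le_lt_trans (cl1 _ _))// distrC.
  by rewrite distrC; apply: dP.
move=> y0; rewrite in_itv/= => y0ab H; exists y0 => // y yab.
by have := H y; rewrite in_itv/= yab => /(_ isT); rewrite !clE.
Qed.

End bliss_profile.

(** * The energy inequality for [p < q] *)

Section energy_bliss.
Context {R : realType}.
Local Open Scope ring_scope.
Implicit Types (a b p q r u v w x y z eta lam m c : R) (F P Q G S : R -> R).

(** With [x = F y] the weight [F ^ q y ^ (- kap - 1)] becomes [X ^ r (F / y) ^ p], where
    [r = (q - p) / p]; the condition of [energy_half] on the slope thus reduces to
    [lam X ^ r <= phi z]. *)
Lemma powR_energy p q x y : 1 < p -> p < q -> 0 <= x -> 0 < y ->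
  x `^ q * y `^ (- (q * (p - 1) / p) - 1) =
  (x `^ p * y `^ (- (p - 1))) `^ ((q - p) / p) * (x `^ p * y `^ (- p)).
Proof.
move=> p1 pq x0 y0.
have p0 : 0 < p by exact: lt_trans p1.
have q0 : 0 < q by exact: lt_trans pq.
rewrite powRM ?powR_ge0// -!powRrM mulrACA.
rewrite -(@powRD _ x); last first.
  by rewrite gt_eqF// addr_gt0// mulr_gt0// mulr_gt0 ?invr_gt0// subr_gt0.
rewrite -(@powRD _ y); last by apply/implyP => _; rewrite gt_eqF.
have -> : p * ((q - p) / p) + p = q by field; rewrite gt_eqF.
by have -> : - (p - 1) * ((q - p) / p) + - p = - (q * (p - 1) / p) - 1 by field; rewrite gt_eqF.
Qed.

Lemma field_speed_powR p q lam x y z : 1 < p -> p < q -> 0 <= x -> 0 < y ->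
  field_speed p z = lam * (x `^ p * y `^ (- (p - 1))) `^ ((q - p) / p) ->
  lam * (x `^ q * y `^ (- (q * (p - 1) / p) - 1)) <=
  (p - 1) * (z - z `^ (p / (p - 1))) * (x `^ p * y `^ (- p)).
Proof.
move=> p1 pq x0 y0 cz; rewrite powR_energy// mulrA -cz; exact: lexx.
Qed.

(** Here [zv xv - zu xu = zu (xv - xu) + xv (zv - zu)], and the profile absorbs the last term. Its
    coefficient is [xv] when the slope is tagged at the left endpoint and [xu] when it is tagged at
    the right one, matching the tangent inequalities for [S] on the two branches. *)
Let legendre_right (g zu zv xu xv su sv : R) :
  xv * (zv - zu) <= su / g - sv / g ->
  zv * xv + sv / g - (zu * xu + su / g) <= zu * (xv - xu).
Proof. lra. Qed.

Let legendre_left (g zu zv xu xv su sv : R) :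
  xu * (zv - zu) <= su / g - sv / g ->
  zv * xv + sv / g - (zu * xu + su / g) <= zv * (xv - xu).
Proof. lra. Qed.

Let tangent_arith (E Phi w y m T : R) : E != 0 -> E * Phi * w = T ->
  Phi * (y * w + E * w * (m - y)) = T * y / E + T * (m - y).
Proof. by move=> E0 <-; field. Qed.

(** The left-hand side is the optimal value over [lam] as it arises in [energy_bliss]. *)
Lemma bliss_constant p q T Phi : 1 < p -> p < q -> 0 <= T -> 0 < Phi ->
  T * (T / (q / (q - p) * Phi)) `^ ((q - p) / p) * (1 - (q / (q - p))^-1)
    * (q * (p - 1) / p) =
  (p - 1) * (q * Phi / (q - p)) `^ (- ((q - p) / p)) * T `^ (q / p).
Proof.
move=> p1 pq T0 Phi0.
have p0 : 0 < p by exact: lt_trans p1.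
have q0 : 0 < q by exact: lt_trans pq.
have qp0 : 0 < q - p by rewrite subr_gt0.
have K0 : 0 <= q / (q - p) * Phi by rewrite !mulr_ge0 ?invr_ge0 ?(ltW q0) ?(ltW Phi0) ?(ltW qp0).
have -> : q * Phi / (q - p) = q / (q - p) * Phi by rewrite mulrAC.
have -> : T `^ (q / p) = T * T `^ ((q - p) / p).
  have h : 0 < q / p by rewrite divr_gt0.
  rewrite -(mulr_powRB1 T0 h); congr (_ * T `^ _).
  by field; rewrite gt_eqF.
rewrite (@powRM _ T) ?invr_ge0// -(powR_inv1 K0) -powRrM mulN1r.
have -> : 1 - (q / (q - p))^-1 = p / q by rewrite invf_div; field; rewrite gt_eqF.
by field; rewrite !gt_eqF.
Qed.

(** The multiplier is existential because it is dictated by the maximum of [X]; [energy_bliss] then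
    takes the worst case over all multipliers. *)
Lemma energy_bliss_dual p q a b F P Q S Phi : 1 < p -> p < q -> a <= b ->
  energy_data p q a b F P Q -> F a = 0 -> 0 < F b ->
  bliss_profile p ((q - p) / p) S Phi ->
  exists2 lam, 0 < lam &
    lam / (q * (p - 1) / p) * (Q b - Q a) + Phi / lam `^ (p / (q - p)) <= P b - P a.
Proof.
move=> p1 pq ab D Fa0 Fb0 HS; have [a0 Fa Fm Y Qb] := D.
have p0 : 0 < p by exact: lt_trans p1.
have q0 : 0 < q by exact: lt_trans pq.
have F0 s : a <= s <= b -> 0 <= F s.
  by move=> /andP[as_ sb]; apply: le_trans Fa _; exact: Fm.
clear Fm Y Qb.
set r := (q - p) / p in HS.
have r0 : 0 < r by rewrite divr_gt0 ?subr_gt0.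
have rV : p / (q - p) = r^-1 by rewrite /r invf_div.
pose X y := F y `^ p * y `^ (- (p - 1)).
have X0 y : 0 <= X y by rewrite mulr_ge0 ?powR_ge0.
have [y0 y0ab Xmax] := energy_argmax p1 ab D.
have Xy0 : 0 < X y0.
  apply: lt_le_trans (Xmax b _); last by rewrite ab lexx.
  by rewrite mulr_gt0 ?powR_gt0// (lt_le_trans a0).
pose z0 := field_argmax p.
have z00 : 0 < z0 by exact: field_argmax_gt0.
have z01 : z0 <= 1 by exact: field_argmax_le1.
pose phi0 := field_speed p z0.
have phi00 : 0 < phi0 by rewrite /phi0 field_speed_argmax ?powR_gt0 ?divr_gt0 ?subr_gt0.
(* The value for which [lam * X y0 ^ r = phi0]: the equation [phi z = c y] is then solvable on both
   branches throughout [[a, b]], and the branches can be joined at [y0]. *)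
pose lam := phi0 * X y0 `^ (- r).
have lam0 : 0 < lam by rewrite mulr_gt0 ?powR_gt0.
exists lam => //; rewrite rV.
pose g := lam `^ r^-1; have g0 : 0 < g by rewrite powR_gt0.
pose c y := lam * X y `^ r.
have c0 y : 0 <= c y by rewrite mulr_ge0 ?powR_ge0 ?(ltW lam0).
have cphi y : a <= y <= b -> c y <= phi0.
  move=> yab; have -> : phi0 = lam * X y0 `^ r.
    by rewrite /lam powRN mulfVK// gt_eqF ?powR_gt0.
  rewrite (ler_pM2l lam0); apply: (ge0_ler_powR (ltW r0));
    rewrite ?nnegrE; [exact: X0|exact: X0|exact: Xmax].
clear Xmax.
have cV y : c y `^ r^-1 = g * X y.
  rewrite /c powRM ?powR_ge0 ?(ltW lam0)// -powRrM mulfV ?gt_eqF// powRr1//.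
(* Arbitrary selections of the two branches: the tangent inequalities compare any two of their
   values. The default 0 is never met on [[a, b]], where a solution exists. *)
pose zp y := xget 0 [set z | z0 <= z <= 1 /\ field_speed p z = c y].
pose zm y := xget 0 [set z | 0 <= z <= z0 /\ field_speed p z = c y].
have zpP y : a <= y <= b -> z0 <= zp y <= 1 /\ field_speed p (zp y) = c y.
  move=> yab; have [z zP] := @field_speed_ivt R p p1 z0 1 (c y) (ltW z00) z01
    ltac:(by rewrite field_speed1 ge_min c0 orbT)
    ltac:(by rewrite le_max; apply/orP; left; exact: cphi).
  exact: (@xgetPex _ 0 [set z | z0 <= z <= 1 /\ field_speed p z = c y] (ex_intro _ z zP)).
have zmP y : a <= y <= b -> 0 <= zm y <= z0 /\ field_speed p (zm y) = c y.
  move=> yab; have [z zP] := @field_speed_ivt R p p1 0 z0 (c y) (lexx _) (ltW z00)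
    ltac:(by rewrite (field_speed0 p1) ge_min c0)
    ltac:(by rewrite le_max; apply/orP; right; exact: cphi).
  exact: (@xgetPex _ 0 [set z | 0 <= z <= z0 /\ field_speed p z = c y] (ex_intro _ z zP)).
have hz y z (yab : a <= y <= b) (cz : field_speed p z = c y) :=
  field_speed_powR p1 pq (F0 _ yab) (lt_le_trans a0 (proj1 (andP yab))) cz.
pose Gp y := zp y * X y + S (zp y) / g.
pose Gm y := zm y * X y + S (zm y) / g.
case/andP: y0ab => ay0 y0b.
have ab1 y : a <= y -> y <= y0 -> a <= y <= b by move=> -> /le_trans ->.
have ab2 y : y0 <= y -> y <= b -> a <= y <= b by move=> /(le_trans ay0) -> ->.
have plus : Gp y0 - Gp a + lam / (q * (p - 1) / p) * (Q y0 - Q a) <= P y0 - P a.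
  apply: (@energy_half R p q a y0 F P Q lam zp Gp true p1 q0 ay0
    (energy_data_sub D (lexx a) ay0 y0b) (ltW lam0)).
  - move=> y /andP[h1 h2]; have [/andP[h3 ->] _] := zpP _ (ab1 _ h1 h2).
    by rewrite andbT (le_trans (ltW z00)).
  - by move=> y /andP[h1 h2]; apply: hz (ab1 _ h1 h2) _; case: (zpP _ (ab1 _ h1 h2)).
  - move=> u v au uv vy.
    have [zu _] := zpP u (ab1 _ au (le_trans uv vy)).
    have [zv cv] := zpP v (ab1 _ (le_trans au uv) vy).
    have := bliss_profile_right p1 r0 HS zu zv.
    rewrite cv cV -/(X u) -/(X v) /Gp -mulrA => h.
    apply: legendre_right; rewrite -mulrBl (ler_pdivlMr _ _ g0) mulrC.
    exact: h.
have minus : Gm b - Gm y0 + lam / (q * (p - 1) / p) * (Q b - Q y0) <= P b - P y0.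
  apply: (@energy_half R p q y0 b F P Q lam zm Gm false p1 q0 y0b
    (energy_data_sub D ay0 y0b (lexx b)) (ltW lam0)).
  - move=> y /andP[h1 h2]; have [/andP[-> h3] _] := zmP _ (ab2 _ h1 h2).
    exact: le_trans z01.
  - by move=> y /andP[h1 h2]; apply: hz (ab2 _ h1 h2) _; case: (zmP _ (ab2 _ h1 h2)).
  - move=> u v au uv vy.
    have [zu cu] := zmP u (ab2 _ au (le_trans uv vy)).
    have [zv _] := zmP v (ab2 _ (le_trans au uv) vy).
    have := bliss_profile_left p1 r0 HS zu zv.
    rewrite cu cV -/(X u) -/(X v) /Gm -mulrA => h.
    apply: legendre_left; rewrite -mulrBl (ler_pdivlMr _ _ g0) mulrC.
    exact: h.
have [S0 S1 lo hi] := HS.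
(* At [a] the tangent inequality is applied against [z = 1], where [S] vanishes; at [b], in
   [finish], against [z = 0], where [S] equals [Phi]. *)
have start : Gp a <= 0.
  have [za ca] := zpP a (ab1 _ (lexx _) ay0).
  have Xa : X a = 0 by rewrite /X Fa0 powR0 ?gt_eqF ?mul0r.
  have := bliss_profile_right p1 r0 HS (introT andP (conj z01 (lexx _))) za.
  rewrite ca cV Xa mulr0 mul0r S1 sub0r oppr_ge0 => h.
  by rewrite /Gp Xa mulr0 add0r pmulr_lle0 ?invr_gt0.
(* The branches are joined by the bound [phi <= phi0 = c y0] between [zm y0] and [zp y0], whether or
   not these two points coincide. *)
have middle : Gm y0 <= Gp y0.
  have [/andP[zp0 zp1] cp] := zpP y0 (ab1 _ ay0 (lexx _)).
  have [/andP[zm0 zm1] cm] := zmP y0 (ab1 _ ay0 (lexx _)).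
  have := hi (zm y0) (zp y0) (g * X y0) zm0 (le_trans zm1 zp0) zp1.
  have H z : zm y0 <= z <= zp y0 -> field_speed p z `^ r^-1 <= g * X y0.
    move=> /andP[z1 z2]; rewrite -cV.
    have zz : 0 <= z <= 1 by rewrite (le_trans zm0 z1) (le_trans z2 zp1).
    have -> : c y0 = phi0 by rewrite /c /lam powRN mulfVK// gt_eqF ?powR_gt0.
    rewrite ge0_ler_powR ?nnegrE ?invr_ge0 ?(ltW r0) ?(ltW phi00)//.
      exact: field_speed_ge0.
    exact: field_speed_le.
  move=> /(_ H); rewrite -mulrA => h.
  have : (S (zm y0) - S (zp y0)) / g <= X y0 * (zp y0 - zm y0).
    by rewrite (ler_pdivrMr _ _ g0) mulrC; exact: h.
  rewrite /Gm /Gp; move: (X y0) (zp y0) (zm y0) (g^-1); clear; move=> *; lra.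
have finish : Phi / g <= Gm b.
  have [zb cb] := zmP b (ab2 _ y0b (lexx _)).
  have := bliss_profile_left p1 r0 HS zb (introT andP (conj (lexx _) (ltW z00))).
  rewrite cb cV S0 -mulrA => h.
  have : X b * (0 - zm b) <= (S (zm b) - Phi) / g.
    by rewrite (ler_pdivlMr _ _ g0) mulrC; exact: h.
  rewrite /Gm; move: (X b) (zm b) (g^-1); clear; move=> *; lra.
move: plus minus start middle finish; rewrite !mulrBr.
move: (lam / _) (Gp a) (Gp y0) (Gm y0) (Gm b) (Phi / g) (P a) (P b) (P y0) (Q a) (Q b) (Q y0).
clear; move=> *; lra.
Qed.

(** With [m = 1 / lam], [T = P b - P a] and [E = q / (q - p)], the dual inequality reads
    [(Q b - Q a) / kap <= m T - Phi m ^ E]. The right-hand side is concave in [m], and the tangent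
    to [m ^ E] at its maximiser bounds it for every [m]. *)
Lemma energy_bliss p q a b F P Q S Phi : 1 < p -> p < q -> a <= b ->
  energy_data p q a b F P Q -> F a = 0 -> 0 < Phi ->
  bliss_profile p ((q - p) / p) S Phi ->
  Q b - Q a <= (p - 1) * (q * Phi / (q - p)) `^ (- ((q - p) / p)) * (P b - P a) `^ (q / p).
Proof.
move=> p1 pq ab D Fa0 Phi0 HS; have [a0 Fa Fm Y Qb] := D.
have p0 : 0 < p by exact: lt_trans p1.
have q0 : 0 < q by exact: lt_trans pq.
have p10 : 0 < p - 1 by rewrite subr_gt0.
have qp0 : 0 < q - p by rewrite subr_gt0.
set T := P b - P a.
have T0 : 0 <= T.
  by rewrite subr_ge0; apply: (energy_P_mono p1 D); rewrite ?lexx.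
have Fb : 0 <= F b by apply: le_trans Fa _; apply: Fm.
(* If [F b = 0] there is no positive maximum of [X] to define [lam], but the bound on the increments
   of [Q] already gives [Q b <= Q a]. *)
move: Fb; rewrite le_eqVlt => /predU1P[Fb|Fb].
  apply: (le_trans (Qb _ _ (lexx _) ab (lexx _))).
  by rewrite -Fb powR0 ?gt_eqF// mul0r !mulr_ge0 ?powR_ge0 ?(ltW p10).
have [lam lam0] := energy_bliss_dual p1 pq ab D Fa0 Fb HS.
rewrite -/T; set kap := q * (p - 1) / p; set r := (q - p) / p.
have kap0 : 0 < kap by rewrite divr_gt0 ?mulr_gt0.
have r0 : 0 < r by rewrite divr_gt0.
pose E := q / (q - p).
have E0 : 0 < E by rewrite divr_gt0.
have E1 : 1 < E by rewrite ltr_pdivlMr// mul1r gtrBl.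
have rE : E - 1 = r^-1 by rewrite /E /r invf_div; field; rewrite gt_eqF.
have -> : p / (q - p) = r^-1 by rewrite /r invf_div.
set m := lam^-1; have m0 : 0 < m by rewrite invr_gt0.
have -> : lam = m^-1 by rewrite invrK.
have lamr : ((m^-1) `^ r^-1)^-1 = m `^ r^-1.
  by rewrite -(powR_inv1 (ltW m0)) -powRrM mulN1r powRN invrK.
rewrite lamr => h.
(* The critical point of [m T - Phi m ^ E], where [T = E Phi m ^ (E - 1)] and [E - 1 = 1 / r]. *)
pose y := (T / (E * Phi)) `^ r.
have y0 : 0 <= y by exact: powR_ge0.
have yr : E * Phi * y `^ r^-1 = T.
  rewrite /y -powRrM mulfV ?gt_eqF// powRr1; last first.
    by rewrite divr_ge0// mulr_ge0// ltW.
  by field; rewrite !gt_eqF.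
have mE : m * m `^ r^-1 = m `^ E by rewrite -rE mulr_powRB1 ?(ltW m0).
have yE : y * y `^ r^-1 = y `^ E by rewrite -rE mulr_powRB1.
have ht := powR_tangent E1 (ltW m0) y0.
have h2 : (Q b - Q a) / kap <= m * T - Phi * m `^ E.
  rewrite -mE; have := ler_wpM2l (ltW m0) h.
  rewrite mulrDr !mulrA mulfV ?gt_eqF// mul1r => h3.
  by rewrite lerBrDr; apply: le_trans h3; rewrite le_eqVlt; apply/orP; left; apply/eqP; ring.
have h4 : (Q b - Q a) / kap <= T * y * (1 - E^-1).
  apply: le_trans h2 _.
  have h5 := ler_wpM2l (ltW Phi0) ht.
  rewrite rE in h5.
  have h6 : Phi * (y `^ E + E * y `^ r^-1 * (m - y)) = T * y / E + T * (m - y).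
    rewrite -yE; apply: tangent_arith; [by rewrite gt_eqF|exact: yr].
  move: h5; rewrite h6; have -> : T * y * (1 - E^-1) = T * y - T * y / E by ring.
  clear; lra.
rewrite ler_pdivrMr// in h4; apply: le_trans h4 _.
by rewrite /y /E /kap /r bliss_constant.
Qed.

End energy_bliss.

(** * Lebesgue measure on the half-line and the Gamma function *)

Section completed_measure.
Context {R : realType}.
Implicit Types (A D : set R) (f : R -> \bar R) (C : R).

Local Notation lam := (@lebesgue_measure R).
Local Notation mu :=
  (@completed_lebesgue_measure R : {measure set (lebesgueR R) -> \bar R}).

Lemma measurable_lebesgueR A : measurable A -> measurable (A : set (lebesgueR R)).
Proof. exact: sub_caratheodory. Qed.

Lemma measurable_fun_lebesgueR D f : measurable D -> measurable_fun D f ->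
  measurable_fun (T := lebesgueR R) D f.
Proof. by move=> mD mf _ B mB; apply: measurable_lebesgueR; exact: mf. Qed.

(** The identity map is measurable from the Lebesgue to the Borel sets and pushes the completed
    measure forward to Lebesgue measure on Borel sets. *)
Lemma integral_lebesgueR D f : measurable D -> measurable_fun D f ->
  (forall x, D x -> 0 <= f x) ->
  \int[mu]_(x in D) f x = \int[lam]_(x in D) f x.
Proof.
move=> mD mf f0.
have mid : measurable_fun setT (id : lebesgueR R -> measurableTypeR R).
  by move=> _ B mB; rewrite setTI; exact: measurable_lebesgueR.
have := @ge0_integral_pushforward _ _ _ _ R _ mid mu D f mD mf.
move=> /(_ ltac:(by move=> x; rewrite inE; exact: f0)) <-.
exact: eq_measure_integral.
Qed.

Let scaleR C (x : measurableTypeR R) : measurableTypeR R := (C * x)%R.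

Let measurable_scaleR C : measurable_fun setT (scaleR C).
Proof. exact: mulrl_measurable. Qed.

(** The left-hand side is a measure in [A] that gives every []a, b]] its length, so it is Lebesgue
    measure by uniqueness. *)
Lemma lebesgue_measure_preimage_scale C A : (0 < C)%R -> measurable A ->
  C%:E * lam (( *%R C) @^-1` A) = lam A.
Proof.
move=> C0 mA.
have nu : {nu : {measure set (measurableTypeR R) -> \bar R} |
    forall B, nu B = C%:E * lam (( *%R C) @^-1` B)}.
  unshelve eexists (mscale (NngNum (ltW C0)) (pushforward lam (scaleR C))) => //.
case: nu => nu nuE; rewrite -nuE.
apply/esym/lebesgue_measure_unique => // _ [[a b] _ <-].
rewrite nuE.
have -> : ( *%R C) @^-1` `]a, b]%classic = `](a / C)%R, (b / C)%R]%classic.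
  apply/seteqP; split=> x /=; rewrite !in_itv/= ltr_pdivrMr// ler_pdivlMr//;
    by rewrite (mulrC C).
rewrite !lebesgue_measure_itv/= !lte_fin ltr_pM2r ?invr_gt0//.
case: ifP => _; last by rewrite mule0.
by rewrite -!EFinD -EFinM -mulrBl mulrC mulfVK// gt_eqF.
Qed.

(** A Lebesgue measurable set is a Borel set together with a subset of a Borel null set, and the
    Borel case applies to both Borel sets. *)
Lemma completed_lebesgue_scale C A : (0 < C)%R ->
  measurable (A : set (lebesgueR R)) ->
  measurable (( *%R C) @^-1` A : set (lebesgueR R)) /\
  C%:E * mu (( *%R C) @^-1` A) = mu A.
Proof.
move=> C0 mA.
have : completed_algebra_gen lam A.
  by rewrite -g_sigma_completed_algebra_genE completed_caratheodory_measurable.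
move=> [B mB [N [M [mM M0 NM]]] BNA].
have mC D : measurable D -> measurable (( *%R C) @^-1` D).
  by move=> mD; rewrite -[_ @^-1` _]setTI; apply: (mulrl_measurable C).
have pM0 : lam (( *%R C) @^-1` M) = 0.
  have := lebesgue_measure_preimage_scale C0 mM; rewrite M0 => /eqP.
  by rewrite mule_eq0 eqe gt_eqF//= => /eqP.
have mN' : measurable (( *%R C) @^-1` N : set (lebesgueR R)).
  apply: completed_lebesgue_measure_is_complete.
  exists (( *%R C) @^-1` M); split; [exact: (measurable_lebesgueR (mC _ mM))|exact: pM0|].
  by move=> x; exact: NM.
(* A set squeezed between [D] and [D] enlarged by a null set has the measure of [D]; this is used
   for [A] and for its preimage. *)
have eqB D E : measurable D -> measurable E -> lam E = 0 ->
    forall F, D `<=` F -> F `<=` D `|` E -> measurable (F : set (lebesgueR R)) ->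
    mu F = lam D.
  move=> mD mE E0 F DF FDE mF; apply/eqP; rewrite eq_le; apply/andP; split.
    apply: (@le_trans _ _ (mu (D `|` E))).
      apply: le_measure => //; rewrite inE//.
      by apply: measurableU; exact: measurable_lebesgueR.
    apply: (@le_trans _ _ (lam D + lam E)); last by rewrite E0 adde0.
    exact: (measureU2 lam mD mE).
  rewrite -[lam D]/(mu D); apply: le_measure => //; rewrite inE//.
  exact: measurable_lebesgueR.
have pA : ( *%R C) @^-1` A = ( *%R C) @^-1` B `|` ( *%R C) @^-1` N.
  by rewrite -BNA preimage_setU.
have mpA : measurable (( *%R C) @^-1` A : set (lebesgueR R)).
  by rewrite pA; apply: measurableU => //; exact: (measurable_lebesgueR (mC _ mB)).
split=> //.
rewrite (eqB _ _ (mC _ mB) (mC _ mM) pM0)//; first last.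
- by rewrite pA; apply: setUS => x; exact: NM.
- by rewrite pA; exact: subsetUl.
rewrite lebesgue_measure_preimage_scale// (eqB _ _ mB mM M0 A)//.
- by rewrite -BNA; exact: subsetUl.
- by rewrite -BNA; exact: setUS.
Qed.

Lemma integral_completed_scale C D f : (0 < C)%R ->
  measurable (D : set (lebesgueR R)) -> measurable_fun (T := lebesgueR R) D f ->
  (forall x, D x -> 0 <= f x) ->
  C%:E * \int[mu]_(x in ( *%R C) @^-1` D) f (C * x)%R = \int[mu]_(x in D) f x.
Proof.
move=> C0 mD mf f0.
pose sc (x : lebesgueR R) : lebesgueR R := (C * x)%R.
have msc : measurable_fun setT sc.
  by move=> _ B mB; rewrite setTI; exact: (completed_lebesgue_scale C0 mB).1.
have mscD := (completed_lebesgue_scale C0 mD).1.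
have := @ge0_integral_pushforward _ _ _ _ R _ msc mu D f mD mf.
move=> /(_ ltac:(by move=> x; rewrite inE; exact: f0)).
rewrite -[RHS]/(\int[mu]_(x in ( *%R C) @^-1` D) f (C * x)%R) => <-.
rewrite -[LHS](@ge0_integral_mscale _ (lebesgueR R) R
  (pushforward mu sc) D mD (NngNum (ltW C0)) f mf f0).
apply: eq_measure_integral => A mA _; exact: (completed_lebesgue_scale C0 mA).2.
Qed.

End completed_measure.

(** * Integrals over the half-line, Tonelli's theorem and the fundamental theorem of calculus *)

Section integration_on_half_line.
Context {R : realType}.
Implicit Types (a b c l x y u : R) (f g : R -> \bar R) (F h : R -> R).

Local Notation lam := (@lebesgue_measure R).

(** Explicit integrands are Borel, so this integral is taken for Lebesgue measure on Borel sets;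
    [integral_lebesgueR] passes to the completed measure. *)
Definition pint f := \int[lam]_(x in `]0%R, +oo[) f x.

Lemma eq_pint f g : (forall x, (0 < x)%R -> f x = g x) -> pint f = pint g.
Proof.
by move=> fg; apply: eq_integral => x; rewrite inE/= in_itv/= andbT => /fg.
Qed.

Lemma pint_ge0 f : (forall x, (0 < x)%R -> 0 <= f x) -> 0 <= pint f.
Proof.
by move=> f0; apply: integral_ge0 => x /=; rewrite in_itv/= andbT => /f0.
Qed.

Lemma le_pint f g : (forall x, (0 < x)%R -> 0 <= f x) ->
  measurable_fun setT f -> measurable_fun setT g ->
  (forall x, (0 < x)%R -> f x <= g x) -> pint f <= pint g.
Proof.
move=> f0 mf mg fg; apply: ge0_le_integral => //.
- by move=> x /=; rewrite in_itv/= andbT => /f0.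
- exact: measurable_funTS.
- exact: measurable_funTS.
- by move=> x /=; rewrite in_itv/= andbT => /fg.
Qed.

Lemma pintZl c f : (0 <= c)%R -> (forall x, (0 < x)%R -> 0 <= f x) ->
  measurable_fun setT f -> pint (fun x => c%:E * f x) = c%:E * pint f.
Proof.
move=> c0 f0 mf; apply: ge0_integralZl_EFin => //.
- by move=> x /=; rewrite in_itv/= andbT => /f0.
- exact: measurable_funTS.
Qed.

Lemma pintD f g : (forall x, (0 < x)%R -> 0 <= f x) -> measurable_fun setT f ->
  (forall x, (0 < x)%R -> 0 <= g x) -> measurable_fun setT g ->
  pint (fun x => f x + g x) = pint f + pint g.
Proof.
move=> f0 mf g0 mg; apply: ge0_integralD => //.
- by move=> x /=; rewrite in_itv/= andbT => /f0.
- exact: measurable_funTS.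
- by move=> x /=; rewrite in_itv/= andbT => /g0.
- exact: measurable_funTS.
Qed.

Lemma pint_scale c f : (0 < c)%R -> (forall x, (0 < x)%R -> 0 <= f x) ->
  measurable_fun setT f -> c%:E * pint (fun x => f (c * x)%R) = pint f.
Proof.
move=> c0 f0 mf.
have mI : measurable (`]0%R, +oo[%classic : set R) by [].
have f0' x : `]0%R, +oo[%classic x -> 0 <= f x.
  by move=> /=; rewrite in_itv/= andbT => /f0.
have mf' : measurable_fun (`]0%R, +oo[%classic : set R) f by exact: measurable_funTS.
rewrite {2}/pint -integral_lebesgueR//.
rewrite -(integral_completed_scale c0 (measurable_lebesgueR mI)
  (measurable_fun_lebesgueR mI mf') f0').
have -> : ( *%R c) @^-1` `]0%R, +oo[%classic = `]0%R, +oo[%classic.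
  by apply/seteqP; split=> x /=; rewrite !in_itv/= !andbT pmulr_rgt0.
congr (_ * _); rewrite integral_lebesgueR//.
  have mfc : measurable_fun (`]0%R, +oo[%classic : set R) (fun x : R => f (c * x)%R).
    by apply: measurable_funTS; apply: measurableT_comp => //; exact: mulrl_measurable.
  exact: mfc.
by move=> x /=; rewrite in_itv/= andbT => x0; apply: f0; rewrite mulr_gt0.
Qed.

Lemma integral_pint (D : set R) f : measurable D ->
  D `<=` `]0%R, +oo[%classic -> \int[lam]_(x in D) f x = pint (f \_ D).
Proof.
move=> mD D0; rewrite /pint -(@integral_mkcondr _ _ _ lam _ D f).
by rewrite (setIidr D0).
Qed.

(** The integrand is extended by zero off the open quadrant and Tonelli's theorem is applied on the
    plane. *)
Lemma pint_tonelli (f : R -> R -> \bar R) :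
  measurable_fun setT (fun z : R * R => f z.1 z.2) ->
  (forall x y, (0 < x)%R -> (0 < y)%R -> 0 <= f x y) ->
  pint (fun x => pint (f x)) = pint (fun y => pint (f ^~ y)).
Proof.
move=> mf f0.
pose I : set R := `]0%R, +oo[%classic.
pose g (z : R * R) := ((fun z => f z.1 z.2) \_ (I `*` I)) z.
have mI : measurable I by exact: measurable_itv.
have mg : measurable_fun setT g.
  apply/(measurable_restrictT _ _).1; first exact: measurableX.
  exact: measurable_funTS.
have g0 z : 0 <= g z.
  rewrite /g /patch; case: ifPn => // /set_mem[].
  by rewrite /I /= !in_itv/= !andbT; exact: f0.
have E (h : R -> R -> \bar R) (h' : R -> R -> \bar R) :
    (forall x y, h' x y = if (x \in I) && (y \in I) then h x y else 0) ->
    \int[lam]_x \int[lam]_y h' x y = pint (fun x => pint (h x)).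
  move=> hh; rewrite /pint [RHS]integral_mkcond; apply: eq_integral => x _.
  rewrite patchE -/I; case: ifPn => xI.
    rewrite [RHS]integral_mkcond; apply: eq_integral => y _.
    by rewrite hh patchE xI.
  rewrite (_ : h' x = cst 0) ?integral0//.
  by apply/funext => y; rewrite hh (negbTE xI).
have gE x y : g (x, y) = if (x \in I) && (y \in I) then f x y else 0.
  by rewrite /g patchE in_setX.
have H := @fubini_tonelli _ _ _ _ R lam lam g mg g0.
apply: etrans (esym (E f (fun x y => g (x, y)) gE)) (etrans H _).
by apply: (E (fun y x => f x y) (fun y x => g (x, y))) => y x; rewrite gE andbC.
Qed.

Section fundamental_theorem.
Context (F h : R -> R).
Hypothesis dF : forall x, (0 < x)%R -> is_derive x 1%R F (h x).
Hypothesis ch : forall x, (0 < x)%R -> {for x, continuous h}.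
Hypothesis h0 : forall x, (0 < x)%R -> (0 <= h x)%R.

Let cF x : (0 < x)%R -> {for x, continuous F}.
Proof.
move=> x0; apply/differentiable_continuous/derivable1_diffP.
by have [] := dF x0.
Qed.

Lemma integral_FTC a b : (0 < a)%R -> (a <= b)%R ->
  \int[lam]_(x in `]a, b]) (h x)%:E = (F b - F a)%:E.
Proof.
move=> a0; rewrite le_eqVlt => /predU1P[<-|ab].
  by rewrite set_itvoc0 integral_set0 subrr.
have cw : {within (`[a, b]%classic : set R), continuous h}.
  apply: continuous_in_subspaceT => x; rewrite inE/= in_itv/= => /andP[ax _].
  by apply: ch; exact: lt_le_trans ax.
rewrite integral_itv_obnd_cbnd; last first.
  apply/measurable_EFinP; apply: (@measurable_funS _ _ R R (`[a, b]%classic : set R)) => //.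
    by apply: subset_itv; rewrite bnd_simp.
  exact: subspace_continuous_measurable_fun.
rewrite (@continuous_FTC2 R h F a b ab cw)//.
  split.
  - by move=> x; rewrite in_itv/= => /andP[ax _]; have [] := dF (lt_trans a0 ax).
  - by apply: cvg_at_right_filter; exact: cF.
  - by apply: cvg_at_left_filter; apply: cF; exact: lt_trans ab.
move=> x; rewrite in_itv/= => /andP[ax _]; rewrite derive1E.
by have [] := dF (lt_trans a0 ax).
Qed.

Let mh a b : (0 <= a)%R -> measurable_fun (`]a, b]%classic : set R) (EFin \o h).
Proof.
move=> a0; apply/measurable_EFinP.
apply: (@measurable_funS _ _ R R (`]0%R, +oo[%classic : set R)) => //.
  move=> x /=; rewrite !in_itv/= andbT => /andP[ax _]; exact: le_lt_trans ax.
apply: open_continuous_measurable_fun; first exact: interval_open.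
by move=> x; rewrite inE/= in_itv/= andbT; exact: ch.
Qed.

(** [h] may be unbounded near 0, so []0, b]] is exhausted by the intervals []b / n.+1, b]], on which
    the fundamental theorem applies. *)
Lemma integral_FTC0 l b : (0 < b)%R -> F x @[x --> 0%R^'+] --> l ->
  \int[lam]_(x in `]0%R, b]) (h x)%:E = (F b - l)%:E.
Proof.
move=> b0 Fl.
pose D (n : nat) : set R := `](b / n.+1%:R)%R, b]%classic.
have b0n n : (0 < b / n.+1%:R)%R by rewrite divr_gt0.
have DE : `]0%R, b]%classic = \bigcup_n D n.
  apply/seteqP; split=> [x|x [n _]]; rewrite /D /= !in_itv/= => /andP[x0 xb].
    exists (Num.truncn (b / x)) => //=; rewrite in_itv/= xb andbT.
    rewrite ltr_pdivrMr// mulrC -ltr_pdivrMr//; apply: real_truncnS_gt.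
    exact: num_real.
  by rewrite xb (lt_trans (b0n n)).
have nd : nondecreasing_seq D.
  move=> m n mn; rewrite subsetEset => x /=; rewrite /D /= !in_itv/= => /andP[+ ->].
  rewrite andbT; apply: le_lt_trans; rewrite ler_pM2l// lef_pV2 ?posrE//.
  by rewrite ler_nat ltnS.
have H : \int[lam]_(x in D n) (h x)%:E @[n --> \oo] -->
    \int[lam]_(x in `]0%R, b]) (h x)%:E.
  rewrite DE.
  apply: (@ge0_nondecreasing_set_cvg_integral _ (measurableTypeR R) R D (EFin \o h) lam nd).
  - by move=> n; exact: measurable_itv.
  - by move=> n; apply: mh; exact: ltW.
  - move=> n x; rewrite /D /= in_itv/= lee_fin => /andP[x0 _]; apply: h0.
    exact: lt_trans x0.
apply: (cvg_unique _ H) => //.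
have -> : (fun n => \int[lam]_(x in D n) (h x)%:E) =
    EFin \o (fun n : nat => F b - F (b / n.+1%:R))%R.
  apply/funext => n; rewrite /D integral_FTC// ler_pdivrMr// ler_peMr ?(ltW b0)//.
  by rewrite ler1n.
apply/fine_cvgP; split; first exact: nearW.
apply: cvgB; first exact: cvg_cst.
move/cvg_at_rightP : Fl; apply; split => //.
rewrite -(mulr0 b); apply: cvgM; first exact: cvg_cst.
exact: cvg_harmonic.
Qed.

Lemma integral_FTCy l a : (0 < a)%R -> F x @[x --> +oo%R] --> l ->
  \int[lam]_(x in `]a, +oo[) (h x)%:E = (l - F a)%:E.
Proof.
move=> a0 Fl; rewrite integral_itv_obnd_cbnd; last first.
  apply/measurable_EFinP; apply: (@measurable_funS _ _ R R (`]0%R, +oo[%classic : set R)) => //.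
    by move=> x /=; rewrite !in_itv/= !andbT; exact: lt_trans.
  apply: open_continuous_measurable_fun; first exact: interval_open.
  by move=> x; rewrite inE/= in_itv/= andbT; exact: ch.
rewrite (@ge0_continuous_FTC2y R h F a l)//.
- by move=> x ax; apply: h0; exact: lt_le_trans ax.
- apply: continuous_in_subspaceT => x; rewrite inE/= in_itv/= andbT => ax.
  by apply: ch; exact: lt_le_trans ax.
- by move=> x ax; have [] := dF (lt_trans a0 ax).
- by apply: cvg_at_right_filter; exact: cF.
- move=> x; rewrite in_itv/= andbT => ax; rewrite derive1E.
  by have [] := dF (lt_trans a0 ax).
Qed.

End fundamental_theorem.

End integration_on_half_line.

(** * Measurability of explicit real expressions *)

Section measurability.
Context {d} {T : measurableType d} {R : realType}.
Implicit Types f : T -> R.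

Lemma measurable_fun_powRl (D : set T) f (e : R) : measurable_fun D f ->
  measurable_fun D (fun x => f x `^ e)%R.
Proof. by move=> mf; exact: (measurableT_comp (measurable_powR e) mf). Qed.

Lemma measurable_fun_expR (D : set T) f : measurable_fun D f ->
  measurable_fun D (fun x => expR (f x)).
Proof. by move=> mf; exact: (measurableT_comp (@measurable_expR R) mf). Qed.

Lemma measurable_fun_opp (D : set T) f : measurable_fun D f ->
  measurable_fun D (fun x => - f x)%R.
Proof. by move=> mf; exact: measurable_funN. Qed.

End measurability.

(** Recursion on the syntax of the integrand; a goal that fits no pattern is taken for a
    conditional, whose test and branches become the next goals. *)
Ltac measurable_real := repeat (cbv beta; lazymatch goal with
  | |- measurable_fun _ (fun x => EFin (@?f x)) =>
      apply: (proj2 (@measurable_EFinP _ _ _ _ f))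
  | |- measurable_fun _ (fun x => GRing.add (@?f x) (@?g x)) =>
      apply: (@measurable_funD _ _ _ _ f g)
  | |- measurable_fun _ (fun x => GRing.mul (@?f x) (@?g x)) =>
      apply: (@measurable_funM _ _ _ _ f g)
  | |- measurable_fun _ (fun x => GRing.opp (@?f x)) =>
      apply: (@measurable_fun_opp _ _ _ _ f)
  | |- measurable_fun _ (fun x => expR (@?f x)) =>
      apply: (@measurable_fun_expR _ _ _ _ f)
  | |- measurable_fun _ (fun x => powR (@?f x) ?e) =>
      apply: (@measurable_fun_powRl _ _ _ _ f)
  | |- measurable_fun _ (fun x => Order.le (@?f x) (@?g x)) =>
      apply: (@measurable_fun_ler _ _ _ _ f g)
  | |- measurable_fun _ (fun x => Order.lt (@?f x) (@?g x)) =>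
      apply: (@measurable_fun_ltr _ _ _ _ f g)
  | |- measurable_fun _ (Order.le ?a) =>
      refine (@measurable_fun_ler _ _ _ _ (fun=> a) id _ _)
  | |- measurable_fun _ (Order.lt ?a) =>
      refine (@measurable_fun_ltr _ _ _ _ (fun=> a) id _ _)
  | |- measurable_fun _ expR => exact: measurable_expR
  | |- measurable_fun _ id => exact: measurable_id
  | |- measurable_fun _ (fun x => x) => exact: measurable_id
  | |- measurable_fun _ (fun x => fst x) => exact: measurable_fst
  | |- measurable_fun _ (fun x => snd x) => exact: measurable_snd
  | |- measurable_fun _ (fun _ => ?c) => exact: (@measurable_cst _ _ _ _ _ c)
  | |- _ => refine (measurable_fun_ifT _ _ _)
  end).

(** * The Gamma function and Beta integrals *)

Section gamma_function.
Context {R : realType}.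
Implicit Types (a b c e k m n s t u x y : R) (h : R -> R).

Local Notation lam := (@lebesgue_measure R).

(** An infinite [x] would make the product infinite, so one equation gives both the finiteness of an
    integral and its value. *)
Lemma mule_eq_divr a b (x : \bar R) : (0 < a)%R -> a%:E * x = b%:E ->
  x = (b / a)%:E.
Proof.
move=> a0; case: x => [x| |].
- by rewrite -EFinM => -[<-]; rewrite mulrC mulKf// gt_eqF.
- by rewrite gt0_muley// lte_fin.
- by rewrite gt0_muleNy// lte_fin.
Qed.

Lemma pintZlr c h : (0 <= c)%R -> (forall x, (0 < x)%R -> (0 <= h x)%R) ->
  measurable_fun setT h ->
  pint (fun x => (c * h x)%:E) = c%:E * pint (fun x => (h x)%:E).
Proof.
by move=> c0 h0 mh; rewrite -pintZl//; exact/measurable_EFinP.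
Qed.

Lemma is_derive_expRN x : is_derive x 1%R (fun u => - expR (- u))%R (expR (- x)).
Proof.
have H : is_derive x 1%R (expR \o -%R)%R (expR (- x) * -1)%R.
  exact: is_derive1_comp.
have := is_deriveN H; rewrite mulrN1 opprK; exact.
Qed.

Lemma integral_expRN y : \int[lam]_(x in `[y, +oo[) (expR (- x))%:E = (expR (- y))%:E.
Proof.
have cf : continuous (fun x => expR (- x) : R)%R.
  move=> x; apply: continuous_comp; first exact: opp_continuous.
  exact: continuous_expR.
rewrite (@ge0_continuous_FTC2y R (fun x => expR (- x)) (fun x => - expR (- x))%R y 0%R).
- by rewrite EFinN oppeK add0e.
- by move=> x _; exact: expR_ge0.
- exact: continuous_subspaceT.
- by rewrite -oppr0; apply: cvgN; exact: cvgr_expR.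
- by move=> x _; have [] := is_derive_expRN x.
- by apply: cvg_at_right_filter; apply: cvgN; exact: cf.
- by move=> x _; rewrite derive1E; have [] := is_derive_expRN x.
Qed.

Lemma pint_expRN_ge y : (0 < y)%R ->
  pint (fun u => (if y <= u then expR (- u) else 0)%R%:E) = (expR (- y))%:E.
Proof.
move=> y0; rewrite -integral_expRN integral_pint//; last first.
  by move=> x /=; rewrite !in_itv/= !andbT; exact: lt_le_trans.
apply: eq_pint => u u0; rewrite patchE; case: ifPn => uy.
  by rewrite mem_set//= in_itv/= uy.
by rewrite memNset//= in_itv/= (negbTE uy).
Qed.

Lemma continuous_powR e y : (0 < y)%R -> {for y, continuous (fun y => y `^ e)%R}.
Proof.
move=> y0; apply/differentiable_continuous/derivable1_diffP/derivable_powR.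
by rewrite in_itv/= andbT.
Qed.

(** A layer-cake formula for the power; like [pint_expRN_ge] for the exponential, it lets Tonelli's
    theorem stand in for integration by parts and substitution. *)
Lemma pint_powR_le x u : (0 < x)%R -> (0 < u)%R ->
  pint (fun y => (if y <= u then x * y `^ (x - 1) else 0)%R%:E) = (u `^ x)%:E.
Proof.
move=> x0 u0.
transitivity (\int[lam]_(y in `]0%R, u]) (x * y `^ (x - 1))%:E).
  rewrite integral_pint//; last by move=> y /=; rewrite !in_itv/= andbT => /andP[].
  apply: eq_pint => y y0; rewrite patchE; case: ifPn => yu.
    by rewrite mem_set//= in_itv/= y0.
  by rewrite memNset//= in_itv/= (negbTE yu) andbF.
rewrite (@integral_FTC0 R (fun y => y `^ x)%R (fun y => x * y `^ (x - 1))%R _ _ _ 0%R)//.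
- by rewrite subr0.
- move=> y y0; apply: cvgM; first exact: cvg_cst.
  exact: continuous_powR.
- by move=> y y0; rewrite mulr_ge0 ?powR_ge0 ?(ltW x0).
- exact: powR_cvg0.
Qed.

(** The extended-valued integral, so that the functional equation can be proved before finiteness,
    which depends on it. *)
Let gammaE s := pint (fun t => (t `^ (s - 1) * expR (- t))%:E).

Let gammaE_ge0 s : 0 <= gammaE s.
Proof. by apply: pint_ge0 => x _; rewrite lee_fin mulr_ge0 ?powR_ge0 ?expR_ge0. Qed.

Let gammaE1 : gammaE 1 = 1.
Proof.
rewrite -[RHS](_ : (expR (- 0))%:E = 1); last by rewrite oppr0 expR0.
rewrite -integral_expRN -integral_itv_obnd_cbnd; last first.
  by apply: measurable_funTS; measurable_real.
by apply: eq_pint => x x0; rewrite subrr powRr0 mul1r.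
Qed.

(** Writing [u ^ x] as the integral of [x y ^ (x - 1)] over [y <= u] and exchanging the integrals
    leaves the integral of [expR (- u)] over [u >= y]. *)
Let gammaES x : (0 < x)%R -> gammaE (x + 1) = x%:E * gammaE x.
Proof.
move=> x0; rewrite /gammaE.
transitivity (pint (fun u => pint (fun y =>
    ((if y <= u then x * y `^ (x - 1) else 0) * expR (- u))%R%:E))).
  apply: eq_pint => u u0; rewrite addrK EFinM -pint_powR_le// muleC -pintZlr.
  - by apply: eq_pint => y _; rewrite mulrC.
  - exact: expR_ge0.
  - by move=> y _; case: ifP => // _; rewrite mulr_ge0 ?powR_ge0 ?(ltW x0).
  - by measurable_real.
rewrite pint_tonelli; first last.
- move=> u y _ _; rewrite lee_fin; case: ifP => _; rewrite ?mul0r//.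
  by rewrite !mulr_ge0 ?powR_ge0 ?expR_ge0 ?(ltW x0).
- by measurable_real.
rewrite -pintZlr.
- apply: eq_pint => y y0.
  rewrite mulrA [RHS]EFinM -pint_expRN_ge// -pintZlr.
  + by apply: eq_pint => u _; case: ifP; rewrite ?mul0r ?mulr0.
  + by rewrite mulr_ge0 ?powR_ge0 ?(ltW x0).
  + by move=> u _; case: ifP => // _; exact: expR_ge0.
  + by measurable_real.
- exact: ltW.
- by move=> y _; rewrite mulr_ge0 ?powR_ge0 ?expR_ge0.
- by measurable_real.
Qed.

(** On [(0, 1]] the exponential is at most 1; beyond 1 the exponent [s] is raised to an integer,
    where the functional equation gives finiteness by induction. *)
Let gammaE_lty s : (0 < s)%R -> gammaE s < +oo.
Proof.
move=> s0.
have fact (n : nat) : gammaE n.+1%:R < +oo.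
  elim: n => [|n IH]; first by rewrite gammaE1 ltry.
  by rewrite -(natr1 n.+1) gammaES// lte_mul_pinfty// lee_fin.
pose n := Num.truncn s.
have sn : (s <= n.+1%:R)%R.
  by apply/ltW/real_truncnS_gt; exact: num_real.
apply: (@le_lt_trans _ _ (pint (fun t => (s^-1 * (if t <= 1 then s * t `^ (s - 1) else 0))%R%:E)
    + gammaE n.+1%:R)).
  rewrite -pintD//; first last.
  - by measurable_real.
  - by move=> t _; rewrite lee_fin mulr_ge0 ?powR_ge0 ?expR_ge0.
  - by measurable_real.
  - move=> t _; rewrite lee_fin; case: ifP => _; rewrite ?mulr0//.
    by rewrite !mulr_ge0 ?powR_ge0 ?invr_ge0 ?(ltW s0).
  apply: le_pint.
  - by move=> t _; rewrite lee_fin mulr_ge0 ?powR_ge0 ?expR_ge0.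
  - by measurable_real.
  - by apply: emeasurable_funD; measurable_real.
  - move=> t t0; rewrite -EFinD lee_fin; have [t1|t1] := leP t 1%R.
      rewrite mulKf ?gt_eqF// -[leLHS]addr0 lerD ?mulr_ge0 ?powR_ge0 ?expR_ge0//.
      by rewrite ler_piMr ?powR_ge0// -expR0 ler_expR oppr_le0 ltW.
    rewrite mulr0 add0r ler_wpM2r ?expR_ge0// ler_powR ?(ltW t1)//.
    by rewrite lerD2r.
rewrite lte_add_pinfty// pintZlr.
- by rewrite pint_powR_le// -EFinM ltry.
- by rewrite invr_ge0 ltW.
- by move=> t _; case: ifP => // _; rewrite mulr_ge0 ?powR_ge0 ?(ltW s0).
- by measurable_real.
Qed.

Lemma pint_Gamma s : (0 < s)%R ->
  pint (fun t => (t `^ (s - 1) * expR (- t))%:E) = (Gamma s)%:E.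
Proof.
move=> s0; rewrite -[LHS]/(gammaE s) -[LHS]fineK//.
by rewrite ge0_fin_numE// gammaE_lty.
Qed.

Lemma Gamma1 : Gamma (1 : R) = 1%R.
Proof. by apply: EFin_inj; rewrite -pint_Gamma//; exact: gammaE1. Qed.

Lemma GammaS x : (0 < x)%R -> Gamma (x + 1) = (x * Gamma x)%R.
Proof.
move=> x0; apply: EFin_inj; rewrite EFinM -!pint_Gamma ?addr_gt0//.
exact: gammaES.
Qed.

(** For arguments at least 1 the integrand exceeds [expR (- u)] on [u >= 1]; the functional equation
    carries positivity down to [(0, 1)]. *)
Lemma Gamma_gt0 s : (0 < s)%R -> (0 < Gamma s)%R.
Proof.
have ge1 t : (1 <= t)%R -> (0 < Gamma t)%R.
  move=> t1; rewrite -lte_fin -pint_Gamma ?(lt_le_trans ltr01)//.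
  apply: lt_le_trans (_ : (expR (- 1))%:E <= _); first by rewrite lte_fin expR_gt0.
  rewrite -pint_expRN_ge//; apply: le_pint.
  - by move=> u _; rewrite lee_fin; case: ifP => // _; exact: expR_ge0.
  - by measurable_real.
  - by measurable_real.
  - move=> u u0; rewrite lee_fin; case: ifP => u1; last first.
      by rewrite mulr_ge0 ?powR_ge0 ?expR_ge0.
    rewrite ler_peMl ?expR_ge0// -[leLHS](powRr0 u) ler_powR//.
    by rewrite subr_ge0.
move=> s0; have := ge1 (s + 1)%R; rewrite lerDr (ltW s0) => /(_ isT).
by rewrite GammaS// pmulr_rgt0.
Qed.

Lemma pint_Gamma_scale k s : (0 < k)%R -> (0 < s)%R ->
  pint (fun u => (u `^ (s - 1) * expR (- (k * u)))%:E) = (k `^ (- s) * Gamma s)%:E.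
Proof.
move=> k0 s0; rewrite EFinM -pint_Gamma//.
rewrite -(@pint_scale _ k (fun t => (t `^ (s - 1) * expR (- t))%:E))//; first last.
- by measurable_real.
- by move=> u _; rewrite lee_fin mulr_ge0 ?powR_ge0 ?expR_ge0.
rewrite muleA -EFinM -pintZlr.
- apply: eq_pint => u u0; rewrite powRM ?(ltW k0) ?(ltW u0)//.
  have -> : (k `^ (- s) * k * (k `^ (s - 1) * u `^ (s - 1) * expR (- (k * u))) =
     (k * k `^ (s - 1)) * k `^ (- s) * (u `^ (s - 1) * expR (- (k * u))))%R by ring.
  by rewrite mulr_powRB1 ?(ltW k0)// powRN divff ?mul1r// gt_eqF// powR_gt0.
- by rewrite mulr_ge0 ?powR_ge0 ?(ltW k0).
- by move=> u _; rewrite mulr_ge0 ?powR_ge0 ?expR_ge0.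
- by measurable_real.
Qed.

(* The Beta integral, from the double integral of
   [t ^ (a - 1) u ^ (c - 1) exp (- (1 + t) u)]. *)
Lemma pint_beta a c : (0 < a)%R -> (a < c)%R ->
  pint (fun t => (t `^ (a - 1) * (1 + t) `^ (- c))%:E) =
  (Gamma a * Gamma (c - a) / Gamma c)%:E.
Proof.
move=> a0 ac; have c0 : (0 < c)%R by exact: lt_trans ac.
have Gc := Gamma_gt0 c0; have Ga := Gamma_gt0 a0.
suff H : (Gamma c)%:E * pint (fun t => (t `^ (a - 1) * (1 + t) `^ (- c))%:E) =
    (Gamma a * Gamma (c - a))%:E.
  exact: mule_eq_divr H.
rewrite -pintZlr; first last.
- by measurable_real.
- by move=> t _; rewrite mulr_ge0 ?powR_ge0.
- exact: ltW.
transitivity (pint (fun t => pint (fun u =>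
    (t `^ (a - 1) * (u `^ (c - 1) * expR (- ((1 + t) * u))))%:E))).
  apply: eq_pint => t t0; rewrite pintZlr.
  - rewrite pint_Gamma_scale ?addr_gt0// -EFinM; congr EFin.
    by rewrite [RHS]mulrA [RHS]mulrC.
  - exact: powR_ge0.
  - by move=> u _; rewrite mulr_ge0 ?powR_ge0 ?expR_ge0.
  - by measurable_real.
rewrite pint_tonelli; first last.
- by move=> t u _ _; rewrite lee_fin !mulr_ge0 ?powR_ge0 ?expR_ge0.
- by measurable_real.
rewrite EFinM -(@pint_Gamma (c - a)%R) ?subr_gt0// -pintZlr; first last.
- by measurable_real.
- by move=> u _; rewrite mulr_ge0 ?powR_ge0 ?expR_ge0.
- exact: ltW.
apply: eq_pint => u u0.
have -> : (Gamma a * (u `^ (c - a - 1) * expR (- u)))%:E =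
    (u `^ (c - 1) * expR (- u))%:E * (u `^ (- a) * Gamma a)%:E.
  rewrite -EFinM; congr EFin.
  have -> : (c - a - 1 = (c - 1) + - a)%R by ring.
  rewrite powRD; first by ring.
  by apply/implyP => _; rewrite gt_eqF.
rewrite -pint_Gamma_scale// -pintZlr.
- apply: eq_pint => t _; congr EFin.
  by rewrite mulrDl mul1r opprD expRD (mulrC u t); ring.
- by rewrite mulr_ge0 ?powR_ge0 ?expR_ge0.
- by move=> t _; rewrite mulr_ge0 ?powR_ge0 ?expR_ge0.
- by measurable_real.
Qed.

(** For [k = 1] the layer-cake formula reduces the integral to the lengths [u ^ (1 / m)] of the sets
    where [y ^ m <= u]; a dilation gives general [k]. *)
Lemma pint_expRN_powR m k : (0 < m)%R -> (0 < k)%R ->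
  pint (fun y => (expR (- (k * y `^ m)))%:E) =
  (k `^ (- m^-1) * Gamma (m^-1 + 1))%:E.
Proof.
move=> m0 k0; have mV0 : (0 < m^-1)%R by rewrite invr_gt0.
have H : pint (fun y => (expR (- y `^ m))%:E) = (Gamma (m^-1 + 1))%:E.
  rewrite -pint_Gamma ?addr_gt0//.
  transitivity (pint (fun y => pint (fun u =>
      ((if y `^ m <= u then expR (- u) else 0)%R)%:E))).
    by apply: eq_pint => y y0; rewrite pint_expRN_ge// powR_gt0.
  rewrite pint_tonelli; first last.
  - by move=> t u _ _; rewrite lee_fin; case: ifP => // _; exact: expR_ge0.
  - by measurable_real.
  apply: eq_pint => u u0; rewrite addrK.
  transitivity (pint (fun y =>
      (expR (- u) * (if y <= u `^ m^-1 then 1 * y `^ (1 - 1) else 0))%R%:E)).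
    apply: eq_pint => y y0; rewrite subrr powRr0 mulr1.
    have -> : (y `^ m <= u)%R = (y <= u `^ m^-1)%R.
      apply/idP/idP => [yu|yu].
        have := @ge0_ler_powR R m^-1 (ltW mV0) _ _ _ _ yu.
        rewrite !nnegrE powR_ge0 (ltW u0) -powRrM mulfV ?gt_eqF// powRr1 ?(ltW y0)//.
        exact.
      have := @ge0_ler_powR R m (ltW m0) _ _ _ _ yu.
      rewrite !nnegrE powR_ge0 (ltW y0) -powRrM mulVf ?gt_eqF// powRr1 ?(ltW u0)//.
      exact.
    by case: ifP => _; rewrite ?mulr1 ?mulr0.
  rewrite pintZlr.
  - by rewrite pint_powR_le ?powR_gt0// powRr1 ?powR_ge0// -EFinM mulrC.
  - exact: expR_ge0.
  - by move=> y _; case: ifP => // _; rewrite mul1r powR_ge0.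
  - by measurable_real.
rewrite EFinM -H.
pose c := (k `^ m^-1)%R; have c0 : (0 < c)%R by rewrite powR_gt0.
rewrite -(@pint_scale _ c (fun y => (expR (- y `^ m))%:E))//; last by measurable_real.
rewrite muleA -EFinM powRN mulVf ?gt_eqF// mul1e.
apply: eq_pint => y y0.
by rewrite powRM ?(ltW c0) ?(ltW y0)// /c -powRrM mulVf ?gt_eqF// powRr1 ?(ltW k0).
Qed.

(** Both sides of Bliss's inequality for his extremal are integrals of this form. As for the Beta
    integral, [(1 + y ^ m) ^ (- n)] is written as a Gamma integral in [u] and the integral over [y]
    is done before that over [u]. *)
Lemma pint_cauchy m n : (0 < m)%R -> (m^-1 < n)%R ->
  pint (fun y => ((1 + y `^ m) `^ (- n))%:E) =
  (Gamma (m^-1 + 1) * Gamma (n - m^-1) / Gamma n)%:E.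
Proof.
move=> m0 mn; have mV0 : (0 < m^-1)%R by rewrite invr_gt0.
have n0 : (0 < n)%R by exact: lt_trans mn.
have Gn := Gamma_gt0 n0.
have Gm : (0 < Gamma (m^-1 + 1))%R by rewrite Gamma_gt0 ?addr_gt0.
suff H : (Gamma n)%:E * pint (fun y => ((1 + y `^ m) `^ (- n))%:E) =
    (Gamma (m^-1 + 1) * Gamma (n - m^-1))%:E.
  exact: mule_eq_divr H.
rewrite -pintZlr; first last.
- by measurable_real.
- by move=> t _; rewrite powR_ge0.
- exact: ltW.
transitivity (pint (fun y => pint (fun u =>
    (u `^ (n - 1) * expR (- ((1 + y `^ m) * u)))%:E))).
  apply: eq_pint => y y0; rewrite pint_Gamma_scale ?addr_gt0 ?powR_gt0//.
  by rewrite mulrC.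
rewrite pint_tonelli; first last.
- by move=> t u _ _; rewrite lee_fin !mulr_ge0 ?powR_ge0 ?expR_ge0.
- by measurable_real.
rewrite EFinM -(@pint_Gamma (n - m^-1)%R) ?subr_gt0// -pintZlr; first last.
- by measurable_real.
- by move=> u _; rewrite mulr_ge0 ?powR_ge0 ?expR_ge0.
- exact: ltW.
apply: eq_pint => u u0.
have -> : (Gamma (m^-1 + 1) * (u `^ (n - m^-1 - 1) * expR (- u)))%:E =
    (u `^ (n - 1) * expR (- u))%:E * (u `^ (- m^-1) * Gamma (m^-1 + 1))%:E.
  rewrite -EFinM; congr EFin.
  have -> : (n - m^-1 - 1 = (n - 1) + - m^-1)%R by ring.
  rewrite powRD; first by ring.
  by apply/implyP => _; rewrite gt_eqF.
rewrite -pint_expRN_powR// -pintZlr.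
- apply: eq_pint => t _; congr EFin.
  by rewrite mulrDl mul1r opprD expRD (mulrC u (t `^ m)%R); ring.
- by rewrite mulr_ge0 ?powR_ge0 ?expR_ge0.
- by move=> t _; rewrite expR_ge0.
- by measurable_real.
Qed.

End gamma_function.

(** * The Bliss profile and the sharp constant *)

Section bliss_profile_existence.
Context {R : realType}.
Implicit Types (c e m p r t x y z : R).

Local Notation lam := (@lebesgue_measure R).

Lemma powRN_le e x y : (0 < e)%R -> (0 < x)%R -> (x <= y)%R ->
  (y `^ (- e) <= x `^ (- e))%R.
Proof.
move=> e0 x0 xy; have y0 := lt_le_trans x0 xy.
rewrite !powRN lef_pV2 ?posrE ?powR_gt0//.
by rewrite ge0_ler_powR// ?nnegrE ltW.
Qed.

Lemma powRN_swap_le e x y : (0 < e)%R -> (0 < x)%R -> (0 < y)%R ->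
  (x <= y `^ (- e))%R = (y <= x `^ (- e^-1))%R.
Proof.
have half e' a b : (0 < e')%R -> (0 < a)%R -> (0 < b)%R ->
    (a <= b `^ (- e'))%R -> (b <= a `^ (- e'^-1))%R.
  move=> e0 a0 b0 h; have eV0 : (0 < e'^-1)%R by rewrite invr_gt0.
  have := powRN_le eV0 a0 h.
  by rewrite -powRrM mulrNN mulfV ?gt_eqF// powRr1// ltW.
move=> e0 x0 y0; apply/idP/idP; first exact: half.
by move=> h; have := half e^-1%R y x; rewrite invrK invr_gt0; apply.
Qed.

Context p r (p1 : (1 < p)%R) (r0 : (0 < r)%R).

Let p10 : (0 < p - 1)%R. Proof. by rewrite subr_gt0. Qed.
Let p0 : (0 < p)%R. Proof. exact: lt_trans p1. Qed.

(* [z = (1 + t) ^ (- (p - 1))] turns the profile into a Beta integral. *)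
Let zt t := ((1 + t) `^ (- (p - 1)))%R.
(** [dz] is the derivative of [- zt], and [V t] is [phi ^ (1 / r)] at [zt t]. *)
Let dz t := ((p - 1) * (1 + t) `^ (- p))%R.
Let V t := (((p - 1) * t * (1 + t) `^ (- p)) `^ r^-1)%R.

Let dz_ge0 t : (0 <= dz t)%R.
Proof. by rewrite mulr_ge0 ?powR_ge0 ?(ltW p10). Qed.

Let V_ge0 t : (0 <= V t)%R. Proof. exact: powR_ge0. Qed.

Let measurable_zt : measurable_fun setT zt. Proof. rewrite /zt; measurable_real. Qed.
Let measurable_dz : measurable_fun setT dz. Proof. rewrite /dz; measurable_real. Qed.
Let measurable_V : measurable_fun setT V. Proof. rewrite /V; measurable_real. Qed.

Let field_speed_zt t : (0 < t)%R -> (field_speed p (zt t) `^ r^-1)%R = V t.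
Proof.
move=> t0; rewrite /V; congr (_ `^ _)%R; rewrite /field_speed -mulrA; congr (_ * _)%R.
have t10 : (0 < 1 + t)%R by rewrite addr_gt0.
rewrite /zt -powRrM.
have -> : (- (p - 1) * (p / (p - 1)) = - p)%R by field; rewrite gt_eqF.
have -> : ((1 + t) `^ (- (p - 1)) = (1 + t) * (1 + t) `^ (- p))%R.
  have -> : (- (p - 1) = 1 + - p)%R by ring.
  by rewrite powRD ?powRr1 ?(ltW t10)//; apply/implyP => _; rewrite gt_eqF.
by ring.
Qed.

Let zt_gt0 t : (0 < t)%R -> (0 < zt t)%R.
Proof. by move=> t0; rewrite powR_gt0 ?addr_gt0. Qed.

Let zt_lt1 t : (0 < t)%R -> (zt t < 1)%R.
Proof.
move=> t0; rewrite /zt powRN invf_lt1 ?powR_gt0 ?addr_gt0//.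
rewrite -[ltLHS](powRr0 (1 + t)) /powR gt_eqF ?addr_gt0// ltr_expR mul0r.
by rewrite mulr_gt0// ln_gt0// ltrDl.
Qed.

Let is_derive_zt t : (0 < t)%R -> is_derive t 1%R (fun t => - zt t)%R (dz t).
Proof.
move=> t0; have t10 : (0 < 1 + t)%R by rewrite addr_gt0.
have H1 : is_derive t 1%R (fun t : R => 1 + t)%R 1%R.
  have -> : (fun t : R => 1 + t)%R = (fun t => t + 1)%R by apply/funext => u; rewrite addrC.
  exact: is_derive_shift.
have H : is_derive t 1%R ((fun z => z `^ (- (p - 1)))%R \o (fun t => 1 + t)%R)
    (- (p - 1) * (1 + t) `^ (- (p - 1) - 1) * 1)%R.
  by apply: is_derive1_comp; exact: is_derive1_powR.
have := is_deriveN H.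
have -> : (- (- (p - 1) * (1 + t) `^ (- (p - 1) - 1) * 1) = dz t)%R.
  rewrite /dz; have -> : (- (p - 1) - 1 = - p)%R by ring.
  by ring.
exact.
Qed.

(** The substitution [z = zt t] carries [dz t dt] to Lebesgue measure on [(0, 1)]; this checks it on
    the intervals from [x] to 1. For [x = 0] the range of [t] is unbounded and a Beta integral
    replaces the fundamental theorem. *)
Let mass x : (0 <= x)%R -> (x <= 1)%R ->
  pint (fun t => (if x <= zt t then dz t else 0)%R%:E) = (1 - x)%:E.
Proof.
rewrite le_eqVlt => /predU1P[<- _|x0].
  transitivity (pint (fun t => ((p - 1) * (t `^ (1 - 1) * (1 + t) `^ (- p)))%R%:E)).
    apply: eq_pint => t t0; rewrite (ltW (zt_gt0 t0)) subrr powRr0 mul1r//.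
  rewrite pintZlr ?(ltW p10)//; first last.
  - by measurable_real.
  - by move=> t _; rewrite mulr_ge0 ?powR_ge0.
  rewrite pint_beta// Gamma1 mul1r -EFinM subr0; congr EFin.
  rewrite -{3}(subrK 1%R p) GammaS//; field.
  by rewrite !gt_eqF ?Gamma_gt0.
rewrite le_eqVlt => /predU1P[->|x1].
  rewrite subrr; apply: integral0_eq => t; rewrite /= in_itv/= andbT => t0.
  by rewrite leNgt zt_lt1.
(* The solution of [zt T = x]. *)
pose T := (x `^ (- (p - 1)^-1) - 1)%R.
have T0 : (0 < T)%R.
  rewrite subr_gt0 -[ltLHS](powRr0 x) /powR gt_eqF// ltr_expR mul0r.
  by rewrite nmulr_rgt0 ?oppr_lt0 ?invr_gt0// ln_lt0// x0.
transitivity (\int[lam]_(t in `]0%R, T]) (dz t)%:E).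
  rewrite integral_pint//; last by move=> y /=; rewrite !in_itv/= andbT => /andP[].
  apply: eq_pint => t t0; rewrite patchE.
  have -> : (x <= zt t)%R = (t <= T)%R.
    have t10 : (0 < 1 + t)%R by rewrite addr_gt0.
    by rewrite /zt (powRN_swap_le p10 x0 t10) addrC -lerBrDr.
  case: ifPn => tT.
    by rewrite mem_set//= in_itv/= t0.
  by rewrite memNset//= in_itv/= (negbTE tT) andbF.
have czt : forall s, (0 <= s)%R -> {for s, continuous zt}.
  move=> s s0; apply: (@continuous_comp _ _ _ (fun t => 1 + t)%R (fun z => z `^ (- (p - 1)))%R).
    by apply: cvgD; [exact: cvg_cst|exact: cvg_id].
  by apply: continuous_powR; rewrite ltr_wpDr.
rewrite (@integral_FTC0 R (fun t => - zt t)%R dz _ _ _ (- 1)%R)//.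
- congr EFin; rewrite /zt /T (addrC 1%R (_ - _)%R) subrK -powRrM mulrNN mulVf ?gt_eqF//.
  by rewrite powRr1 ?(ltW x0)//; ring.
- move=> t t0; apply: cvgM; first exact: cvg_cst.
  apply: (@continuous_comp _ _ _ (fun t => 1 + t)%R (fun z => z `^ (- p))%R).
    by apply: cvgD; [exact: cvg_cst|exact: cvg_id].
  by apply: continuous_powR; rewrite addr_gt0.
- have z0 : zt 0 = 1%R by rewrite /zt addr0 powR1.
  apply: cvgN; apply: cvg_at_right_filter.
  have H : zt z @[z --> 0%R] --> zt 0 by exact: (czt 0%R (lexx _)).
  by rewrite z0 in H; exact: H.
Qed.

(** The integral of [V t dz t] over the half-line, a Beta integral with parameters [1 / r + 1] and
    [(p - 1) (1 / r + 1)]. *)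
Let Phi := ((p - 1) `^ (r^-1 + 1) *
  (Gamma (r^-1 + 1) * Gamma ((p - 1) * (r^-1 + 1)) / Gamma (p * (r^-1 + 1))))%R.

(** After the substitution [z = zt t] this is the integral of [phi ^ (1 / r)] over [[x, 1]]. *)
Let SE x := pint (fun t => (if x <= zt t then V t * dz t else 0)%R%:E).

Let SE0 : SE 0%R = Phi%:E.
Proof.
have rV0 : (0 < r^-1 + 1)%R by rewrite addr_gt0 ?invr_gt0.
rewrite /Phi EFinM.
have -> : ((p - 1) * (r^-1 + 1) = p * (r^-1 + 1) - (r^-1 + 1))%R by ring.
rewrite -pint_beta//; last by rewrite ltr_pMl.
rewrite -pintZlr ?powR_ge0//; first last.
- by measurable_real.
- by move=> t _; rewrite mulr_ge0 ?powR_ge0.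
apply: eq_pint => t t0; rewrite (ltW (zt_gt0 t0)); congr EFin.
have t10 : (0 < 1 + t)%R by rewrite addr_gt0.
rewrite /V /dz addrK !powRM ?mulr_ge0 ?powR_ge0 ?(ltW p10) ?(ltW t0)//.
rewrite -powRrM [in RHS]powRD ?powRr1 ?(ltW p10)//; last first.
  by apply/implyP => _; rewrite gt_eqF.
have -> : (- (p * (r^-1 + 1)) = - p * r^-1 + - p)%R by ring.
rewrite [in RHS]powRD; first by ring.
by apply/implyP => _; rewrite gt_eqF.
Qed.

Let SE_le x y : (x <= y)%R -> SE y <= SE x.
Proof.
move=> xy; apply: le_pint.
- by move=> t _; rewrite lee_fin; case: ifP => // _; rewrite mulr_ge0.
- apply/measurable_EFinP; apply: measurable_fun_ifT.
  + exact: measurable_fun_ler.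
  + exact: measurable_funM.
  + exact: measurable_cst.
- apply/measurable_EFinP; apply: measurable_fun_ifT.
  + exact: measurable_fun_ler.
  + exact: measurable_funM.
  + exact: measurable_cst.
- move=> t _; rewrite lee_fin; case: ifPn => yz; last by case: ifP => // _; rewrite mulr_ge0.
  by rewrite (le_trans xy yz).
Qed.

Let SE_fin x : (0 <= x)%R -> SE x = (fine (SE x))%:E.
Proof.
move=> x0; rewrite fineK// ge0_fin_numE.
  by rewrite (le_lt_trans (SE_le x0))// SE0 ltry.
by apply: pint_ge0 => t _; rewrite lee_fin; case: ifP => // _; rewrite mulr_ge0.
Qed.

Let band x y t : R := (if (x <= zt t) && (zt t < y) then 1 else 0)%R.

Let measurable_band x y : measurable_fun setT (band x y).
Proof.
apply: measurable_fun_ifT => //; apply: measurable_and.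
  exact: measurable_fun_ler.
exact: measurable_fun_ltr.
Qed.

Let band_ge0 x y t : (0 <= band x y t)%R. Proof. by rewrite /band; case: ifP. Qed.

Let splitD x y (f : R -> R) : (0 <= x)%R -> (x <= y)%R ->
  (forall t, (0 <= f t)%R) -> measurable_fun setT f ->
  pint (fun t => (if x <= zt t then f t else 0)%R%:E) =
  pint (fun t => (if y <= zt t then f t else 0)%R%:E) +
  pint (fun t => (band x y t * f t)%R%:E).
Proof.
move=> x0 xy f0 mf; rewrite -pintD.
- apply: eq_pint => t _; rewrite -EFinD; congr EFin; rewrite /band ltNge.
  have [yz|yz] := leP y (zt t); first by rewrite (le_trans xy yz) mul0r addr0.
  by rewrite andbT; case: ifP => _; rewrite ?mul1r ?mul0r add0r.
- by move=> t _; rewrite lee_fin; case: ifP.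
- by apply/measurable_EFinP/measurable_fun_ifT => //; exact: measurable_fun_ler.
- by move=> t _; rewrite lee_fin mulr_ge0.
- by apply/measurable_EFinP/measurable_funM.
Qed.

Let band_mass x y : (0 <= x)%R -> (x <= y)%R -> (y <= 1)%R ->
  pint (fun t => (band x y t * dz t)%:E) = (y - x)%:E.
Proof.
move=> x0 xy y1; have y0 := le_trans x0 xy; have x1 := le_trans xy y1.
have := splitD x0 xy dz_ge0 measurable_dz; rewrite !mass//.
case: (pint (fun t => (band x y t * dz t)%:E)) => [s| |] //=.
by rewrite -EFinD => -[h]; congr EFin; lra.
Qed.

Let band_speed x y : (0 <= x)%R -> (x <= y)%R ->
  pint (fun t => (band x y t * (V t * dz t))%:E) =
  (fine (SE x) - fine (SE y))%:E.
Proof.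
move=> x0 xy; have y0 := le_trans x0 xy.
have := @splitD x y (fun t => V t * dz t)%R x0 xy (fun t => mulr_ge0 (V_ge0 t) (dz_ge0 t))
  (measurable_funM measurable_V measurable_dz).
rewrite -/(SE x) -/(SE y) (SE_fin x0) (SE_fin y0).
case: (pint (fun t => (band x y t * (V t * dz t))%:E)) => [s| |] //=.
by rewrite -EFinD => -[->]; congr EFin; ring.
Qed.

Lemma bliss_profile_exists : exists S, bliss_profile p r S Phi.
Proof.
exists (fun x => fine (SE x)); split.
- by rewrite SE0.
- rewrite (_ : SE 1%R = 0)//; apply: integral0_eq => t; rewrite /= in_itv/= andbT => t0.
  by rewrite leNgt zt_lt1.
- move=> x y m x0 xy y1 H.
  (* The lower bound [m] may be negative, while the comparison of integrals needs a nonnegative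
     integrand. *)
  suff : (Num.max m 0 * (y - x) <= fine (SE x) - fine (SE y))%R.
    by apply: le_trans; rewrite ler_wpM2r ?subr_ge0// le_max lexx.
  rewrite -lee_fin -band_speed// EFinM -band_mass// -pintZlr.
  + apply: le_pint.
    * move=> t _; rewrite lee_fin; apply: mulr_ge0; last exact: mulr_ge0.
      by rewrite le_max lexx orbT.
    * apply/measurable_EFinP/measurable_funM; first exact: measurable_cst.
      exact: measurable_funM.
    * by apply/measurable_EFinP/measurable_funM => //; exact: measurable_funM.
    * move=> t t0; rewrite lee_fin mulrCA /band;
      case: ifP => [/andP[xz zy]|_]; last by rewrite !mul0r.
      rewrite !mul1r ler_wpM2r// ge_max V_ge0 andbT -field_speed_zt//.
      by apply: H; rewrite xz ltW.
  + by rewrite le_max lexx orbT.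
  + by move=> t _; rewrite mulr_ge0.
  + exact: measurable_funM.
- move=> x y m x0 xy y1 H.
  have m0 : (0 <= m)%R.
    by apply: le_trans (H x _); rewrite ?powR_ge0 ?lexx.
  rewrite -lee_fin -band_speed// EFinM -band_mass// -pintZlr//.
  + apply: le_pint.
    * by move=> t _; rewrite lee_fin; apply: mulr_ge0; [|exact: mulr_ge0].
    * by apply/measurable_EFinP/measurable_funM => //; exact: measurable_funM.
    * apply/measurable_EFinP/measurable_funM; first exact: measurable_cst.
      exact: measurable_funM.
    * move=> t t0; rewrite lee_fin [leRHS]mulrCA /band;
      case: ifP => [/andP[xz zy]|_]; last by rewrite !mul0r.
      rewrite !mul1r ler_wpM2r// -field_speed_zt//.
      by apply: H; rewrite xz ltW.
  + by move=> t _; rewrite mulr_ge0.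
  + exact: measurable_funM.
Qed.

End bliss_profile_existence.

(** * Identification of the constant with [K_ p q] *)

Section sharp_constant.
Context {R : realType}.
Local Open Scope ring_scope.
Implicit Types (a b p q s : R) (F P Q : R -> R).

Definition bliss_exponent p q : R := (p^-1 - q^-1)^-1.

(** For [p < q] the constant [K_ p q] is its power of exponent [- 1 / s]; it is also the integral of
    the [p]-th power of Bliss's extremal. *)
Definition bliss_integral p q : R := let s := bliss_exponent p q in
  Gamma (s / p) * Gamma (s / conj_exponent q) / Gamma s.

Lemma bliss_exponentE p q : 0 < p -> p < q -> bliss_exponent p q = p * q / (q - p).
Proof.
move=> p0 pq; have q0 := lt_trans p0 pq; rewrite /bliss_exponent; field.
by rewrite !gt_eqF ?subr_gt0.
Qed.

Section lt_case.
Context p q (p1 : 1 < p) (pq : p < q).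
Let s := bliss_exponent p q.
Let p0 : 0 < p. Proof. exact: lt_trans p1. Qed.
Let q0 : 0 < q. Proof. exact: lt_trans pq. Qed.
Let q1 : 1 < q. Proof. exact: lt_trans pq. Qed.
Let qp : 0 < q - p. Proof. by rewrite subr_gt0. Qed.
Let p10 : 0 < p - 1. Proof. by rewrite subr_gt0. Qed.
Let q10 : 0 < q - 1. Proof. by rewrite subr_gt0. Qed.

Lemma bliss_exponent_gt0 : 0 < s.
Proof. by rewrite /s bliss_exponentE// divr_gt0// mulr_gt0. Qed.

Lemma bliss_exponent_divp : s / p = q / (q - p).
Proof. by rewrite /s bliss_exponentE//; field; rewrite !gt_eqF. Qed.

(** This is [s / q' = s / p' + 1], because [1 / q' - 1 / p' = 1 / p - 1 / q = 1 / s]. *)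
Lemma bliss_exponent_conj : s / conj_exponent q = s * (p - 1) / p + 1.
Proof.
by rewrite conj_exponentE// /s bliss_exponentE//; field; rewrite !gt_eqF.
Qed.

Let conj0 : 0 < s * (p - 1) / p.
Proof. by rewrite divr_gt0// mulr_gt0// bliss_exponent_gt0. Qed.

Lemma bliss_integral_gt0 : 0 < bliss_integral p q.
Proof.
rewrite /bliss_integral -/s bliss_exponent_conj bliss_exponent_divp.
apply: divr_gt0; last exact/Gamma_gt0/bliss_exponent_gt0.
by apply: mulr_gt0; apply: Gamma_gt0; [exact: divr_gt0|exact: addr_gt0].
Qed.

Lemma K_lt : K_ p q = bliss_integral p q `^ (- s^-1).
Proof.
rewrite /K_ lt_eqF//= -/(bliss_exponent p q) -/s.
have -> : Gamma s / (Gamma (s / p) * Gamma (s / conj_exponent q)) =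
    bliss_integral p q `^ (- 1).
  by rewrite powR_inv1 ?(ltW bliss_integral_gt0)// /bliss_integral -/s invf_div.
by rewrite -powRrM mulN1r.
Qed.

Lemma K_lt_powq : K_ p q `^ q = bliss_integral p q `^ (- ((q - p) / p)).
Proof.
rewrite K_lt -powRrM; congr (_ `^ _).
by rewrite /s bliss_exponentE//; field; rewrite !gt_eqF.
Qed.

End lt_case.

Lemma K_eq_powq p : 1 < p -> K_ p p `^ p = (p - 1) * (p / (p - 1)) `^ p.
Proof.
move=> p1; have p0 : 0 < p by exact: lt_trans p1.
have p10 : 0 < p - 1 by rewrite subr_gt0.
have k0 : 0 < p / (p - 1) by rewrite divr_gt0.
rewrite /K_ eqxx conj_exponentE// powRM ?powR_ge0// -!powRrM mulVf ?gt_eqF//.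
rewrite powRr1 ?(ltW p0)//.
have -> : (p / (p - 1))^-1 * p = p - 1 by field; rewrite !gt_eqF.
rewrite -(mulr_powRB1 (ltW k0) p0) mulrA; congr (_ * _).
by field; rewrite gt_eqF.
Qed.

Lemma K_gt0 p q : 1 < p -> p <= q -> 0 < K_ p q.
Proof.
move=> p1; have p0 : 0 < p by exact: lt_trans p1.
rewrite le_eqVlt => /predU1P[<-|pq].
  rewrite /K_ eqxx mulr_gt0 ?powR_gt0// conj_exponentE// divr_gt0// subr_gt0//.
by rewrite K_lt// powR_gt0// bliss_integral_gt0.
Qed.

Lemma energy_K p q a b F P Q : 1 < p -> p <= q -> a <= b ->
  energy_data p q a b F P Q -> F a = 0 ->
  Q b - Q a <= K_ p q `^ q * (P b - P a) `^ (q / p).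
Proof.
move=> p1 + ab; have p0 : 0 < p by exact: lt_trans p1.
rewrite le_eqVlt => /predU1P[<-|pq] D Fa.
  rewrite divff ?gt_eqF// powRr1; last first.
    by rewrite subr_ge0; apply: (energy_P_mono p1 D); rewrite ?lexx.
  by rewrite K_eq_powq//; exact: energy_hardy D Fa.
have q0 := lt_trans p0 pq.
have qp : 0 < q - p by rewrite subr_gt0.
have p10 : 0 < p - 1 by rewrite subr_gt0.
set r := (q - p) / p; have r0 : 0 < r by rewrite divr_gt0.
have [S HS] := bliss_profile_exists p1 r0.
set Phi := (X in bliss_profile _ _ _ X) in HS.
pose s := bliss_exponent p q.
have s0 : 0 < s by exact: bliss_exponent_gt0.
have rE : r^-1 + 1 = s / p.
  by rewrite /s bliss_exponent_divp// /r invf_div; field; rewrite gt_eqF.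
have T0 := bliss_integral_gt0 p1 pq.
(* Raised to the power [- r], the first factor cancels the [p - 1] of [energy_bliss] and the second
   becomes [K_ p q ^ q]. *)
have PhiE : q * Phi / (q - p) = (p - 1) `^ r^-1 * bliss_integral p q.
  have e1 : (p - 1) * (s / p) = s * (p - 1) / p by field; rewrite gt_eqF.
  have e2 : p * (s / p) = s by field; rewrite gt_eqF.
  rewrite /Phi rE e1 e2 /bliss_integral -/s bliss_exponent_conj//.
  rewrite GammaS; last by rewrite divr_gt0// mulr_gt0.
  rewrite -/s -rE powRD; last by apply/implyP => _; rewrite gt_eqF.
  rewrite powRr1 ?(ltW p10)// rE.
  have -> : s * (p - 1) / p = (p - 1) * (q / (q - p)).
    by rewrite -(bliss_exponent_divp p1 pq) -/s; field; rewrite gt_eqF.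
  have Gs := Gamma_gt0 s0.
  move: (Gamma s) Gs (Gamma (s / p)) (Gamma _) ((p - 1) `^ _) => G G0 A B X.
  by field; rewrite !gt_eqF.
have Phi0 : 0 < Phi.
  have : 0 < q * Phi / (q - p) by rewrite PhiE mulr_gt0// powR_gt0.
  by rewrite pmulr_lgt0 ?invr_gt0// pmulr_rgt0.
have := energy_bliss p1 pq ab D Fa Phi0 HS.
rewrite PhiE K_lt_powq// -/r powRM ?powR_ge0 ?(ltW T0)//.
rewrite -powRrM mulrN mulVf ?gt_eqF// powR_inv1 ?(ltW p10)// mulrA mulfV ?mul1r//.
by rewrite gt_eqF.
Qed.

End sharp_constant.

(** * Primitives of functions in [Lplus] and the integrated Young inequality *)

Section young_integral.
Context {R : realType}.
Implicit Types (p u v w x : R).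

Local Notation mu :=
  (@completed_lebesgue_measure R : {measure set (lebesgueR R) -> \bar R}).

Lemma powR_young p w x : (1 < p)%R -> (0 <= w)%R -> (0 <= x)%R ->
  (p * w * x <= x `^ p + (p - 1) * w `^ (p / (p - 1)))%R.
Proof.
move=> p1 w0 x0; have p0 : (0 < p)%R by exact: lt_trans p1.
have p10 : (0 < p - 1)%R by rewrite subr_gt0.
have := powR_tangent p1 x0 (powR_ge0 w (p - 1)^-1).
rewrite -!powRrM mulVf ?gt_eqF// powRr1// (mulrC _^-1%R p).
set y := (w `^ (p - 1)^-1)%R.
have -> : (w `^ (p / (p - 1)) = w * y)%R.
  have -> : (p / (p - 1) = 1 + (p - 1)^-1)%R by field; rewrite gt_eqF.
  rewrite powRD ?powRr1//; rewrite gt_eqF//.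
  by rewrite addr_gt0// invr_gt0.
by lra.
Qed.

(** [f] may take the value infinity, where the right-hand side is infinite as well. *)
Lemma poweR_young p w (y : \bar R) : (1 < p)%R -> (0 <= w)%R -> 0 <= y ->
  (p * w)%:E * y <= y `^ p + ((p - 1) * w `^ (p / (p - 1)))%:E.
Proof.
move=> p1 w0; have p0 : (0 < p)%R by exact: lt_trans p1.
case: y => [y| |]; rewrite ?lee_fin.
- by move=> y0; exact: powR_young.
- by move=> _; rewrite poweRyr ?gt_eqF//= addye ?leey.
- by [].
Qed.

Context p (f : R -> \bar R) (p1 : (1 < p)%R) (Lf : Lplus f).

Let f0 u v x : (0 <= u)%R -> `]u, v]%classic x -> 0 <= f x.
Proof.
move=> u0; rewrite /= in_itv/= => /andP[ux _]; apply: Lf.2; exact: le_lt_trans ux.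
Qed.

Let mI u v : measurable (`]u, v]%classic : set (lebesgueR R)).
Proof. by apply: measurable_lebesgueR; exact: measurable_itv. Qed.

Let subI u v : (0 <= u)%R -> `]u, v]%classic `<=` (`]0%R, +oo[%classic : set R).
Proof.
move=> u0 x /=; rewrite !in_itv/= andbT => /andP[ux _]; exact: le_lt_trans ux.
Qed.

Let mf u v : (0 <= u)%R -> measurable_fun (T := lebesgueR R) `]u, v] f.
Proof.
move=> u0; have [mf _] := Lf; apply: measurable_funS mf.
  by apply: measurable_lebesgueR; exact: measurable_itv.
exact: subI.
Qed.

Lemma Lplus_poweR e : measurable_fun (T := lebesgueR R) `]0%R, +oo[ (fun x => f x `^ e).
Proof. exact: measurableT_comp (measurable_poweR e) Lf.1. Qed.

Let mfp u v : (0 <= u)%R -> measurable_fun (T := lebesgueR R) `]u, v] (fun x => f x `^ p).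
Proof. by move=> u0; exact: measurableT_comp (measurable_poweR p) (mf u0). Qed.

Definition primitive u v := \int[mu]_(x in `]u, v]) f x.
Definition primitive_pow u v := \int[mu]_(x in `]u, v]) (f x `^ p).

Lemma primitive_ge0 u v : (0 <= u)%R -> 0 <= primitive u v.
Proof. by move=> u0; apply: integral_ge0 => x; exact: f0. Qed.

Lemma primitive_pow_ge0 u v : 0 <= primitive_pow u v.
Proof. by apply: integral_ge0 => x _; exact: poweR_ge0. Qed.

Let itv_split u v w : (u <= v)%R -> (v <= w)%R ->
  `]u, w]%classic = `]u, v]%classic `|` `]v, w]%classic :> set R.
Proof.
move=> uv vw; rewrite -itv_bndbnd_setU//; by rewrite bnd_simp.
Qed.

Let itv_disj u v w : [disjoint (`]u, v]%classic : set R) & (`]v, w]%classic : set R)].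
Proof.
apply/disj_setPS => x [] /=; rewrite !in_itv/= => /andP[_ xv] /andP[].
by rewrite ltNge xv.
Qed.

Lemma primitive_add u v w : (0 <= u)%R -> (u <= v)%R -> (v <= w)%R ->
  primitive u w = primitive u v + primitive v w.
Proof.
move=> u0 uv vw; rewrite /primitive (itv_split uv vw).
apply: ge0_integral_setU; [exact: mI|exact: mI| | |exact: itv_disj].
- by rewrite -(itv_split uv vw); exact: mf.
- by move=> x; rewrite -(itv_split uv vw); exact: f0.
Qed.

Lemma primitive_pow_add u v w : (0 <= u)%R -> (u <= v)%R -> (v <= w)%R ->
  primitive_pow u w = primitive_pow u v + primitive_pow v w.
Proof.
move=> u0 uv vw; rewrite /primitive_pow (itv_split uv vw).
apply: ge0_integral_setU; [exact: mI|exact: mI| | |exact: itv_disj].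
- by rewrite -(itv_split uv vw); exact: mfp.
- by move=> x _; exact: poweR_ge0.
Qed.

(** Integrating the pointwise inequality with a constant weight gives the increment inequality
    required in [energy_data]. *)
Lemma primitive_young u v w : (0 <= u)%R -> (u <= v)%R -> (0 <= w)%R ->
  (p * w)%:E * primitive u v <=
  primitive_pow u v + ((p - 1) * w `^ (p / (p - 1)) * (v - u))%:E.
Proof.
move=> u0 uv w0; have p0 : (0 < p)%R by exact: lt_trans p1.
have muI : mu `]u, v]%classic = (v - u)%:E.
  rewrite -[LHS]/(lebesgue_measure `]u, v]%classic) lebesgue_measure_itv/= lte_fin.
  by case: ltgtP uv => //= -> _; rewrite subrr.
have k0 : (0 <= (p - 1) * w `^ (p / (p - 1)))%R.
  by rewrite mulr_ge0 ?powR_ge0// subr_ge0 ltW.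
rewrite /primitive -ge0_integralZl_EFin//; first last.
- by rewrite mulr_ge0// ltW.
- exact: mf.
- by move=> x; exact: f0.
rewrite [X in _ <= _ + X]EFinM -muI.
have := @integral_cst _ (lebesgueR R) R mu `]u, v]%classic (mI u v)
  ((p - 1) * w `^ (p / (p - 1)))%:E.
rewrite /cst => <-; rewrite /primitive_pow.
have k0e (x : lebesgueR R) : `]u, v]%classic x ->
    0 <= cst ((p - 1) * w `^ (p / (p - 1)))%:E x by rewrite lee_fin.
rewrite -(ge0_integralD mu (mI u v) (fun x _ => poweR_ge0 (f x) p) (@mfp u v u0)
  k0e (measurable_cst _)).
apply: (ge0_le_integral mu (mI u v)).
- by move=> x Ix; rewrite mule_ge0 ?lee_fin ?mulr_ge0 ?(ltW p0)//; exact: f0 Ix.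
- by apply: measurable_funeM; exact: mf.
- by apply: emeasurable_funD; [exact: mfp|exact: measurable_cst].
- by move=> x Ix; apply: poweR_young => //; exact: f0 Ix.
Qed.

Hypothesis fin : \int[mu]_(x in `]0%R, +oo[) (f x `^ p) < +oo.

Lemma primitive_pow_le u v : (0 <= u)%R ->
  primitive_pow u v <= \int[mu]_(x in `]0%R, +oo[) (f x `^ p).
Proof.
move=> u0; apply: ge0_subset_integral.
- exact: mI.
- by apply: measurable_lebesgueR; exact: measurable_itv.
- exact: Lplus_poweR.
- by move=> x _; exact: poweR_ge0.
- exact: subI.
Qed.

Lemma primitive_pow_fin u v : (0 <= u)%R -> primitive_pow u v \is a fin_num.
Proof.
move=> u0; rewrite ge0_fin_numE ?primitive_pow_ge0//.
exact: le_lt_trans (primitive_pow_le _ u0) fin.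
Qed.

(** Young's inequality with weight 1 bounds the primitive by finite quantities, down to the left
    endpoint 0. *)
Lemma primitive_fin u v : (0 <= u)%R -> primitive u v \is a fin_num.
Proof.
move=> u0; have [uv|vu] := leP u v; last first.
  by rewrite /primitive set_itv_ge ?integral_set0// -leNgt bnd_simp ltW.
have p0 : (0 < p)%R by exact: lt_trans p1.
rewrite ge0_fin_numE ?primitive_ge0//.
have := primitive_young u0 uv (ltW ltr01).
rewrite mulr1; have := primitive_ge0 v u0; case: (primitive u v) => [x| |]//= _.
  by rewrite ltry.
rewrite gt0_muley ?lte_fin// leye_eq.
by rewrite -(fineK (primitive_pow_fin v u0)).
Qed.

End young_integral.

(** * Hardy's and Bliss's inequalities *)

Section hardy_power.
Context {R : realType}.
Implicit Types (a b c e p q u v w x y : R).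

Local Notation lam := (@lebesgue_measure R).
Local Notation mu :=
  (@completed_lebesgue_measure R : {measure set (lebesgueR R) -> \bar R}).

Lemma powRN_swap_ge e x y : (0 < e)%R -> (0 < x)%R -> (0 < y)%R ->
  (x `^ (- e) <= y)%R = (y `^ (- e^-1) <= x)%R.
Proof.
have half e' a b : (0 < e')%R -> (0 < a)%R -> (0 < b)%R ->
    (a `^ (- e') <= b)%R -> (b `^ (- e'^-1) <= a)%R.
  move=> e0 a0 b0 h; have eV0 : (0 < e'^-1)%R by rewrite invr_gt0.
  have := powRN_le eV0 (powR_gt0 (- e')%R a0) h.
  by rewrite -powRrM mulrNN mulfV ?gt_eqF// powRr1// ltW.
move=> e0 x0 y0; apply/idP/idP; first exact: half.
by move=> h; have := half e^-1%R y x; rewrite invrK invr_gt0; apply.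
Qed.

(** For [e = q (p - 1) / p = q / p'] this is [c x ^ (- p' / q)]. *)
Definition power_form c e x := (c * x `^ (- e^-1))%R.

Lemma power_form_gt0 c e x : (0 < c)%R -> (0 < x)%R -> (0 < power_form c e x)%R.
Proof. by move=> c0 x0; rewrite mulr_gt0// powR_gt0. Qed.

Lemma power_form_le c e x y : (0 < c)%R -> (0 < e)%R -> (0 < x)%R -> (0 < y)%R ->
  (power_form c e x <= y)%R = ((y / c) `^ (- e) <= x)%R.
Proof.
move=> c0 e0 x0 y0; rewrite /power_form mulrC -ler_pdivlMr//.
rewrite powRN_swap_ge ?invr_gt0 ?divr_gt0// invrK//.
Qed.

Lemma measurable_power_form c e : measurable_fun setT (power_form c e).
Proof. rewrite /power_form; measurable_real. Qed.

(** The integral is the length of the set where the power form lies in []u, v]]; it provides the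
    factor of [F v ^ q] in [energy_data]. *)
Lemma pint_power_form_band c e u v : (0 < c)%R -> (0 < e)%R -> (0 < u)%R -> (u <= v)%R ->
  pint (fun x => (if (u < power_form c e x) && (power_form c e x <= v) then 1 else 0)%R%:E) =
  (c `^ e * (u `^ (- e) - v `^ (- e)))%:E.
Proof.
move=> c0 e0 u0 uv; have v0 := lt_le_trans u0 uv.
have E y : (0 < y)%R -> ((y / c) `^ (- e) = c `^ e * y `^ (- e))%R.
  move=> y0; rewrite powRM ?invr_ge0 ?(ltW c0) ?(ltW y0)// mulrC; congr (_ * _)%R.
  by rewrite -powR_inv1 ?(ltW c0)// -powRrM mulrNN mul1r.
have h0 y : (0 < y)%R -> (0 < (y / c) `^ (- e))%R by move=> y0; rewrite powR_gt0// divr_gt0.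
have hc y : (0 < y)%R -> (0 < (y / c) `^ (- e))%R by move=> y0; rewrite powR_gt0// divr_gt0.
pose A : set R := `[((v / c) `^ (- e))%R, ((u / c) `^ (- e))%R[%classic.
have mA : measurable A by exact: measurable_itv.
transitivity (lam A); last first.
  rewrite /A lebesgue_measure_itv/= lte_fin !E// lt_neqAle.
  rewrite ler_pM2l ?powR_gt0// powRN_le// andbT.
  case: eqVneq => /= [h|_]; last by rewrite -EFinB mulrBr.
  by rewrite mulrBr h subrr.
have := @integral_cst _ (measurableTypeR R) R lam A mA 1; rewrite mul1e => <-.
rewrite integral_pint//; last first.
  move=> x; rewrite /A /= !in_itv/= andbT => /andP[h _].
  exact: lt_le_trans (hc _ v0) h.
apply: eq_pint => x x0; rewrite patchE.
have -> : (x \in A) = (u < power_form c e x)%R && (power_form c e x <= v)%R.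
  by rewrite ltNge !power_form_le// andbC -ltNge /A mem_setE in_itv.
by case: ifP.
Qed.

Context p q (p1 : (1 < p)%R) (pq : (p <= q)%R).
Let kap := (q * (p - 1) / p)%R.
Let p0 : (0 < p)%R. Proof. exact: lt_trans p1. Qed.
Let q0 : (0 < q)%R. Proof. exact: lt_le_trans pq. Qed.
Let kap0 : (0 < kap)%R.
Proof. by rewrite divr_gt0 ?mulr_gt0// subr_gt0. Qed.

Context (f : R -> \bar R) (Lf : Lplus f).
Let ip := \int[mu]_(x in `]0%R, +oo[) (f x `^ p).
Hypothesis fin : ip < +oo.

Context c (c0 : (0 < c)%R).

Section truncation.
Context a b (a0 : (0 < a)%R) (ab : (a <= b)%R).

Let F y := fine (primitive f a y).
Let P y := fine (primitive_pow p f a y).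

Let FE y : primitive f a y = (F y)%:E.
Proof. by rewrite fineK//; apply: (primitive_fin p1 Lf fin); exact: ltW. Qed.
Let PE y : primitive_pow p f a y = (P y)%:E.
Proof. by rewrite fineK//; apply: (primitive_pow_fin Lf fin); exact: ltW. Qed.

Let F0 y : (y <= a)%R -> F y = 0%R.
Proof.
by move=> ya; rewrite /F /primitive set_itv_ge ?integral_set0// -leNgt bnd_simp.
Qed.

Let F_ge0 y : (0 <= F y)%R.
Proof. by rewrite -lee_fin -FE primitive_ge0// ltW. Qed.

Let FB u v : (a <= u)%R -> (u <= v)%R -> primitive f u v = (F v - F u)%:E.
Proof.
move=> au uv; have := primitive_add Lf (ltW a0) au uv.
rewrite !FE; have := primitive_ge0 Lf v (le_trans (ltW a0) au).
by case: (primitive f u v) => [x| |]//= _; rewrite -EFinD => -[->]; congr EFin; ring.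
Qed.

Let PB u v : (a <= u)%R -> (u <= v)%R -> primitive_pow p f u v = (P v - P u)%:E.
Proof.
move=> au uv; have := primitive_pow_add p Lf (ltW a0) au uv.
rewrite !PE; have := primitive_pow_ge0 p f u v.
by case: (primitive_pow p f u v) => [x| |]//= _; rewrite -EFinD => -[->]; congr EFin; ring.
Qed.

Let F_mono u v : (u <= v)%R -> (F u <= F v)%R.
Proof.
move=> uv; have [ua|au] := leP u a; first by rewrite (F0 ua).
rewrite -subr_ge0 -lee_fin -FB ?(ltW au)// primitive_ge0//.
by rewrite (le_trans (ltW a0))// ltW.
Qed.

Let measurable_FqB : measurable_fun setT (fun x => F (power_form c kap x) `^ q)%R.
Proof.
apply: measurable_fun_powRl.
apply: (measurableT_comp (f := F)); last exact: measurable_power_form.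
exact: nondecreasing_measurable.
Qed.

Let band u v x : R :=
  (if (u < power_form c kap x) && (power_form c kap x <= v) then 1 else 0)%R.

Let measurable_band u v : measurable_fun setT (band u v).
Proof.
apply: measurable_fun_ifT => //; apply: measurable_and.
  by apply: measurable_fun_ltr => //; exact: measurable_power_form.
by apply: measurable_fun_ler => //; exact: measurable_power_form.
Qed.

Let band_ge0 u v x : (0 <= band u v x)%R. Proof. by rewrite /band; case: ifP. Qed.

(** With [y = power_form c kap x] this is [c ^ kap] times the integral of
    [kap F ^ q y ^ (- kap - 1)] over []u, v]]; additivity and [QE_le] make the substitution itself
    unnecessary. *)
Let QE u v := pint (fun x => (band u v x * F (power_form c kap x) `^ q)%:E).

Let QE_add v w : (a <= v)%R -> (v <= w)%R -> QE a w = QE a v + QE v w.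
Proof.
move=> av vw; rewrite /QE -pintD.
- apply: eq_pint => x x0; rewrite -EFinD -mulrDl; congr (_ * _)%:E.
  rewrite /band; have [xv|vx] := leP (power_form c kap x) v.
    by rewrite (le_trans xv vw) andbT /= addr0.
  by rewrite andbF (le_lt_trans av vx) add0r.
- by move=> x _; rewrite lee_fin mulr_ge0 ?powR_ge0.
- by apply/measurable_EFinP/measurable_funM.
- by move=> x _; rewrite lee_fin mulr_ge0 ?powR_ge0.
- by apply/measurable_EFinP/measurable_funM.
Qed.

Let QE_le u v : (a <= u)%R -> (u <= v)%R ->
  QE u v <= (F v `^ q * (c `^ kap * (u `^ (- kap) - v `^ (- kap))))%:E.
Proof.
move=> au uv; have u0 := lt_le_trans a0 au.
rewrite EFinM -pint_power_form_band// -pintZlr ?powR_ge0//; last exact: measurable_band.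
apply: le_pint.
- by move=> x _; rewrite lee_fin mulr_ge0 ?powR_ge0.
- by apply/measurable_EFinP/measurable_funM.
- apply/measurable_EFinP; apply: measurable_funM; [exact: measurable_cst|exact: measurable_band].
- move=> x x0; rewrite lee_fin /band; case: ifPn => [/andP[_ xv]|_]; last by rewrite mul0r mulr0.
  rewrite mul1r mulr1; apply: (ge0_ler_powR (ltW q0)); [exact: F_ge0|exact: F_ge0|exact: F_mono].
by move=> x _; case: ifP.
Qed.

Let QE_fin u v : (a <= u)%R -> (u <= v)%R -> QE u v \is a fin_num.
Proof.
move=> au uv; rewrite ge0_fin_numE.
  by rewrite (le_lt_trans (QE_le au uv)) ?ltry.
by apply: pint_ge0 => x _; rewrite lee_fin mulr_ge0 ?powR_ge0.
Qed.

Let Q y := (c `^ (- kap) * fine (QE a y))%R.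

Let data : energy_data p q a b F P Q.
Proof.
have ck : (c `^ (- kap) * c `^ kap = 1)%R.
  by rewrite powRN mulVf// gt_eqF ?powR_gt0.
split=> //.
- by move=> u v _ uv _; exact: F_mono.
- move=> u v w au uv vb w0.
  have := primitive_young p1 Lf (le_trans (ltW a0) au) uv w0.
  by rewrite FB// PB// -EFinM -EFinD lee_fin; lra.
- move=> u v au uv vb.
  have := QE_le au uv; rewrite -(fineK (QE_fin au uv)) lee_fin => h.
  have -> : (Q v - Q u = c `^ (- kap) * fine (QE u v))%R.
    rewrite /Q (QE_add au uv) fineD ?QE_fin//; by ring.
  have := ler_wpM2l (powR_ge0 c (- kap)) h.
  move/le_trans; apply; rewrite -/kap.
  rewrite (mulrCA (c `^ (- kap))%R) (mulrA (c `^ (- kap))%R) ck mul1r.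
  exact: lexx.
Qed.

Lemma hardy_power_truncated :
  pint (fun x => (band a b x * F (power_form c kap x) `^ q)%:E) <=
  (c `^ kap * (K_ p q `^ q * fine ip `^ (q / p)))%:E.
Proof.
have Fa : F a = 0%R by exact: F0.
have := energy_K p1 pq ab data Fa.
have -> : Q a = 0%R.
  rewrite /Q (_ : QE a a = 0) ?mulr0//.
  by apply: integral0_eq => x _; rewrite /band ltNge andNb mul0r.
have -> : P a = 0%R.
  by rewrite /P /primitive_pow set_itv_ge ?integral_set0// -leNgt bnd_simp.
rewrite !subr0 => h.
rewrite -[leLHS]/(QE a b) -(fineK (QE_fin (lexx a) ab)) lee_fin.
have ck : (c `^ kap * c `^ (- kap) = 1)%R.
  by rewrite powRN mulfV// gt_eqF ?powR_gt0.
have h2 := ler_wpM2l (powR_ge0 c kap) h; rewrite mulrA ck mul1r in h2.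
apply: (le_trans h2); apply: ler_wpM2l; first exact: powR_ge0.
apply: ler_wpM2l; first exact: powR_ge0.
have Pb : (P b <= fine ip)%R.
  rewrite -lee_fin -PE fineK; first exact: (primitive_pow_le p Lf b (ltW a0)).
  by rewrite ge0_fin_numE; [exact: fin|apply: integral_ge0 => x _; exact: poweR_ge0].
have P0 : (0 <= P b)%R by rewrite -lee_fin -PE; exact: primitive_pow_ge0.
apply: ge0_ler_powR; [by rewrite divr_ge0 ?(ltW p0) ?(ltW q0)|exact: P0| |exact: Pb].
exact: le_trans P0 Pb.
Qed.

Lemma measurable_hardy_truncated :
  measurable_fun setT (fun x => (band a b x * F (power_form c kap x) `^ q)%:E).
Proof. by apply/measurable_EFinP/measurable_funM. Qed.

End truncation.

Let eps n : R := (n.+1%:R)^-1%R.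
Let eps_gt0 n : (0 < eps n)%R. Proof. by rewrite invr_gt0. Qed.
Let eps_le n : (eps n <= n.+1%:R)%R.
Proof.
by rewrite (@le_trans _ _ 1%R)//; [rewrite invf_le1 ?ler1n|rewrite ler1n].
Qed.

(** The truncated integrand increases with [n]: the range of the power form grows, and the primitive
    starts closer to 0. *)
Let G n x := ((if (eps n < power_form c kap x) && (power_form c kap x <= n.+1%:R) then 1 else 0)
  * fine (primitive f (eps n) (power_form c kap x)) `^ q)%R.

Let primitive_cvg y : (0 < y)%R ->
  fine (primitive f (eps n) y) @[n --> \oo] --> fine (primitive f 0 y).
Proof.
move=> y0; apply: fine_cvg; rewrite fineK ?(primitive_fin p1 Lf fin)//.
pose D n : set (lebesgueR R) := `](eps n), y]%classic.
have nd : nondecreasing_seq D.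
  move=> m n mn; rewrite subsetEset => x /=; rewrite /D /= !in_itv/= => /andP[+ ->].
  rewrite andbT; apply: le_lt_trans; rewrite lef_pV2 ?posrE//.
  by rewrite ler_nat ltnS.
have -> : primitive f 0 y = \int[mu]_(x in \bigcup_n D n) f x.
  congr (\int[mu]_(x in _) f x); apply/seteqP; split=> [x|x [n _]];
    rewrite /D /= !in_itv/= => /andP[x0 xb].
    exists (Num.truncn (x^-1)) => //=; rewrite in_itv/= xb andbT.
    rewrite -[ltRHS]invrK ltf_pV2 ?posrE ?invr_gt0//; apply: real_truncnS_gt.
    exact: num_real.
  by rewrite xb (lt_trans (eps_gt0 n)).
have [mf f0] := Lf.
apply: (@ge0_nondecreasing_set_cvg_integral _ (lebesgueR R) R D f mu nd).
- by move=> n; apply: measurable_lebesgueR; exact: measurable_itv.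
- move=> n; apply: measurable_funS mf.
    by apply: measurable_lebesgueR; exact: measurable_itv.
  move=> x; rewrite /D /= !in_itv/= andbT => /andP[nx _].
  exact: lt_trans nx.
- move=> n x; rewrite /D /= in_itv/= => /andP[nx _]; apply: f0.
  exact: lt_trans nx.
Qed.

Let G_cvg x : (0 < x)%R ->
  (G n x)%:E @[n --> \oo] --> primitive f 0 (power_form c kap x) `^ q.
Proof.
move=> x0; have y0 := @power_form_gt0 c kap x c0 x0.
set y := power_form c kap x in y0 *.
rewrite -(fineK (primitive_fin p1 Lf fin y (lexx 0%R))) poweR_EFin.
apply/fine_cvgP; split; first exact: nearW.
have : (fine (primitive f (eps n) y) `^ q)%R @[n --> \oo] --> (fine (primitive f 0 y) `^ q)%R.
  apply/cvgrPdist_lt => d d0.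
  have F0 u : (0 <= u)%R -> (0 <= fine (primitive f u y))%R.
    by move=> u0; rewrite fine_ge0// primitive_ge0.
  have [d' d'0 H] := powR_near q0 (F0 0%R (lexx _)) d0.
  have /cvgrPdist_lt/(_ _ d'0) := primitive_cvg y0.
  apply: filterS => n hn; rewrite distrC; apply: H; first by rewrite F0// ltW.
  by rewrite distrC.
apply: cvg_trans; apply: near_eq_cvg; near=> n.
rewrite /= /G -/y.
have -> : (eps n < y)%R.
  rewrite -[ltRHS]invrK ltf_pV2 ?posrE ?invr_gt0//.
  apply: (@le_lt_trans _ _ n%:R); last by rewrite ltr_nat.
  near: n; exact: nbhs_infty_ger.
have -> : (y <= n.+1%:R)%R.
  rewrite (@le_trans _ _ n%:R)// ?ler_nat//.
  near: n; exact: nbhs_infty_ger.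
by rewrite mul1r.
Unshelve. all: by end_near. Qed.

Let G_ge0 n x : (0 <= G n x)%R.
Proof. by rewrite mulr_ge0 ?powR_ge0//; case: ifP. Qed.

Let G_mono x : (0 < x)%R -> {homo (fun n => (G n x)%:E) : m n / (m <= n)%N >-> m <= n}.
Proof.
move=> x0 m n mn; rewrite lee_fin /G.
have := @power_form_gt0 c kap x c0 x0; set y := power_form c kap x => y0.
have emn : (eps n <= eps m)%R by rewrite lef_pV2 ?posrE// ler_nat ltnS.
case: ifPn => [/andP[my ym]|_]; last by rewrite mul0r mulr_ge0 ?powR_ge0//; case: ifP.
have -> : (eps n < y)%R && (y <= n.+1%:R)%R.
  by rewrite (le_lt_trans emn my)/=; apply: (le_trans ym); rewrite ler_nat ltnS.
rewrite [leLHS]mul1r [leRHS]mul1r.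
have F0 k : (0 <= fine (primitive f (eps k) y))%R.
  by rewrite fine_ge0// primitive_ge0// ltW.
apply: (ge0_ler_powR (ltW q0)); [exact: F0|exact: F0|].
apply: fine_le; [exact: (primitive_fin p1 Lf fin y (ltW (eps_gt0 m)))
  |exact: (primitive_fin p1 Lf fin y (ltW (eps_gt0 n)))|].
rewrite (primitive_add Lf (ltW (eps_gt0 n)) emn (ltW my)).
by rewrite leeDr//; exact: (primitive_ge0 Lf (eps m) (ltW (eps_gt0 n))).
Qed.

(** The bounds for the truncated integrals are uniform in [n], so monotone convergence passes them
    to the limit. *)
Lemma hardy_power_upper :
  pint (fun x => primitive f 0 (power_form c kap x) `^ q) <=
  (c `^ kap * (K_ p q `^ q * fine ip `^ (q / p)))%:E.
Proof.
have mG n : measurable_fun setT (fun x => (G n x)%:E).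
  exact: (measurable_hardy_truncated n.+1%:R (eps_gt0 n)).
have mI : measurable (`]0%R, +oo[%classic : set (measurableTypeR R)).
  exact: measurable_itv.
have x_gt0 x : `]0%R, +oo[%classic x -> (0 < x)%R by rewrite /= in_itv/= andbT.
have H := @cvg_monotone_convergence _ (measurableTypeR R) R lam _ mI
  (fun n x => (G n x)%:E) (fun n => measurable_funTS (mG n))
  (fun n x _ => G_ge0 n x) (fun x Dx => G_mono (x_gt0 x Dx)).
rewrite (@eq_pint _ _ (fun x => limn (fun n => (G n x)%:E))).
  apply: (cvge_le _ H); apply: nearW => n.
  exact: (hardy_power_truncated (eps_gt0 n) (eps_le n)).
by move=> x x0; apply/esym/cvg_lim => //; exact: G_cvg.
Qed.

End hardy_power.

(** * Bounds for the operator norm *)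

Section hardy_operator.
Context {R : realType}.
Implicit Types (c e p q x y C : R) (f g b : R -> \bar R).

Local Notation mu :=
  (@completed_lebesgue_measure R : {measure set (lebesgueR R) -> \bar R}).
Local Notation I := (`]0%R, +oo[%classic : set R).

Lemma itv0yE x : I x <-> (0 < x)%R.
Proof. by rewrite /= in_itv/= andbT. Qed.

(* No measurability is needed: the integral of a nonnegative function is a
   supremum over the simple functions below it. *)
Lemma le_integral_ge0 (D : set (lebesgueR R)) f g : (forall x, D x -> 0 <= f x) ->
  (forall x, D x -> f x <= g x) -> \int[mu]_(x in D) f x <= \int[mu]_(x in D) g x.
Proof.
move=> f0 fg.
have g0 x : D x -> 0 <= g x by move=> Dx; exact: le_trans (f0 x Dx) (fg x Dx).
rewrite !ge0_integralE//; apply: le_ereal_sup => _ [h hf <-]; exists h => // x.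
apply: le_trans (hf x) _; rewrite !patchE; case: ifPn => // /set_mem Dx.
exact: fg.
Qed.

Lemma measurable_lebesgueR_I : measurable (I : set (lebesgueR R)).
Proof. by apply: measurable_lebesgueR; exact: measurable_itv. Qed.

Lemma normLE e f : (0 < e)%R -> (forall x, (0 < x)%R -> 0 <= f x) ->
  normL e f = (\int[mu]_(x in I) (f x `^ e)) `^ e^-1.
Proof.
move=> e0 f0; rewrite /normL unlock; congr (_ `^ _).
rewrite [RHS]integral_mkcond; apply: eq_integral => x _.
rewrite !patchE; case: ifPn => [/set_mem/itv0yE x0|_].
  by rewrite gee0_abs// f0.
by rewrite abse0 poweR0r// gt_eqF.
Qed.

Lemma normL_fin e f : (0 < e)%R -> (forall x, (0 < x)%R -> 0 <= f x) ->
  normL e f < +oo -> \int[mu]_(x in I) (f x `^ e) < +oo.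
Proof.
by move=> e0 f0; rewrite normLE//; apply: lty_poweRy; rewrite gt_eqF ?invr_gt0.
Qed.

Lemma Lplus_Borel f : measurable_fun setT f -> (forall x, (0 < x)%R -> 0 <= f x) ->
  Lplus f.
Proof.
move=> mf f0; split=> //; apply: measurable_fun_lebesgueR; first exact: measurable_itv.
exact: measurable_funTS.
Qed.

Lemma integral_pintR f : measurable_fun setT f -> (forall x, (0 < x)%R -> 0 <= f x) ->
  \int[mu]_(x in I) f x = pint f.
Proof.
move=> mf f0; apply: integral_lebesgueR; first exact: measurable_itv.
  exact: measurable_funTS.
by move=> x /itv0yE; exact: f0.
Qed.

Definition hardy_dom (y : \bar R) : set R := [set t : R | (0 < t)%R /\ t%:E < y].

Lemma hardy_dom_I (y : \bar R) : hardy_dom y `<=` I.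
Proof. by move=> t [t0 _]; exact/itv0yE. Qed.

Lemma hardy_dom_fin y : hardy_dom y%:E = `]0%R, y[%classic.
Proof. by apply/seteqP; split=> t; rewrite /hardy_dom /= in_itv/= lte_fin => /andP. Qed.

Lemma hardy_domS (y z : \bar R) : y <= z -> hardy_dom y `<=` hardy_dom z.
Proof. by move=> yz t [t0 ty]; split=> //; exact: lt_le_trans yz. Qed.

Lemma measurable_hardy_dom (y : \bar R) : measurable (hardy_dom y : set (lebesgueR R)).
Proof.
apply: measurable_lebesgueR; case: y => [y| |].
- by rewrite hardy_dom_fin; exact: measurable_itv.
- rewrite (_ : hardy_dom +oo = I); first exact: measurable_itv.
  apply/seteqP; split=> [|t /itv0yE t0]; first exact: hardy_dom_I.
  by split=> //; rewrite ltry.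
- rewrite (_ : hardy_dom -oo = set0); first exact: measurable0.
  by apply/seteqP; split=> t // [].
Qed.

Lemma hardy_op_ge0 b f x : Lplus f -> 0 <= hardy_op b f x.
Proof. by move=> [_ f0]; apply: integral_ge0 => t [t0 _]; exact: f0. Qed.

Lemma le_hardy_dom f (D E : set (lebesgueR R)) : Lplus f ->
  measurable D -> measurable E -> D `<=` E -> E `<=` I ->
  \int[mu]_(t in D) f t <= \int[mu]_(t in E) f t.
Proof.
move=> [mf f0] mD mE DE EI; apply: ge0_subset_integral => //.
- apply: measurable_funS mf => //; exact: measurable_lebesgueR_I.
- by move=> t /EI/itv0yE; exact: f0.
Qed.

Lemma hardy_norm_le_of p q b (C : \bar R) : 0 <= C ->
  (forall f, Lplus f -> normL p f < +oo -> normL q (hardy_op b f) <= C * normL p f) ->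
  hardy_norm p q b <= C.
Proof. by move=> C0 H; apply: ereal_inf_lbound; split. Qed.

Lemma hardy_norm_ge0 p q b : 0 <= hardy_norm p q b.
Proof. by apply: le_ereal_inf_tmp => C []. Qed.

Lemma hardy_norm_power_form p q b c : (1 < p)%R -> (p <= q)%R -> (0 < c)%R ->
  (forall x, (0 < x)%R -> b x <= (power_form c (q * (p - 1) / p) x)%:E) ->
  hardy_norm p q b <= (c `^ ((p - 1) / p) * K_ p q)%:E.
Proof.
move=> p1 pq c0 bc; have p0 : (0 < p)%R by exact: lt_trans p1.
have q0 : (0 < q)%R by exact: lt_le_trans pq.
have K0 := K_gt0 p1 pq.
apply: hardy_norm_le_of; first by rewrite lee_fin mulr_ge0 ?powR_ge0 ?(ltW K0).
move=> f Lf nf; have [mf f0] := Lf; have fin := normL_fin p0 f0 nf.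
rewrite normLE//; last by move=> x _; exact: hardy_op_ge0.
rewrite (normLE p0 f0); set ip := \int[mu]_(x in I) (f x `^ p) in fin *.
have ip0 : 0 <= ip by apply: integral_ge0 => x _; exact: poweR_ge0.
have ipE : ip = (fine ip)%:E by rewrite fineK// ge0_fin_numE.
set kap := (q * (p - 1) / p)%R in bc *.
have Fm : nondecreasing_fun (fun y => fine (primitive f 0 y)).
  move=> u v uv; apply: fine_le; [exact: (primitive_fin p1 Lf fin u (lexx _))
    |exact: (primitive_fin p1 Lf fin v (lexx _))|].
  apply: (le_hardy_dom Lf); [| | |].
  - by apply: measurable_lebesgueR; exact: measurable_itv.
  - by apply: measurable_lebesgueR; exact: measurable_itv.
  - by move=> t /=; rewrite !in_itv/= => /andP[-> tu]; exact: le_trans uv.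
  - by move=> t /=; rewrite !in_itv/= => /andP[->].
have mF : measurable_fun setT (fun x => primitive f 0 (power_form c kap x) `^ q).
  rewrite (_ : (fun _ => _) = EFin \o
    (fun x => fine (primitive f 0 (power_form c kap x)) `^ q)%R).
    apply/measurable_EFinP/measurable_fun_powRl.
    apply: (measurableT_comp (f := fun y => fine (primitive f 0 y))).
      exact: nondecreasing_measurable.
    exact: measurable_power_form.
  apply/funext => x /=.
  by rewrite -poweR_EFin (fineK (primitive_fin p1 Lf fin _ (lexx _))).
have := hardy_power_upper p1 pq Lf fin c0; rewrite -/kap -/ip.
rewrite -integral_pintR//; last by move=> x _; exact: poweR_ge0.
move=> h.
have {}h : \int[mu]_(x in I) (hardy_op b f x `^ q) <=
    (c `^ kap * (K_ p q `^ q * fine ip `^ (q / p)))%:E.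
  apply: le_trans h; apply: le_integral_ge0 => [x _|x /itv0yE x0]; first exact: poweR_ge0.
  apply: gt0_ler_poweR; first exact: ltW.
  - by rewrite in_itv/= leey andbT hardy_op_ge0.
  - by rewrite in_itv/= leey andbT (primitive_ge0 Lf _ (lexx _)).
  apply: (le_hardy_dom Lf); [exact: measurable_hardy_dom| | |].
  - by apply: measurable_lebesgueR; exact: measurable_itv.
  - move=> t [t0 tb]; rewrite /= in_itv/= t0/= -lee_fin.
    exact: le_trans (ltW tb) (bc x x0).
  - by move=> t /=; rewrite !in_itv/= => /andP[->].
have qV : (0 <= q^-1)%R by rewrite invr_ge0 ltW.
apply: (@le_trans _ _ ((c `^ kap * (K_ p q `^ q * fine ip `^ (q / p)))%:E `^ q^-1)).
  apply: gt0_ler_poweR => //.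
  - rewrite in_itv/= leey andbT integral_ge0// => x _; exact: poweR_ge0.
  - by rewrite in_itv/= leey andbT lee_fin !mulr_ge0 ?powR_ge0.
rewrite ipE !poweR_EFin -EFinM lee_fin !powRM ?mulr_ge0 ?powR_ge0// -!powRrM.
have -> : (q * q^-1 = 1)%R by rewrite mulfV// gt_eqF.
have -> : (q / p * q^-1 = p^-1)%R by field; rewrite !gt_eqF.
have -> : (kap * q^-1 = (p - 1) / p)%R by rewrite /kap; field; rewrite !gt_eqF.
by rewrite powRr1 ?(ltW K0)// mulrA.
Qed.

End hardy_operator.

(** * Comparison of parameters, the upper bound and the lower bound by [A0] *)

Section hardy_bounds.
Context {R : realType}.
Implicit Types (c e p q x y A C : R) (f g b : R -> \bar R).

Local Notation lam := (@lebesgue_measure R).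
Local Notation mu :=
  (@completed_lebesgue_measure R : {measure set (lebesgueR R) -> \bar R}).
Local Notation I := (`]0%R, +oo[%classic : set R).

(** The power form with constant [A ^ p'] is the parameter whose [c0] is identically [A], so bounds
    on [c0] amount to comparing [b] with it. *)
Lemma power_form_c0 p q A x : (1 < p)%R -> (0 < q)%R -> (0 < A)%R -> (0 < x)%R ->
  (power_form (A `^ (p / (p - 1))) (q * (p - 1) / p) x `^ ((p - 1) / p) * x `^ q^-1 = A)%R.
Proof.
move=> p1 q0 A0 x0; have p0 : (0 < p)%R by exact: lt_trans p1.
have p10 : (0 < p - 1)%R by rewrite subr_gt0.
rewrite /power_form powRM ?powR_ge0// -!powRrM -mulrA -powRD; last first.
  by apply/implyP => _; rewrite gt_eqF.
have -> : (p / (p - 1) * ((p - 1) / p) = 1)%R by field; rewrite !gt_eqF.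
have -> : (- (q * (p - 1) / p)^-1 * ((p - 1) / p) + q^-1 = 0)%R.
  by field; rewrite !gt_eqF.
by rewrite powRr1 ?(ltW A0)// powRr0 mulr1.
Qed.

Lemma conj_exponentV p : (1 < p)%R -> (conj_exponent p)^-1%R = ((p - 1) / p)%R.
Proof. by move=> p1; rewrite conj_exponentE// invf_div. Qed.

Lemma c0_le p q b A x : (1 < p)%R -> (0 < q)%R -> (0 < A)%R -> (0 < x)%R -> 0 <= b x ->
  (c0 p q b x <= A%:E) = (b x <= (power_form (A `^ (p / (p - 1))) (q * (p - 1) / p) x)%:E).
Proof.
move=> p1 q0 A0 x0; have p0 : (0 < p)%R by exact: lt_trans p1.
have k0 : (0 < (p - 1) / p)%R by rewrite divr_gt0// subr_gt0.
have pf0 := @power_form_gt0 _ (A `^ (p / (p - 1)))%R (q * (p - 1) / p)%R x (powR_gt0 _ A0) x0.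
rewrite /c0 conj_exponentV//; case: (b x) => [r| |]//.
  rewrite !lee_fin -[X in (_ <= X)%R = _](power_form_c0 p1 q0 A0 x0) => r0.
  rewrite ler_pM2r ?powR_gt0//; apply/idP/idP => [h|h].
    rewrite leNgt; apply/negP => /(gt0_ltr_powR k0 (ltW pf0) r0).
    by rewrite ltNge h.
  by rewrite ge0_ler_powR ?nnegrE ?(ltW k0) ?(ltW pf0).
move=> _; rewrite poweRyr ?gt_eqF// gt0_mulye ?lte_fin ?powR_gt0//.
Qed.

Lemma c0_ge p q b A x : (1 < p)%R -> (0 < q)%R -> (0 < A)%R -> (0 < x)%R -> 0 <= b x ->
  (A%:E <= c0 p q b x) = ((power_form (A `^ (p / (p - 1))) (q * (p - 1) / p) x)%:E <= b x).
Proof.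
move=> p1 q0 A0 x0; have p0 : (0 < p)%R by exact: lt_trans p1.
have k0 : (0 < (p - 1) / p)%R by rewrite divr_gt0// subr_gt0.
have pf0 := @power_form_gt0 _ (A `^ (p / (p - 1)))%R (q * (p - 1) / p)%R x (powR_gt0 _ A0) x0.
rewrite /c0 conj_exponentV//; case: (b x) => [r| |]//.
  rewrite !lee_fin -[X in (X <= _)%R = _](power_form_c0 p1 q0 A0 x0) => r0.
  rewrite ler_pM2r ?powR_gt0//; apply/idP/idP => [h|h].
    rewrite leNgt; apply/negP => /(gt0_ltr_powR k0 r0 (ltW pf0)).
    by rewrite ltNge h.
  by rewrite ge0_ler_powR ?nnegrE ?(ltW k0) ?(ltW pf0).
move=> _; rewrite poweRyr ?gt_eqF// gt0_mulye ?lte_fin ?powR_gt0//.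
by rewrite !leey.
Qed.

Lemma c0_ge0 p q b x : 0 <= c0 p q b x.
Proof. by rewrite mule_ge0 ?poweR_ge0// lee_fin powR_ge0. Qed.

Lemma hardy_norm_le_A0 p q b : (1 < p)%R -> (p <= q)%R -> normal_form_parameter b ->
  hardy_norm p q b <= (K_ p q)%:E * A0 p q b.
Proof.
move=> p1 pq [_ b0]; have p0 : (0 < p)%R by exact: lt_trans p1.
have q0 : (0 < q)%R by exact: lt_le_trans pq.
have p10 : (0 < p - 1)%R by rewrite subr_gt0.
have K0 := K_gt0 p1 pq.
have ub x : (0 < x)%R -> c0 p q b x <= A0 p q b.
  by move=> x0; apply: ereal_sup_ubound; exists x => //; exact/itv0yE.
have A00 : 0 <= A0 p q b by apply: le_trans (ub 1%R ltr01); exact: c0_ge0.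
case: (A0 p q b) A00 ub => [A| |]//; last first.
  by move=> _ _; rewrite gt0_muley ?lte_fin// leey.
rewrite lee_fin => A00 ub; apply/lee_addgt0Pr => e e0.
(* [A] may be 0 while a power form needs a positive constant; this increment adds exactly [e] to the
   bound. *)
pose A' := (A + e / K_ p q)%R.
have A'0 : (0 < A')%R by rewrite ltr_wpDl// divr_gt0.
have := @hardy_norm_power_form _ p q b (A' `^ (p / (p - 1))) p1 pq (powR_gt0 _ A'0).
rewrite -powRrM; have -> : (p / (p - 1) * ((p - 1) / p) = 1)%R by field; rewrite !gt_eqF.
rewrite powRr1 ?(ltW A'0)//; have -> : (A' * K_ p q = K_ p q * A + e)%R.
  by rewrite /A'; field; rewrite gt_eqF.
rewrite EFinD EFinM; apply => x x0.
rewrite -c0_le ?b0//; apply: le_trans (ub x x0) _.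
by rewrite lee_fin lerDl divr_ge0 ?ltW.
Qed.

(** For [g s = C f (C s)], substitution gives that the operator of [C b] at [f] is that of [b] at
    [g], and the [p]-norm of [g] is [C ^ (1 / p')] times that of [f]. *)
Lemma hardy_norm_homo p q a b C : (1 < p)%R -> (0 < q)%R -> (0 < C)%R ->
  (forall x, (0 < x)%R -> a x <= C%:E * b x) ->
  hardy_norm p q a <= (C `^ (conj_exponent p)^-1)%:E * hardy_norm p q b.
Proof.
move=> p1 q0 C0 ab; have p0 : (0 < p)%R by exact: lt_trans p1.
apply: hardy_norm_le_of.
  by rewrite mule_ge0 ?hardy_norm_ge0// lee_fin powR_ge0.
move=> f Lf nf; have [mf f0] := Lf.
pose g (s : R) := C%:E * f (C * s)%R.
have g0 s : (0 < s)%R -> 0 <= g s.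
  by move=> s0; rewrite mule_ge0 ?lee_fin ?(ltW C0)// f0// mulr_gt0.
have msc : measurable_fun setT (fun x : lebesgueR R => (C * x)%R : lebesgueR R).
  by move=> _ B mB; rewrite setTI; exact: (completed_lebesgue_scale C0 mB).1.
have IC : ( *%R C) @^-1` I = I.
  by apply/seteqP; split=> x /=; rewrite !in_itv/= !andbT pmulr_rgt0.
have mfC : measurable_fun (T := lebesgueR R) I (fun s => f (C * s)%R).
  apply: (measurable_comp measurable_lebesgueR_I _ mf).
    by move=> _ [x /itv0yE x0 <-]; apply/itv0yE; rewrite mulr_gt0.
  exact: (@measurable_funTS _ _ _ (lebesgueR R)).
have Lg : Lplus g by split => //; exact: measurable_funeM.
have ng : normL p g = (C `^ (conj_exponent p)^-1)%:E * normL p f.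
  rewrite (normLE p0 g0) (normLE p0 f0) conj_exponentV//.
  rewrite -(@integral_completed_scale _ C _ (fun x => f x `^ p) C0 measurable_lebesgueR_I
    (Lplus_poweR Lf p) (fun x _ => poweR_ge0 _ _)) IC.
  set J := \int[mu]_(x in I) (f (C * x)%R `^ p).
  have J0 : 0 <= J by apply: integral_ge0 => x _; exact: poweR_ge0.
  have -> : \int[mu]_(x in I) (g x `^ p) = (C `^ p)%:E * J.
    rewrite /J -(ge0_integralZl_EFin mu measurable_lebesgueR_I
      (fun x _ => poweR_ge0 (f (C * x)%R) p)
      (measurableT_comp (measurable_poweR p) mfC) (powR_ge0 C p)).
    apply: eq_integral => x /set_mem/itv0yE x0.
    by rewrite poweRM ?lee_fin ?(ltW C0)// f0// mulr_gt0.
  rewrite !poweRM ?lee_fin ?powR_ge0 ?(ltW C0)// muleA !poweR_EFin -EFinM.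
  congr (_%:E * _); rewrite -powRrM mulfV ?gt_eqF// powRr1 ?(ltW C0)//.
  rewrite -powRD; last by apply/implyP => _; rewrite gt_eqF.
  have -> : ((p - 1) / p + p^-1 = 1)%R by field; rewrite gt_eqF.
  by rewrite powRr1// ltW.
have [_ /(_ g Lg)] := hardy_norm_bounding b p0 q0.
rewrite ng => H; rewrite -muleA muleCA.
apply: le_trans (H _); last first.
  have nf0 : 0 <= normL p f by exact: Lnorm_ge0.
  case: (normL p f) nf nf0 => [z| |]//= _ _.
  by rewrite -EFinM ltry.
rewrite (normLE q0); last by move=> x _; exact: hardy_op_ge0.
rewrite (normLE q0); last by move=> x _; exact: hardy_op_ge0.
apply: gt0_ler_poweR; first by rewrite invr_ge0 ltW.
- by rewrite in_itv/= leey andbT integral_ge0// => x _; exact: poweR_ge0.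
- by rewrite in_itv/= leey andbT integral_ge0// => x _; exact: poweR_ge0.
apply: le_integral_ge0 => [x _|x /itv0yE x0]; first exact: poweR_ge0.
apply: gt0_ler_poweR; rewrite ?(ltW q0)//.
- by rewrite in_itv/= leey andbT hardy_op_ge0.
- by rewrite in_itv/= leey andbT hardy_op_ge0.
have preE : ( *%R C) @^-1` hardy_dom (C%:E * b x) = hardy_dom (b x).
  apply/seteqP; split=> t; rewrite /hardy_dom /= pmulr_rgt0// EFinM => -[t0];
    rewrite lte_pmul2l ?lte_fin//.
apply: (@le_trans _ _ (\int[mu]_(t in hardy_dom (C%:E * b x)) f t)).
  apply: (le_hardy_dom Lf); [exact: measurable_hardy_dom|exact: measurable_hardy_dom| |].
  - exact/hardy_domS/ab.
  - exact: hardy_dom_I.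
have mfD : measurable_fun (T := lebesgueR R) (hardy_dom (C%:E * b x)) f.
  by apply: measurable_funS mf; [exact: measurable_lebesgueR_I|exact: hardy_dom_I].
have f0D t : hardy_dom (C%:E * b x) t -> 0 <= f t by move=> [t0 _]; exact: f0.
rewrite -(integral_completed_scale C0 (measurable_hardy_dom _) mfD f0D) preE.
have mfCD : measurable_fun (T := lebesgueR R) (hardy_dom (b x)) (fun s => f (C * s)%R).
  by apply: measurable_funS mfC; [exact: measurable_lebesgueR_I|exact: hardy_dom_I].
have fCD t : hardy_dom (b x) t -> 0 <= f (C * t)%R.
  by move=> [t0 _]; rewrite f0// mulr_gt0.
by rewrite -(ge0_integralZl_EFin mu (measurable_hardy_dom (b x)) fCD mfCD (ltW C0)).
Qed.

(* Testing on the indicator of an interval [(0, M)] with [M <= b x]. *)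
Lemma le_hardy_norm_point p q b M x : (1 < p)%R -> (0 < q)%R ->
  normal_form_parameter b -> (0 < x)%R -> (0 < M)%R -> M%:E <= b x ->
  (M `^ ((p - 1) / p) * x `^ q^-1)%:E <= hardy_norm p q b.
Proof.
move=> p1 q0 [b_mono b0] x0 M0 Mb; have p0 : (0 < p)%R by exact: lt_trans p1.
pose f (t : R) : \bar R := (if t <= M then 1 else 0)%R%:E.
have f0 t : 0 <= f t by rewrite lee_fin; case: ifP.
have mf : measurable_fun setT f by rewrite /f; measurable_real.
have Lf : Lplus f by apply: Lplus_Borel.
have fp : \int[mu]_(t in I) (f t `^ p) = M%:E.
  rewrite integral_pintR; [|exact: (measurableT_comp (measurable_poweR p) mf)
    |by move=> t _; exact: poweR_ge0].
  rewrite -[RHS](_ : (M `^ 1)%:E = _); last by rewrite powRr1// ltW.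
  rewrite -pint_powR_le//; apply: eq_pint => t t0; rewrite /f poweR_EFin subrr powRr0 mulr1.
  by case: ifP => _; rewrite ?powR1// powR0// gt_eqF.
have nf : normL p f = (M `^ p^-1)%:E by rewrite (normLE p0)// fp poweR_EFin.
have [N0 H] := hardy_norm_bounding b p0 q0.
have := H f Lf; rewrite nf ltry => /(_ isT).
rewrite (normLE q0); last by move=> y _; exact: hardy_op_ge0.
have lo : ((M `^ q)%:E * x%:E) `^ q^-1 <=
    (\int[mu]_(y in I) (hardy_op b f y `^ q)) `^ q^-1.
  apply: gt0_ler_poweR; rewrite ?invr_ge0 ?(ltW q0)//.
  - by rewrite in_itv/= leey andbT mule_ge0 ?lee_fin ?powR_ge0 ?(ltW x0).
  - by rewrite in_itv/= leey andbT integral_ge0// => y _; exact: poweR_ge0.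
  (* The length of [(0, x]] is rewritten as an integral, so that two integrals over the half-line
     are compared pointwise. *)
  have -> : x%:E = (x `^ 1)%:E by rewrite powRr1// ltW.
  rewrite -(pint_powR_le ltr01 x0).
  rewrite -pintZl ?powR_ge0//; first last.
  - by measurable_real.
  - by move=> y y0; rewrite lee_fin; case: ifP => //; rewrite subrr powRr0 mulr1.
  rewrite -integral_pintR; first last.
  - move=> y y0; rewrite mule_ge0 ?lee_fin ?powR_ge0//; case: ifP => //.
    by rewrite subrr powRr0 mulr1.
  - by apply: measurable_funeM; measurable_real.
  apply: le_integral_ge0 => [y _|y /itv0yE y0].
    rewrite mule_ge0 ?lee_fin ?powR_ge0//; case: ifP => //.
    by rewrite subrr powRr0 mulr1.
  case: ifPn => yx; last by rewrite mule0 poweR_ge0.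
  rewrite subrr powRr0 mulr1 mule1 -poweR_EFin.
  apply: gt0_ler_poweR; rewrite ?(ltW q0)//.
  - by rewrite in_itv/= leey lee_fin (ltW M0).
  - by rewrite in_itv/= leey andbT hardy_op_ge0.
  have bxy : b x <= b y by apply: b_mono; rewrite // in_itv/= andbT.
  apply: le_trans (le_hardy_dom Lf (measurable_hardy_dom M%:E) (measurable_hardy_dom (b y))
    (hardy_domS (le_trans Mb bxy)) (@hardy_dom_I _ _)).
  rewrite hardy_dom_fin.
  have -> : M%:E = \int[mu]_(t in `]0%R, M[) cst 1 t.
    rewrite integral_cst; last by apply: measurable_lebesgueR; exact: measurable_itv.
    rewrite mul1e -[mu _]/(lam `]0%R, M[%classic) lebesgue_measure_itv/= lte_fin M0.
    by rewrite -EFinB subr0.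
  apply: le_integral_ge0 => // t; rewrite /= in_itv/= => /andP[_ tM].
  by rewrite /f (ltW tM).
move=> /(le_trans lo); rewrite -EFinM poweR_EFin powRM ?powR_ge0 ?(ltW x0)//.
rewrite -powRrM mulfV ?gt_eqF// powRr1 ?(ltW M0)//.
case: (hardy_norm p q b) N0 => [N| |]//; last by move=> *; rewrite leey.
rewrite -EFinM !lee_fin => N0 h.
have Mp : (0 < M `^ p^-1)%R by rewrite powR_gt0.
rewrite -(ler_pM2r Mp); apply: le_trans h.
rewrite mulrAC -powRD; last by apply/implyP => _; rewrite gt_eqF.
have -> : ((p - 1) / p + p^-1 = 1)%R by field; rewrite gt_eqF.
by rewrite powRr1// ltW.
Qed.

Lemma A0_le_hardy_norm p q b : (1 < p)%R -> (0 < q)%R ->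
  normal_form_parameter b -> A0 p q b <= hardy_norm p q b.
Proof.
move=> p1 q0 nb; have p0 : (0 < p)%R by exact: lt_trans p1.
have k0 : (0 < (p - 1) / p)%R by rewrite divr_gt0// subr_gt0.
apply: ge_ereal_sup => _ [x /itv0yE x0 <-].
have := @le_hardy_norm_point p q b _ x p1 q0 nb x0.
have [_ b0] := nb; have := b0 x x0.
rewrite /c0 conj_exponentV//; case: (b x) => [r| |]//.
  rewrite lee_fin => r0; move: r0; rewrite [in X in X -> _]le_eqVlt => /predU1P[<- _|r0 H].
    by rewrite poweR0r ?gt_eqF// mul0e hardy_norm_ge0.
  by rewrite poweR_EFin -EFinM; exact: H.
move=> _ H; rewrite poweRyr ?gt_eqF// gt0_mulye ?lte_fin ?powR_gt0//.
have := hardy_norm_ge0 p q b; case: (hardy_norm p q b) H => [N| |]// H N0.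
rewrite lee_fin in N0.
have xq : (0 < x `^ q^-1)%R by rewrite powR_gt0.
(* When [b x] is infinite every height [M] is allowed, and this one would force the finite norm [N]
   to be at least [N + 1]. *)
have M1 : (0 < (N + 1) / x `^ q^-1)%R by rewrite divr_gt0// ltr_wpDl.
have := H _ (powR_gt0 ((p - 1) / p)^-1 M1) (leey _).
rewrite -powRrM mulVf ?gt_eqF// powRr1 ?(ltW M1)// divfK ?gt_eqF// lee_fin.
by rewrite gerDl ler10.
Qed.

End hardy_bounds.

(** * Dilation of test functions *)

Section dilation.
Context {R : realType}.
Implicit Types (c d e k p q x y : R).

Local Notation lam := (@lebesgue_measure R).
Local Notation mu :=
  (@completed_lebesgue_measure R : {measure set (lebesgueR R) -> \bar R}).
Local Notation I := (`]0%R, +oo[%classic : set R).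

Lemma pint_exhaust (g : R -> R) (chi : nat -> R -> bool) (C : \bar R) :
  measurable_fun setT g -> (forall x, (0 < x)%R -> (0 <= g x)%R) ->
  (forall n, measurable_fun setT (chi n)) ->
  (forall x m n, (0 < x)%R -> (m <= n)%N -> chi m x -> chi n x) ->
  (forall x, (0 < x)%R -> \forall n \near \oo, chi n x) ->
  (forall n, pint (fun x => (if chi n x then g x else 0)%R%:E) <= C) ->
  pint (fun x => (g x)%:E) <= C.
Proof.
move=> mg g0 mchi mono ev ub.
pose G n x := (if chi n x then g x else 0)%R%:E.
have mG n : measurable_fun setT (G n).
  apply/measurable_EFinP; apply: measurable_fun_ifT;
    [exact: mchi|exact: mg|exact: measurable_cst].
have mI : measurable (I : set (measurableTypeR R)) by exact: measurable_itv.
have G0 n x : I x -> 0 <= G n x.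
  by move=> /itv0yE x0; rewrite lee_fin; case: ifP => // _; exact: g0.
have Gm x : I x -> {homo G ^~ x : m n / (m <= n)%N >-> m <= n}.
  move=> /itv0yE x0 m n mn; rewrite /G lee_fin; case: ifPn => [h|_].
    by rewrite (mono x m n x0 mn h).
  by case: ifP => // _; exact: g0.
have H := @cvg_monotone_convergence _ (measurableTypeR R) R lam _ mI
  G (fun n => measurable_funTS (mG n)) G0 Gm.
rewrite (@eq_pint _ _ (fun x => limn (G ^~ x))).
  by apply: (cvge_le _ H); apply: nearW => n; exact: ub.
move=> x x0; apply/esym/cvg_lim => //.
apply: cvg_near_cst; apply: filterS (ev x x0) => n hn.
by rewrite /G hn.
Qed.

Context p q (p1 : (1 < p)%R) (q0 : (0 < q)%R).
Let kap := (q * (p - 1) / p)%R.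
Let p0 : (0 < p)%R. Proof. exact: lt_trans p1. Qed.
Let kap0 : (0 < kap)%R.
Proof. by rewrite divr_gt0 ?mulr_gt0// subr_gt0. Qed.

Context (b : R -> \bar R) c (c0 : (0 < c)%R) (Cst : R)
  (NC : hardy_norm p q b <= Cst%:E).
Context (f Phi : R -> R) (ip : R) (mf : measurable_fun setT f)
  (f0 : forall x, (0 <= f x)%R) (mPhi : measurable_fun setT Phi)
  (Phi0 : forall x, (0 < x)%R -> (0 <= Phi x)%R)
  (fPhi : forall y, (0 < y)%R -> \int[lam]_(x in `]0%R, y]) (f x)%:E = (Phi y)%:E)
  (fip : pint (fun x => (f x `^ p)%:E) = ip%:E).

Let Cst0 : (0 <= Cst)%R.
Proof. by rewrite -lee_fin; apply: le_trans NC; exact: hardy_norm_ge0. Qed.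

Let ip0 : (0 <= ip)%R.
Proof. by rewrite -lee_fin -fip; apply: pint_ge0 => x _; rewrite lee_fin powR_ge0. Qed.

Section dilated.
Context (m : R) (m0 : (0 < m)%R).

Let fm x : \bar R := (f (m * x))%:E.

Let mmx : measurable_fun setT (fun x : R => m * x)%R.
Proof. exact: mulrl_measurable. Qed.

Let mfm : measurable_fun setT fm.
Proof. by apply/measurable_EFinP; exact: (measurableT_comp mf mmx). Qed.

Let Lfm : Lplus fm.
Proof. by apply: Lplus_Borel => // x _; rewrite lee_fin. Qed.

Let nfm : normL p fm = ((ip / m) `^ p^-1)%:E.
Proof.
rewrite normLE//; last by move=> x _; rewrite lee_fin.
rewrite integral_pintR; [|exact: (measurableT_comp (measurable_poweR p) mfm)
  |by move=> x _; exact: poweR_ge0].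
rewrite -poweR_EFin; congr (_ `^ _); apply: mule_eq_divr => //.
rewrite -fip; apply: (pint_scale m0 (f := fun x => (f x `^ p)%:E)).
  by move=> x _; rewrite lee_fin powR_ge0.
by apply/measurable_EFinP; exact: measurable_fun_powRl.
Qed.

Let hardy_fm x y : (0 < y)%R -> y%:E <= b x ->
  (m^-1 * Phi (m * y))%:E <= hardy_op b fm x.
Proof.
move=> y0 yb; have my0 : (0 < m * y)%R by rewrite mulr_gt0.
apply: le_trans (le_hardy_dom Lfm (measurable_hardy_dom y%:E) (measurable_hardy_dom (b x))
  (hardy_domS yb) (@hardy_dom_I _ _)).
rewrite hardy_dom_fin.
have mI z : measurable (`]0%R, z[%classic : set R) by exact: measurable_itv.
have mfE (D : set R) : measurable_fun D (EFin \o f).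
  by apply: measurable_funTS; exact/measurable_EFinP.
have H := @integral_completed_scale R m `]0%R, (m * y)%R[%classic (EFin \o f) m0
  (measurable_lebesgueR (mI _)) (measurable_fun_lebesgueR (mI _) (mfE _))
  (fun x _ => f0 x).
rewrite (integral_lebesgueR (mI _) (mfE _) (fun x _ => f0 x)) in H.
rewrite integral_itv_bndo_bndc// (fPhi my0) in H.
have E : ( *%R m) @^-1` `]0%R, (m * y)%R[%classic = `]0%R, y[%classic.
  by apply/seteqP; split=> z /=; rewrite !in_itv/= pmulr_rgt0// ltr_pM2l.
rewrite E in H.
have -> : (m^-1 * Phi (m * y) = Phi (m * y) / m)%R by rewrite mulrC.
by rewrite (mule_eq_divr m0 H).
Qed.

Let hardy_bound :
  \int[mu]_(x in I) (hardy_op b fm x `^ q) <= (Cst `^ q * (ip / m) `^ (q / p))%:E.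
Proof.
have [_ /(_ fm Lfm)] := hardy_norm_bounding b p0 q0.
rewrite nfm ltry => /(_ isT) H.
have {}H : normL q (hardy_op b fm) <= (Cst * (ip / m) `^ p^-1)%:E.
  by apply: le_trans H _; rewrite EFinM lee_wpmul2r// lee_fin powR_ge0.
rewrite (normLE q0) in H; last by move=> x _; exact: hardy_op_ge0.
set X := \int[mu]_(x in I) _ in H *.
have X0 : 0 <= X by apply: integral_ge0 => x _; exact: poweR_ge0.
have -> : X = (X `^ q^-1) `^ q by rewrite -poweRrM mulVf ?gt_eqF// poweRe1.
have -> : (Cst `^ q * (ip / m) `^ (q / p) = (Cst * (ip / m) `^ p^-1) `^ q)%R.
  by rewrite [in RHS]powRM ?powR_ge0// -powRrM (mulrC p^-1%R).
rewrite -poweR_EFin; apply: gt0_ler_poweR => //; first exact: ltW.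
- by rewrite in_itv/= leey poweR_ge0.
- by rewrite in_itv/= leey lee_fin mulr_ge0 ?powR_ge0.
Qed.

(** Dilating [f] by [m] and the outer variable by [m ^ kap] leaves the inequality for the power form
    invariant, since [kap - q = - q / p]; only the set where [b] dominates the power is moved. *)
Lemma hardy_norm_dilated (chi : R -> bool) : measurable_fun setT chi ->
  (forall x, (0 < x)%R -> chi x -> (power_form c kap x)%:E <= b x) ->
  pint (fun w => (if chi (m `^ kap * w) then Phi (power_form c kap w) `^ q else 0)%R%:E)
    <= (Cst `^ q * ip `^ (q / p))%:E.
Proof.
move=> mchi chib.
pose k := (m `^ kap)%R; have k0 : (0 < k)%R by rewrite powR_gt0.
pose G x := (if chi x then (m^-1 * Phi (m * power_form c kap x)) `^ q else 0)%R%:E.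
have mPm : measurable_fun setT (fun x => Phi (m * power_form c kap x)).
  apply: (measurableT_comp mPhi); apply: (measurableT_comp mmx).
  exact: measurable_power_form.
have mG : measurable_fun setT G.
  apply/measurable_EFinP; apply: measurable_fun_ifT; [exact: mchi| |exact: measurable_cst].
  apply: measurable_fun_powRl; apply: measurable_funM; [exact: measurable_cst|exact: mPm].
have G0 x : (0 < x)%R -> 0 <= G x.
  by move=> x0; rewrite lee_fin; case: ifP => // _; exact: powR_ge0.
have HG : pint G <= (Cst `^ q * (ip / m) `^ (q / p))%:E.
  apply: le_trans hardy_bound; rewrite -integral_pintR//.
  apply: le_integral_ge0 => [x /itv0yE|x /itv0yE x0]; first exact: G0.
  rewrite /G; case: ifPn => chx; last exact: poweR_ge0.
  have pf0 := @power_form_gt0 _ c kap x c0 x0.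
  rewrite -poweR_EFin; apply: gt0_ler_poweR; first exact: ltW.
  - rewrite in_itv/= leey lee_fin andbT; apply: mulr_ge0; first by rewrite invr_ge0 ltW.
    by apply: Phi0; rewrite mulr_gt0.
  - by rewrite in_itv/= leey andbT hardy_op_ge0.
  exact: hardy_fm pf0 (chib x x0 chx).
rewrite -(pint_scale k0 G0 mG) in HG.
have GE w : (0 < w)%R -> G (k * w)%R =
    (m `^ (- q))%:E * (if chi (k * w) then Phi (power_form c kap w) `^ q else 0)%R%:E.
  move=> w0; rewrite /G.
  have -> : (m * power_form c kap (k * w) = power_form c kap w)%R.
    rewrite /power_form powRM ?(ltW k0) ?(ltW w0)// /k -powRrM.
    have -> : (kap * - kap^-1 = - 1)%R by field; rewrite gt_eqF.
    rewrite powR_inv1 ?(ltW m0)//; field.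
    by rewrite gt_eqF.
  case: ifP => _; last by rewrite mule0.
  rewrite -EFinM powRM ?invr_ge0 ?(ltW m0) ?Phi0 ?power_form_gt0//.
  by rewrite -powR_inv1 ?(ltW m0)// -powRrM mulN1r.
rewrite (eq_pint GE) pintZl ?powR_ge0// in HG; first last.
- apply/measurable_EFinP; apply: measurable_fun_ifT; [|
    apply: measurable_fun_powRl; exact: (measurableT_comp mPhi (measurable_power_form _ _))
    |exact: measurable_cst].
  by apply: (measurableT_comp mchi); exact: mulrl_measurable.
- by move=> w w0; rewrite lee_fin; case: ifP => // _; exact: powR_ge0.
rewrite muleA -EFinM in HG.
have e1 : (k * m `^ (- q) = m `^ (- (q / p)))%R.
  rewrite /k -powRD; last by apply/implyP => _; rewrite gt_eqF.
  by congr (_ `^ _)%R; rewrite /kap; field; rewrite gt_eqF.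
have e2 : (Cst `^ q * (ip / m) `^ (q / p) = m `^ (- (q / p)) * (Cst `^ q * ip `^ (q / p)))%R.
  rewrite powRM ?invr_ge0 ?(ltW m0)//.
  have -> : (m^-1 `^ (q / p) = m `^ (- (q / p)))%R.
    by rewrite -powR_inv1 ?(ltW m0)// -powRrM mulN1r.
  by ring.
by move: HG; rewrite e1 e2 EFinM lee_pmul2l// lte_fin powR_gt0.
Qed.

End dilated.

(* Dilating a test function pushes the range where [b] dominates the power to
   the whole half-line. *)
Lemma hardy_norm_dilation :
  (exists2 d, (0 < d)%R & forall x, (0 < x)%R -> (x < d)%R -> (power_form c kap x)%:E <= b x) \/
  (exists d, forall x, (0 < x)%R -> (d < x)%R -> (power_form c kap x)%:E <= b x) ->
  pint (fun w => (Phi (power_form c kap w) `^ q)%:E) <= (Cst `^ q * ip `^ (q / p))%:E.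
Proof.
have mg : measurable_fun setT (fun w => Phi (power_form c kap w) `^ q)%R.
  apply: measurable_fun_powRl; exact: (measurableT_comp mPhi (measurable_power_form _ _)).
(* Dilating the test function by [k ^ (1 / kap)] multiplies the outer variable by [k]; below, [k] is
   [1 / n.+1] near 0 and [n.+1] near infinity. *)
have mk k : (0 < k)%R -> ((k `^ kap^-1) `^ kap = k)%R.
  by move=> k0; rewrite -powRrM mulVf ?gt_eqF// powRr1// ltW.
case=> [[d d0 H]|[d H]].
- apply: (pint_exhaust (chi := fun n w => (n.+1%:R^-1 * w < d)%R)) => //.
  + by move=> x _; exact: powR_ge0.
  + by move=> n; measurable_real.
  + move=> x m n x0 mn; apply: le_lt_trans; rewrite ler_pM2r// lef_pV2 ?posrE//.
    by rewrite ler_nat ltnS.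
  + move=> x x0; near=> n; rewrite mulrC ltr_pdivrMr// mulrC -ltr_pdivrMr//.
    apply: (@le_lt_trans _ _ n%:R); last by rewrite ltr_nat.
    near: n; exact: nbhs_infty_ger.
  + move=> n; have n0 : (0 < n.+1%:R^-1 :> R)%R by rewrite invr_gt0.
    have := @hardy_norm_dilated _ (powR_gt0 kap^-1 n0) (fun x => x < d)%R.
    by rewrite mk//; apply; [measurable_real|exact: H].
- apply: (pint_exhaust (chi := fun n w => (d < n.+1%:R * w)%R)) => //.
  + by move=> x _; exact: powR_ge0.
  + by move=> n; measurable_real.
  + move=> x m n x0 mn h; apply: lt_le_trans h _; rewrite ler_pM2r//.
    by rewrite ler_nat ltnS.
  + move=> x x0; near=> n; rewrite -ltr_pdivrMr//.
    apply: (@le_lt_trans _ _ n%:R); last by rewrite ltr_nat.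
    near: n; exact: nbhs_infty_ger.
  + move=> n; have n0 : (0 < n.+1%:R :> R)%R by [].
    have := @hardy_norm_dilated _ (powR_gt0 kap^-1 n0) (fun x => d < x)%R.
    by rewrite mk//; apply; [measurable_real|exact: H].
Unshelve. all: by end_near. Qed.

End dilation.

(** * Extremal functions and lower bounds *)

Section extremals.
Context {R : realType}.
Implicit Types (a c d e p q r s t x y : R) (b : R -> \bar R).

Local Notation lam := (@lebesgue_measure R).

Definition dominates_power b c e : Prop :=
  (exists2 d, (0 < d)%R & forall x, (0 < x)%R -> (x < d)%R -> (power_form c e x)%:E <= b x) \/
  (exists d, forall x, (0 < x)%R -> (d < x)%R -> (power_form c e x)%:E <= b x).

Lemma continuous_1DpowR r e y : (0 < y)%R ->
  {for y, continuous (fun y => (1 + y `^ r) `^ e)%R}.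
Proof.
move=> y0; apply: (@continuous_comp _ _ _ (fun y => 1 + y `^ r)%R (fun z => z `^ e)%R).
  by apply: cvgD; [exact: cvg_cst|exact: continuous_powR].
by apply: continuous_powR; rewrite addr_gt0// powR_gt0.
Qed.

(* The derivative is Bliss's extremal function for [r = (q - p) / p]. *)
Lemma is_derive_bliss r y : (0 < r)%R -> (0 < y)%R ->
  is_derive y 1%R (fun y => y * (1 + y `^ r) `^ (- r^-1))%R
    ((1 + y `^ r) `^ (- r^-1 - 1))%R.
Proof.
move=> r0 y0; have g0 : (0 < 1 + y `^ r)%R by rewrite addr_gt0// powR_gt0.
have H1 : is_derive y 1%R (fun y => 1 + y `^ r)%R (0 + r * y `^ (r - 1))%R.
  by apply: is_deriveD; exact: is_derive1_powR.
have H2 : is_derive y 1%R ((fun z => z `^ (- r^-1))%R \o (fun y => 1 + y `^ r)%R)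
    (- r^-1 * (1 + y `^ r) `^ (- r^-1 - 1) * (0 + r * y `^ (r - 1)))%R.
  by apply: is_derive1_comp; exact: is_derive1_powR.
have := is_deriveM (is_derive_id y 1%R) H2.
case=> d1 d2; apply: DeriveDef; [exact: d1|rewrite [LHS]d2 /GRing.scale/= add0r mulr1].
have -> : ((1 + y `^ r) `^ (- r^-1) = (1 + y `^ r) * (1 + y `^ r) `^ (- r^-1 - 1))%R.
  have -> : (- r^-1 = 1 + (- r^-1 - 1))%R by ring.
  rewrite {1}powRD; last by apply/implyP => _; rewrite gt_eqF.
  rewrite powRr1 ?(ltW g0)//; congr (_ * _ `^ _)%R; by ring.
have -> : (y * (- r^-1 * (1 + y `^ r) `^ (- r^-1 - 1) * (r * y `^ (r - 1))) =
    - (y * y `^ (r - 1)) * (1 + y `^ r) `^ (- r^-1 - 1))%R.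
  by field; rewrite gt_eqF.
rewrite mulr_powRB1 ?(ltW y0)//; by ring.
Qed.

Lemma integral_bliss r y : (0 < r)%R -> (0 < y)%R ->
  \int[lam]_(x in `]0%R, y]) ((1 + x `^ r) `^ (- r^-1 - 1))%:E =
  (y * (1 + y `^ r) `^ (- r^-1))%:E.
Proof.
move=> r0 y0.
rewrite (@integral_FTC0 R (fun y => y * (1 + y `^ r) `^ (- r^-1))%R
  (fun x => (1 + x `^ r) `^ (- r^-1 - 1))%R _ _ _ 0%R) ?subr0//.
- by move=> x x0; exact: is_derive_bliss.
- by move=> x x0; exact: continuous_1DpowR.
- by move=> x _; exact: powR_ge0.
- apply: (@squeeze_cvgr _ _ _ R (fun=> 0%R) (fun x => x)).
  + near=> x; have x0 : (0 < x)%R by [].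
    rewrite mulr_ge0 ?powR_ge0 ?(ltW x0)//= ler_piMr ?(ltW x0)//.
    have := @powRN_le _ r^-1 1%R (1 + x `^ r)%R; rewrite powR1; apply.
    * by rewrite invr_gt0.
    * by [].
    * by rewrite lerDl powR_ge0.
  + exact: cvg_cst.
  + by apply: cvg_at_right_filter; exact: cvg_id.
Unshelve. all: by end_near. Qed.

(** For Bliss's extremal the integral of [f ^ p] is [T], and that of the [q]-th power of its
    primitive along the power form is [c ^ kap * T]. The resulting
    [c ^ kap * T <= Cst ^ q * T ^ (q / p)] is the claim raised to the power [q], as
    [K_ p q ^ q = T ^ (- r)] and [q / p = r + 1]. *)
Lemma hardy_norm_ge_bliss p q b c (Cst : R) : (1 < p)%R -> (p < q)%R -> (0 < c)%R ->
  hardy_norm p q b <= Cst%:E -> dominates_power b c (q * (p - 1) / p)%R ->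
  (K_ p q * c `^ ((p - 1) / p) <= Cst)%R.
Proof.
move=> p1 pq c0 NC dom.
have p0 : (0 < p)%R by exact: lt_trans p1.
have q0 : (0 < q)%R by exact: lt_trans pq.
have p10 : (0 < p - 1)%R by rewrite subr_gt0.
have qp : (0 < q - p)%R by rewrite subr_gt0.
have Cst0 : (0 <= Cst)%R by rewrite -lee_fin; apply: le_trans NC; exact: hardy_norm_ge0.
set kap := (q * (p - 1) / p)%R in dom *.
have kap0 : (0 < kap)%R by rewrite divr_gt0 ?mulr_gt0.
pose r := ((q - p) / p)%R; have r0 : (0 < r)%R by rewrite divr_gt0.
pose s := bliss_exponent p q; have s0 : (0 < s)%R by exact: bliss_exponent_gt0.
have T0 := bliss_integral_gt0 p1 pq; set T := bliss_integral p q in T0.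
have sE : s = (p * q / (q - p))%R by rewrite /s bliss_exponentE.
have s1 : (r^-1 + 1 = s / p)%R.
  by rewrite sE /r invf_div; field; rewrite !gt_eqF.
have s2 : (s - r^-1 = s / conj_exponent q)%R.
  rewrite bliss_exponent_conj// -/s sE /r invf_div; field; by rewrite !gt_eqF.
have s3 : ((- r^-1 - 1) * p = - s)%R.
  by rewrite sE /r invf_div; field; rewrite !gt_eqF.
have s4 : ((r / kap)^-1 + 1 = s / conj_exponent q)%R.
  by rewrite bliss_exponent_conj// -/s sE /r /kap; field; rewrite !gt_eqF.
have s5 : (s - (r / kap)^-1 = s / p)%R.
  by rewrite sE /r /kap; field; rewrite !gt_eqF.
have sq0 : (0 < s / conj_exponent q)%R.
  by rewrite -s4 addr_gt0// invr_gt0 divr_gt0.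
have sp0 : (0 < s / p)%R by rewrite divr_gt0.
have fip : pint (fun x => (((1 + x `^ r) `^ (- r^-1 - 1)) `^ p)%:E) = T%:E.
  transitivity (pint (fun x => ((1 + x `^ r) `^ (- s))%:E)).
    by apply: eq_pint => x x0; rewrite -powRrM s3.
  have rs : (r^-1 < s)%R by rewrite -subr_gt0 s2.
  rewrite (pint_cauchy r0 rs).
  by rewrite s1 s2.
have := @hardy_norm_dilation R p q p1 q0 b c c0 Cst NC
  (fun x => (1 + x `^ r) `^ (- r^-1 - 1))%R
  (fun y => y * (1 + y `^ r) `^ (- r^-1))%R T.
move=> H.
have m1 : measurable_fun setT (fun x => (1 + x `^ r) `^ (- r^-1 - 1))%R by measurable_real.
have m2 : measurable_fun setT (fun y => y * (1 + y `^ r) `^ (- r^-1))%R by measurable_real.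
have g1 x : (0 <= (1 + x `^ r) `^ (- r^-1 - 1))%R by exact: powR_ge0.
have g2 x : (0 < x)%R -> (0 <= x * (1 + x `^ r) `^ (- r^-1))%R.
  by move=> x0; rewrite mulr_ge0 ?powR_ge0// ltW.
have {}H := H m1 g1 m2 g2 (fun y => @integral_bliss r y r0) fip dom.
(* Replacing the exponent [r] by [r / kap] exchanges the Gamma arguments [s / p] and [s / q'], so
   the integral is again [T]. *)
have TE : T%:E = pint (fun w => ((1 + w `^ (r / kap)) `^ (- s))%:E).
  have rk0 : (0 < r / kap)%R by rewrite divr_gt0.
  have rks : ((r / kap)^-1 < s)%R by rewrite -subr_gt0 s5.
  rewrite (pint_cauchy rk0 rks) s4 s5 /T /bliss_integral -/s.
  apply: (congr1 EFin); apply: (congr1 (fun z => z / _)%R); exact: mulrC.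
have {}H : (c `^ kap)%:E * T%:E <= (Cst `^ q * T `^ (q / p))%:E.
  apply: le_trans H; rewrite -/kap.
  have ck0 : (0 < c `^ kap)%R by rewrite powR_gt0.
  set G := (X in _ <= pint X).
  rewrite -(@pint_scale _ (c `^ kap) G ck0).
  - apply: lee_wpmul2l; first by rewrite lee_fin ltW.
    rewrite TE le_eqVlt; apply/orP; left; apply/eqP; apply: eq_pint => w w0.
    rewrite /G; apply: (congr1 EFin).
    have -> : power_form c kap (c `^ kap * w) = (w `^ (- kap^-1))%R.
      rewrite /power_form powRM ?powR_ge0 ?(ltW w0)// -powRrM.
      have -> : (kap * - kap^-1 = - 1)%R by field; rewrite gt_eqF.
      by rewrite powR_inv1 ?(ltW c0)// mulVKf// gt_eqF.
    (* As [r s = q], [(1 + v ^ (- r)) ^ (- s)] equals [v ^ q (1 + v ^ r) ^ (- q / r)], the [q]-th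
       power of the primitive at [v]. *)
    set v := (w `^ (- kap^-1))%R; have v0 : (0 < v)%R by rewrite powR_gt0.
    have wv : (w `^ (r / kap) = v `^ (- r))%R.
      by rewrite /v -powRrM; congr (_ `^ _)%R; field; rewrite gt_eqF.
    rewrite wv.
    have vr0 : (0 < v `^ r)%R by rewrite powR_gt0.
    have -> : (1 + v `^ (- r) = (1 + v `^ r) * v `^ (- r))%R.
      by rewrite powRN; field; rewrite gt_eqF.
    have g0 : (0 < 1 + v `^ r)%R by rewrite addr_gt0.
    rewrite [RHS]powRM ?powR_ge0 ?(ltW v0)// -powRrM.
    rewrite [LHS]powRM ?powR_ge0 ?(ltW g0)// -powRrM [RHS]mulrC.
    by congr (_ `^ _ * _ `^ _)%R; rewrite sE /r; field; rewrite !gt_eqF.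
  - by move=> w w0; rewrite lee_fin powR_ge0.
  - by rewrite /G /power_form; measurable_real.
rewrite -EFinM lee_fin in H.
rewrite leNgt; apply/negP => lt.
have KC0 : (0 <= K_ p q * c `^ ((p - 1) / p))%R.
  by rewrite mulr_ge0 ?powR_ge0 ?ltW// K_gt0// ltW.
have := gt0_ltr_powR q0 Cst0 KC0 lt.
rewrite powRM ?powR_ge0 ?ltW ?K_gt0 ?ltW//.
rewrite K_lt_powq// -/r -/T -powRrM.
have -> : ((p - 1) / p * q = kap)%R by rewrite /kap; field; rewrite gt_eqF.
rewrite ltNge => /negP; apply.
rewrite powRN mulrC ler_pdivrMr ?powR_gt0//.
have -> : (c `^ kap = c `^ kap * T * T^-1)%R by rewrite mulfK// gt_eqF.
rewrite ler_pdivrMr//; apply: le_trans H _.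
rewrite -mulrA ler_wpM2l ?powR_ge0//.
have -> : (q / p = r + 1)%R by rewrite /r; field; rewrite gt_eqF.
rewrite powRD ?powRr1 ?(ltW T0)//.
by apply/implyP => _; rewrite gt_eqF.
Qed.

Lemma powRN_cvgy e : (0 < e)%R -> (x `^ (- e))%R @[x --> +oo%R] --> 0%R.
Proof.
move=> e0; apply/cvgrPdist_lt => d d0; near=> x.
have x0 : (0 < x)%R by near: x; exact: nbhs_pinfty_gt.
rewrite sub0r normrN ger0_norm ?powR_ge0//.
have xd : (((d / 2) `^ (- e^-1)) <= x)%R.
  by near: x; apply: nbhs_pinfty_ge; rewrite num_real.
rewrite -powRN_swap_ge// ?divr_gt0// in xd.
by apply: le_lt_trans xd _; rewrite ltr_pdivrMr// ltr_pMr// ltrDl.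
Unshelve. all: by end_near. Qed.

Lemma integral_powRN_tail d e : (0 < d)%R -> (0 < e)%R ->
  \int[lam]_(x in `]d, +oo[) (x `^ (- e - 1))%:E = (d `^ (- e) / e)%:E.
Proof.
move=> d0 e0.
rewrite (@integral_FTCy R (fun x => - e^-1 * x `^ (- e))%R (fun x => x `^ (- e - 1))%R _ _ _ 0%R)//.
- by congr EFin; field; rewrite gt_eqF.
- move=> x x0; have := is_deriveM (is_derive_cst (- e^-1)%R x 1%R) (is_derive1_powR (- e)%R x0).
  case=> d1 d2; apply: DeriveDef; [exact: d1|rewrite [LHS]d2 /GRing.scale/=].
  by field; rewrite gt_eqF.
- by move=> x x0; exact: continuous_powR.
- by move=> x _; exact: powR_ge0.
- rewrite -(mulr0 (- e^-1)%R); apply: cvgM; first exact: cvg_cst.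
  exact: powRN_cvgy.
Qed.

End extremals.

(** * Truncated powers for [p = q], and the bounds by lower limits *)

Section lower_bounds.
Context {R : realType}.
Implicit Types (a c d e p q t x y A : R) (b : R -> \bar R).

Local Notation lam := (@lebesgue_measure R).

Section hardy_test.
Context (p c e : R) (p1 : (1 < p)%R) (c0 : (0 < c)%R) (e0 : (0 < e)%R).

Let p0 : (0 < p)%R. Proof. exact: lt_trans p1. Qed.
Let p10 : (0 < p - 1)%R. Proof. by rewrite subr_gt0. Qed.
(** The exponent for which [f ^ p] is [t ^ (e - 1)] on [(0, 1]]: [e = 0] is the critical,
    non-integrable power, and [a] tends to [1 / p'] as [e] tends to 0. *)
Let a := ((p - 1 + e) / p)%R.
Let a0 : (0 < a)%R. Proof. by rewrite divr_gt0// addr_gt0. Qed.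
Let f t : R := (if t <= 1 then t `^ (a - 1) else 0)%R.
Let Phi y : R := (a^-1 * (if y <= 1 then y else 1) `^ a)%R.
Let kap := (p * (p - 1) / p)%R.
Let kapE : kap = (p - 1)%R. Proof. by rewrite /kap; field; rewrite gt_eqF. Qed.
Let kap0 : (0 < kap)%R. Proof. by rewrite kapE. Qed.

Let f_primitive y : (0 < y)%R ->
  \int[lam]_(x in `]0%R, y]) (f x)%:E = (Phi y)%:E.
Proof.
move=> y0; set u := (if (y <= 1)%R then y else 1%R).
have u0 : (0 < u)%R by rewrite /u; case: ifP.
rewrite /Phi -/u EFinM -(pint_powR_le a0 u0) -pintZlr; first last.
- by measurable_real.
- by move=> x _; case: ifP => // _; rewrite mulr_ge0 ?powR_ge0 ?(ltW a0).
- by rewrite invr_ge0 ltW.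
rewrite integral_pint//; last by move=> x /=; rewrite !in_itv/= andbT => /andP[].
apply: eq_pint => x x0; rewrite patchE.
have -> : (x \in (`]0%R, y]%classic : set R)) = (x <= y)%R by rewrite mem_setE in_itv/= x0.
have -> : (x <= u)%R = (x <= y)%R && (x <= 1)%R.
  rewrite /u; case: ifPn => [y1|]; last rewrite -ltNge => y1.
    by apply/idP/andP => [xy|[]//]; split=> //; exact: le_trans y1.
  by apply/idP/andP => [x1|[]//]; split=> //; apply: le_trans (ltW y1).
rewrite /f; case: (x <= y)%R; case: (x <= 1)%R => //=; rewrite ?mulr0//.
by rewrite mulKf// gt_eqF.
Qed.

Let f_power : pint (fun x => (f x `^ p)%:E) = (e^-1)%:E.
Proof.
have := pint_powR_le e0 ltr01; rewrite powR1 => h.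
rewrite -[RHS]mule1 -h -pintZlr; first last.
- by measurable_real.
- by move=> x _; case: ifP => // _; rewrite mulr_ge0 ?powR_ge0 ?(ltW e0).
- by rewrite invr_ge0 ltW.
apply: eq_pint => x x0; rewrite /f; case: ifP => _.
  rewrite -powRrM mulKf ?gt_eqF//; congr (_ `^ _)%:E.
  by rewrite /a; field; rewrite gt_eqF.
by rewrite powR0 ?gt_eqF// mulr0.
Qed.

(** Only [w > c ^ kap] is kept, where the power form is below 1 and the primitive is a pure power.
    Both sides then diverge like [1 / e], a factor that cancels; as [e] tends to 0 the bound becomes
    Hardy's constant. *)
Lemma hardy_norm_ge_test b (Cst : R) : hardy_norm p p b <= Cst%:E ->
  dominates_power b c kap -> ((p - 1) * c `^ (p - 1) <= (Cst * a) `^ p)%R.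
Proof.
move=> NC dom.
have Cst0 : (0 <= Cst)%R by rewrite -lee_fin; apply: le_trans NC; exact: hardy_norm_ge0.
have m1 : measurable_fun setT f by rewrite /f; measurable_real.
have m2 : measurable_fun setT Phi by rewrite /Phi; measurable_real.
have g1 x : (0 <= f x)%R by rewrite /f; case: ifP => // _; exact: powR_ge0.
have g2 x : (0 < x)%R -> (0 <= Phi x)%R.
  by move=> _; rewrite mulr_ge0 ?powR_ge0// invr_ge0 ltW.
have := @hardy_norm_dilation R p p p1 p0 b c c0 Cst NC f Phi e^-1%R m1 g1 m2 g2
  f_primitive f_power dom.
rewrite -/kap mulfV ?gt_eqF// powRr1 ?invr_ge0 ?(ltW e0)// => H.
pose D := (c `^ kap)%R; have D0 : (0 < D)%R by rewrite powR_gt0.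
pose eta := (e / (p - 1))%R; have eta0 : (0 < eta)%R by rewrite divr_gt0.
pose K0 := (a^-1 `^ p * c `^ (a * p))%R.
have K00 : (0 < K0)%R by rewrite mulr_gt0 ?powR_gt0 ?invr_gt0.
have tail : pint (fun w => (K0 * (if D < w then w `^ (- eta - 1) else 0))%:E) =
    (K0 * (D `^ (- eta) / eta))%:E.
  rewrite pintZlr; first last.
  - by measurable_real.
  - by move=> x _; case: ifP => // _; exact: powR_ge0.
  - exact: ltW.
  rewrite [RHS]EFinM -(integral_powRN_tail D0 eta0); apply: (congr1 (fun z => K0%:E * z)).
  rewrite integral_pint//; last first.
    by move=> x /=; rewrite !in_itv/= !andbT; exact: lt_trans.
  apply: eq_pint => w w0; rewrite patchE.
  have -> : (w \in (`]D, +oo[%classic : set R)) = (D < w)%R by rewrite mem_setE in_itv/= andbT.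
  by case: ifP.
have {}H : (K0 * (D `^ (- eta) / eta) <= Cst `^ p * e^-1)%R.
  rewrite -lee_fin -tail; apply: le_trans H; apply: le_pint.
  - by move=> w _; rewrite lee_fin mulr_ge0 ?(ltW K00)//; case: ifP => // _; exact: powR_ge0.
  - by measurable_real.
  - apply/measurable_EFinP; apply: measurable_fun_powRl.
    exact: (measurableT_comp m2 (measurable_power_form c kap)).
  move=> w w0; rewrite lee_fin; case: ifPn => Dw; last by rewrite mulr0 powR_ge0.
  have pf0 := @power_form_gt0 _ c kap w c0 w0.
  have -> : Phi (power_form c kap w) = (a^-1 * power_form c kap w `^ a)%R.
    rewrite /Phi power_form_le//.
    have -> : ((1 / c) `^ (- kap) = D)%R.
      by rewrite div1r -powR_inv1 ?(ltW c0)// -powRrM mulrNN mul1r.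
    by rewrite (ltW Dw).
  have aV0 : (0 <= a^-1)%R by rewrite invr_ge0 ltW.
  rewrite [leRHS]powRM ?powR_ge0// -powRrM /power_form [in leRHS]powRM ?powR_ge0 ?(ltW c0)//.
  rewrite -powRrM mulrA -/K0.
  have -> : (- kap^-1 * (a * p) = - eta - 1)%R.
    by rewrite kapE /a /eta; field; rewrite !gt_eqF.
  exact: lexx.
have cD : (c `^ (a * p) * D `^ (- eta) = c `^ (p - 1))%R.
  rewrite /D -powRrM -powRD; last by apply/implyP => _; rewrite gt_eqF.
  by congr (_ `^ _)%R; rewrite kapE /a /eta; field; rewrite !gt_eqF.
have aVp : (a^-1 `^ p * a `^ p = 1)%R.
  by rewrite -powRM ?invr_ge0 ?(ltW a0)// mulVf ?gt_eqF// powR1.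
have {}H : (a^-1 `^ p * ((p - 1) * c `^ (p - 1)) <= Cst `^ p)%R.
  have := ler_wpM2r (ltW e0) H; rewrite mulfVK ?gt_eqF//.
  apply: le_trans; rewrite -cD /K0 /eta le_eqVlt; apply/orP; left; apply/eqP.
  by field; rewrite !gt_eqF.
rewrite powRM ?(ltW a0)//.
have := ler_wpM2r (powR_ge0 a p) H; apply: le_trans.
by rewrite mulrAC aVp mul1r.
Qed.

End hardy_test.

Lemma hardy_norm_ge_power p q b c (Cst : R) : (1 < p)%R -> (p <= q)%R -> (0 < c)%R ->
  hardy_norm p q b <= Cst%:E -> dominates_power b c (q * (p - 1) / p)%R ->
  (K_ p q * c `^ ((p - 1) / p) <= Cst)%R.
Proof.
move=> p1; rewrite le_eqVlt => /predU1P[<-|pq] c0 NC dom; last first.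
  exact: hardy_norm_ge_bliss NC dom.
have p0 : (0 < p)%R by exact: lt_trans p1.
have p10 : (0 < p - 1)%R by rewrite subr_gt0.
have Cst0 : (0 <= Cst)%R by rewrite -lee_fin; apply: le_trans NC; exact: hardy_norm_ge0.
set L := (K_ p p * _)%R.
have L0 : (0 <= L)%R by rewrite mulr_ge0 ?powR_ge0// ltW// K_gt0.
have key e : (0 < e)%R -> (L <= Cst * (1 + e / (p - 1)))%R.
  move=> e0; have h := hardy_norm_ge_test p1 c0 e0 NC dom.
  have e1 : (0 <= 1 + e / (p - 1))%R by rewrite addr_ge0// divr_ge0// ltW.
  rewrite leNgt; apply/negP => lt.
  have := gt0_ltr_powR p0 (mulr_ge0 Cst0 e1) L0 lt.
  rewrite ltNge => /negP; apply.
  rewrite /L powRM ?powR_ge0 ?(ltW (K_gt0 p1 (lexx p)))// K_eq_powq// -powRrM.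
  have -> : ((p - 1) / p * p = p - 1)%R by rewrite divfK// gt_eqF.
  rewrite mulrAC.
  have -> : (Cst * (1 + e / (p - 1)) = Cst * ((p - 1 + e) / p) * (p / (p - 1)))%R.
    by field; rewrite !gt_eqF.
  have ae : (0 <= (p - 1 + e) / p)%R by rewrite divr_ge0 ?(ltW p0)// ltW// addr_gt0.
  have k0 : (0 <= p / (p - 1))%R by rewrite divr_ge0 ?(ltW p10) ?(ltW p0).
  rewrite [leRHS](powRM _ (mulr_ge0 Cst0 ae) k0); apply: ler_wpM2r; first exact: powR_ge0.
  exact: h.
apply/ler_addgt0Pr => d d0.
have C1 : (0 < Cst + 1)%R by rewrite ltr_wpDl.
(* With this [e] the excess is [d * Cst / (Cst + 1)], at most [d]; adding 1 keeps the denominator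
   positive when [Cst = 0]. *)
have := key (d * (p - 1) / (Cst + 1))%R.
rewrite !mulr_gt0 ?invr_gt0// => /(_ isT) /le_trans; apply.
have -> : (Cst * (1 + d * (p - 1) / (Cst + 1) / (p - 1)) = Cst + d * (Cst / (Cst + 1)))%R.
  by field; rewrite !gt_eqF.
by rewrite lerD2l ler_piMr ?(ltW d0)// ler_pdivrMr// mul1r lerDl.
Qed.

(** If [c0] were bounded below on a set of the filter by some [A] larger than the norm divided by
    [K_ p q], then [b] would dominate there the power form of constant [A ^ p'], whose lower bound
    is [K_ p q * A]. The filter is abstract so that 0 and infinity are treated together. *)
Lemma K_limf_einf_le p q b (F : set_system R) : (1 < p)%R -> (p <= q)%R ->
  (forall x, (0 < x)%R -> 0 <= b x) ->
  (forall V : set R, F V ->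
    (exists2 d, (0 < d)%R & forall x, (0 < x)%R -> (x < d)%R -> V x) \/
    (exists d, forall x, (0 < x)%R -> (d < x)%R -> V x)) ->
  (K_ p q)%:E * limf_einf (c0 p q b) F <= hardy_norm p q b.
Proof.
move=> p1 pq b0 HF; have p0 : (0 < p)%R by exact: lt_trans p1.
have q0 : (0 < q)%R by exact: lt_le_trans pq.
have K0 := K_gt0 p1 pq.
have := hardy_norm_ge0 p q b.
case N : (hardy_norm p q b) => [Cst| |]//; last by move=> _; rewrite leey.
rewrite lee_fin => Cst0.
have -> : Cst%:E = (K_ p q)%:E * (Cst / K_ p q)%:E.
  by rewrite -EFinM mulrC divfK// gt_eqF.
apply: lee_wpmul2l; first by rewrite lee_fin ltW.
rewrite limf_einfE; apply: ge_ereal_sup => _ [V FV <-].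
rewrite leNgt; apply/negP => lt.
have CK0 : (0 <= Cst / K_ p q)%R by rewrite divr_ge0// ltW.
(* The infimum itself serves when it is finite; when it is infinite, any larger real number than
   [Cst / K_ p q] does. *)
have [A CA AV] : exists2 A : R, (Cst / K_ p q < A)%R & A%:E <= ereal_inf (c0 p q b @` V).
  case: (ereal_inf _) lt => [i| |]//.
    by rewrite lte_fin => h; exists i.
  by move=> _; exists (Cst / K_ p q + 1)%R; rewrite ?ltrDl// leey.
have A0 : (0 < A)%R by exact: le_lt_trans CA.
have dV x : (0 < x)%R -> V x ->
    (power_form (A `^ (p / (p - 1))) (q * (p - 1) / p) x)%:E <= b x.
  move=> x0 Vx; rewrite -c0_ge ?b0//; apply: le_trans AV _.
  by apply: ereal_inf_lbound; exists x.
have dom : dominates_power b (A `^ (p / (p - 1)))%R (q * (p - 1) / p)%R.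
  case: (HF V FV) => [[d d0 H]|[d H]]; [left; exists d => //|right; exists d];
    by move=> x x0 xd; apply: dV => //; exact: H.
have NC : hardy_norm p q b <= Cst%:E by rewrite N.
have := hardy_norm_ge_power p1 pq (powR_gt0 _ A0) NC dom.
rewrite -powRrM; have -> : (p / (p - 1) * ((p - 1) / p) = 1)%R.
  by field; rewrite !gt_eqF// subr_gt0.
rewrite powRr1 ?(ltW A0)// mulrC -ler_pdivlMr// => h.
by have := le_lt_trans h CA; rewrite ltxx.
Qed.

Lemma K_A0_zero_le p q b : (1 < p)%R -> (p <= q)%R -> normal_form_parameter b ->
  (K_ p q)%:E * A0_zero p q b <= hardy_norm p q b.
Proof.
move=> p1 pq [_ b0]; apply: K_limf_einf_le => // V.
move=> /nbhs_ballP[d /= d0 H]; left; exists d => // x x0 xd.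
by apply: H => //; rewrite /ball/= sub0r normrN gtr0_norm.
Qed.

Lemma K_A0_infty_le p q b : (1 < p)%R -> (p <= q)%R -> normal_form_parameter b ->
  (K_ p q)%:E * A0_infty p q b <= hardy_norm p q b.
Proof.
move=> p1 pq [_ b0]; apply: K_limf_einf_le => // V.
by move=> [d [_ H]]; right; exists d => x _; exact: H.
Qed.

End lower_bounds.

Unset Implicit Arguments.

Theorem theorem3p12 (R : realType) (p q : R) (hp : (1 < p)%R) (hq : (0 < q)%R) :
  (forall (a b : R -> \bar R) (C : R),
     normal_form_parameter a -> normal_form_parameter b -> (0 < C)%R ->
     (forall x : R, (0 < x)%R -> a x <= C%:E * b x) ->
     hardy_norm p q a <=
       (C `^ (conj_exponent p)^-1)%:E * hardy_norm p q b) /\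
  ((p <= q)%R -> forall b : R -> \bar R, normal_form_parameter b ->
     maxe (A0 p q b)
       (maxe ((K_ p q)%:E * A0_zero p q b) ((K_ p q)%:E * A0_infty p q b))
       <= hardy_norm p q b /\
     hardy_norm p q b <= (K_ p q)%:E * A0 p q b) /\
  ((p <= q)%R -> forall b : R -> \bar R, normal_form_parameter b ->
     (A0 p q b = A0_zero p q b \/ A0 p q b = A0_infty p q b) ->
     hardy_norm p q b = (K_ p q)%:E * A0 p q b).
Proof.
have q0 := hq; split=> [a b C _ _ C0 ab|].
  exact: hardy_norm_homo.
have lower : (p <= q)%R -> forall b : R -> \bar R, normal_form_parameter b ->
    maxe (A0 p q b)
      (maxe ((K_ p q)%:E * A0_zero p q b) ((K_ p q)%:E * A0_infty p q b))
      <= hardy_norm p q b.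
  move=> pq b nb; rewrite !ge_max; apply/and3P; split.
  - exact: A0_le_hardy_norm.
  - exact: K_A0_zero_le.
  - exact: K_A0_infty_le.
split=> pq b nb; first by split; [exact: lower|exact: hardy_norm_le_A0].
move=> A0E; apply/eqP; rewrite eq_le hardy_norm_le_A0//=.
by case: A0E => ->; [exact: K_A0_zero_le|exact: K_A0_infty_le].
Qed.
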